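(* Let $Y=\{1,-1\}$ and let $V$ be the hinge loss $V(y,a)=\max\{1-ya,0\}$. Assume $\kappa:=\sup_{x\in X}\sqrt{K(x,x)}<\infty$, that (A3) holds with $\beta\in(0,1]$ and that (A4) holds with $\zeta\in(0,2)$. Let $\eta_t=\eta_1t^{-\theta}$ with $\frac12<\theta<1$ and $0<\eta_1\le\min\big\{\frac{\sqrt{1-\theta}}{\sqrt2(\kappa+1)},\frac{1-\theta}{4}\big\}$, and let $T=\lceil m^{\frac{1}{(1-\theta)(2\beta+1)}}\rceil$ (with $m$ such that $T\ge3$). Then there is a constant $\widetilde C>0$ independent of $m,\delta$ such that for every $\delta\in(0,1)$, with confidence $1-\delta$, $$\mathcal R(\mathrm{sign}(f_T))-\mathcal R(f_c)\le\widetilde C\,m^{-\frac{\beta}{2\beta+1}}\log\frac2\delta.$$ In particular, if $\epsilon\in(0,\frac13)$ and $\beta>\frac{1-3\epsilon}{1+6\epsilon}$, then with confidence $1-\delta$, $\mathcal R(\mathrm{sign}(f_T))-\mathcal R(f_c)\le\widetilde C\,m^{\epsilon-\frac13}\log\frac2\delta$.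
   Context: Setting. $X$ is a separable metric space, $Y\subseteq\mathbb{R}$, $Z=X\times Y$, and $\rho$ is a Borel probability measure on $Z$. A loss $V:\mathbb{R}\times\mathbb{R}\to[0,\infty)$ is measurable and convex in its second argument; $V'_-(y,a)$ denotes the left derivative of $a\mapsto V(y,a)$. The expected risk is $\mathcal{E}(f)=\int_Z V(y,f(x))\,d\rho(x,y)$, and it is assumed that there is a measurable $f_\rho^V:X\to\mathbb{R}$ minimizing $\mathcal{E}$ over all measurable functions. A sample $\mathbf{z}=\{(x_i,y_i)\}_{i=1}^m$ is drawn i.i.d. from $\rho$, and $\mathcal{E}_{\mathbf z}(f)=\frac1m\sum_{i=1}^m V(y_i,f(x_i))$ is the empirical risk. $K:X\times X\to\mathbb{R}$ is a reproducing kernel (symmetric, with positive semidefinite Gram matrices) with reproducing kernel Hilbert space $(\mathcal{H}_K,\|\cdot\|_K)$, $K_x=K(x,\cdot)$, and $B_R=\{f\in\mathcal{H}_K:\|f\|_K\le R\}$. Given step sizes $\eta_t>0$, the iterates are $f_1=0$ and $f_{t+1}=f_t-\eta_t\frac1m\sum_{j=1}^m V'_-(y_j,f_t(x_j))K_{x_j}$ for $t=1,\dots,T$, where $T$ is the stopping iteration. ''With confidence $1-\delta$'' means with probability at least $1-\delta$ over the draw of $\mathbf z\sim\rho^m$. Classification: for $b:X\to\{1,-1\}$ the misclassification risk is $\mathcal R(b)=\rho(\{(x,y)\in Z:y\ne b(x)\})$; $f_c$ is the Bayes rule, $f_c(x)=1$ if $\rho(y=1\mid x)\ge\frac12$ and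 $f_c(x)=-1$ otherwise (for the hinge loss, $f_\rho^V=f_c$); $\mathrm{sign}(f)(x)=1$ if $f(x)\ge0$ and $-1$ otherwise. Assumption (A3) (approximation error): for $\lambda>0$ let $f_\lambda$ be a minimizer over $\mathcal H_K$ of $\mathcal{E}(f)+\lambda\|f\|_K^2$ and $\mathcal{D}(\lambda)=\mathcal{E}(f_\lambda)-\mathcal{E}(f_\rho^V)+\lambda\|f_\lambda\|_K^2$; there are $\beta\in(0,1]$, $c_\beta>0$ with $\mathcal{D}(\lambda)\le c_\beta\lambda^\beta$ for all $\lambda>0$. Assumption (A4) (capacity): with $d_{2,\mathbf z}(f,g)=\big(\frac1m\sum_{i=1}^m(f(x_i)-g(x_i))^2\big)^{1/2}$ and $\mathcal N(\mathcal G,\epsilon,d)$ the $\epsilon$-covering number of $\mathcal G$ in the metric $d$, there are $\zeta\in(0,2)$, $c_\zeta>0$ with $\mathbb{E}_{\mathbf z}[\log\mathcal N(B_1,\epsilon,d_{2,\mathbf z})]\le c_\zeta\epsilon^{-\zeta}$ for all $\epsilon>0$. *)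

(* Defs.v *)
From HB Require Import structures.
From mathcomp Require Import all_boot all_order all_algebra.
From mathcomp Require Import all_classical all_reals all_analysis.

Set Implicit Arguments.
Unset Strict Implicit.
Unset Printing Implicit Defensive.

Import Order.TTheory GRing.Theory Num.Theory.
Import numFieldNormedType.Exports.

Local Open Scope classical_set_scope.
Local Open Scope ring_scope.

Section Defs.
Variable R : realType.

Definition hinge (y a : R) : R := Num.max (1 - y * a) 0.

Definition left_deriv (V : R -> R -> R) (y a : R) : R :=
  lim ((fun h : R => (V y a - V y (a - h)) / h) @ 0^'+).

Definition BorelX (X : pseudoPMetricType R) := g_sigma_algebraType (@open X).

Definition kernel_sym {X : Type} (K : X -> X -> R) := forall x y, K x y = K y x.
Definition kernel_psd {X : Type} (K : X -> X -> R) :=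
  forall (n : nat) (xs : 'I_n -> X) (c : 'I_n -> R),
    0 <= \sum_(i < n) \sum_(j < n) c i * c j * K (xs i) (xs j).

Definition rknorm {X : Type} (ip : (X -> R) -> (X -> R) -> R) (f : X -> R) : R :=
  Num.sqrt (ip f f).

(** (H, ip) is the reproducing kernel Hilbert space of K: a linear space of
    real functions on X with an inner product, complete for the induced norm,
    containing every K_x = K x and with the reproducing property.
    (Such a Hilbert space is unique.) *)
Record is_RKHS {X : Type} (K : X -> X -> R) (H : set (X -> R))
    (ip : (X -> R) -> (X -> R) -> R) : Prop := {
  rk_0 : H (fun _ => 0);
  rk_add : forall f g, H f -> H g -> H (fun x => f x + g x);
  rk_scale : forall (a : R) f, H f -> H (fun x => a * f x);
  rk_sym : forall f g, H f -> H g -> ip f g = ip g f;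
  rk_lin : forall (a : R) f g h, H f -> H g -> H h ->
      ip (fun x => a * f x + g x) h = a * ip f h + ip g h;
  rk_pos : forall f, H f -> 0 <= ip f f;
  rk_def : forall f, H f -> ip f f = 0 -> f = (fun _ => 0);
  rk_complete : forall u : nat -> X -> R, (forall n, H (u n)) ->
      (forall e : R, 0 < e -> exists N : nat, forall n k : nat, (N <= n)%N -> (N <= k)%N ->
          rknorm ip (fun x => u n x - u k x) < e) ->
      exists g, H g /\ (fun n => rknorm ip (fun x => u n x - g x)) @ \oo --> (0 : R);
  rk_kern : forall x, H (K x);
  rk_repr : forall f x, H f -> f x = ip f (K x) }.

Definition unit_ball {X : Type} (H : set (X -> R)) (ip : (X -> R) -> (X -> R) -> R) :=
  [set f | H f /\ rknorm ip f <= 1].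

Definition kappa {X : Type} (K : X -> X -> R) : R := sup (range (fun x => Num.sqrt (K x x))).

Definition d2 {X : Type} (m : nat) (xs : 'I_m -> X) (f g : X -> R) : R :=
  Num.sqrt (m%:R^-1 * \sum_(i < m) (f (xs i) - g (xs i)) ^+ 2).

Definition is_cover {X : Type} (S : set (X -> R)) (eps : R)
    (d : (X -> R) -> (X -> R) -> R) (n : nat) :=
  exists c : 'I_n -> X -> R, (forall i, S (c i)) /\
    forall f, S f -> exists i, d f (c i) <= eps.

(** Covering number N(S, eps, d) (+oo if no finite cover) and its logarithm. *)
Definition covering_number {X : Type} (S : set (X -> R)) (eps : R)
    (d : (X -> R) -> (X -> R) -> R) : \bar R :=
  ereal_inf [set (n%:R)%:E | n in [set n | is_cover S eps d n]].

Definition log_covering_number {X : Type} (S : set (X -> R)) (eps : R)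
    (d : (X -> R) -> (X -> R) -> R) : \bar R :=
  match covering_number S eps d with
  | EFin r => (ln r)%:E
  | _ => +oo%E
  end.

Definition iid_sample {dO dT} {Omega : measurableType dO} {T : measurableType dT}
    (P : probability Omega R) (rho : probability T R) (m : nat)
    (Zs : 'I_m -> Omega -> T) : Prop :=
  (forall i, measurable_fun [set: Omega] (Zs i)) /\
  (forall i (A : set T), measurable A -> P (Zs i @^-1` A) = rho A) /\
  (forall A : 'I_m -> set T, (forall i, measurable (A i)) ->
     P (\bigcap_(i in [set: 'I_m]) (Zs i @^-1` A i)) =
     (\prod_(i < m) P (Zs i @^-1` A i))%E).

Definition with_confidence {dO} {Omega : measurableType dO}
    (P : probability Omega R) (delta : R) (E : set Omega) : Prop :=
  exists A, measurable A /\ A `<=` E /\ ((1 - delta)%:E <= P A)%E.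

Definition exp_risk {dX} {X : measurableType dX} (rho : probability (X * R)%type R)
    (V : R -> R -> R) (f : X -> R) : \bar R :=
  (\int[rho]_z (V z.2 (f z.1))%:E)%E.

Definition mis_risk {dX} {X : measurableType dX} (rho : probability (X * R)%type R)
    (b : X -> R) : R :=
  fine (rho [set z | z.2 <> b z.1]).

Definition sign {X : Type} (f : X -> R) : X -> R := fun x => if 0 <= f x then 1 else -1.

Definition cond_prob_one {dX} {X : measurableType dX} (rho : probability (X * R)%type R)
    (eta : X -> R) : Prop :=
  measurable_fun [set: X] eta /\ (forall x, 0 <= eta x <= 1) /\
  forall A : set X, measurable A ->
    rho (A `*` [set 1]) = (\int[rho]_(z in A `*` [set: R]) (eta z.1)%:E)%E.

Definition bayes_rule {X : Type} (eta : X -> R) : X -> R :=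
  fun x => if 2^-1 <= eta x then 1 else -1.

Definition stepsize (eta1 theta : R) (t : nat) : R := eta1 * (t%:R `^ (- theta)).

(** gd_iter n = f_{n+1}: f_1 = 0,
    f_{t+1} = f_t - eta_t (1/m) sum_j V'_-(y_j, f_t(x_j)) K_{x_j}. *)
Fixpoint gd_iter {X : Type} (K : X -> X -> R) (V' : R -> R -> R) (eta : nat -> R)
    (m : nat) (xs : 'I_m -> X) (ys : 'I_m -> R) (n : nat) : X -> R :=
  match n with
  | 0 => fun _ => 0
  | n'.+1 =>
      let f := gd_iter K V' eta xs ys n' in
      fun x => f x - eta n'.+1 * (m%:R^-1 * \sum_(j < m) V' (ys j) (f (xs j)) * K (xs j) x)
  end.

End Defs.

(* Main.v *)
(** Write Lambda = T^(1-theta), which is of order m^(1/(2 beta + 1)), lambda = 1/Lambda, and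
    let E, E_z be the expected and the empirical hinge risk. The subgradient inequality for
    ||f_(t+1) - f||^2 keeps all iterates in a ball of radius O(sqrt Lambda). Comparing averages
    of the risks over the last k iterates, for k = 1, ..., T, turns the same inequality into a
    bound for the last one:
    E_z(f_T) - E_z(f_lambda) = O(lambda ||f_lambda||^2 + lambda + Delta) as soon as
    E_z(f_t) - E_z(f_lambda) >= - Delta for all t <= T. Uniform deviation bounds on the ball give
    such a Delta of order lambda^beta + sqrt(Lambda/m) log(2/delta), and the comparison theorem
    for the hinge loss passes from excess risk to excess misclassification risk.

    The deviation bounds come from a direct exponential symmetrization: integrating out one
    sample point at a time, the contraction principle replaces the loss by f(x) = <f, K_x>, so
    that the supremum over the ball is controlled by the potential
    h |-> exp (sqrt (1 + r^2 ||h||^2)) on the Hilbert space. No chaining is needed, and the capacity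
    assumption (A4) only serves measurability. As K is not assumed to be jointly measurable,
    x |-> K_x might have non-separable essential range, and then the supremum over the ball
    could not be reduced to a countable family. But if K_x is at distance at least c from the
    span of any countable set of K_(x') with positive probability, a random sample contains
    proportionally many points each far from the span of those that follow it, and the 2^k sign
    combinations of the k orthonormal directions so obtained force covering numbers exponential
    in k, against (A4). *)

Require Import Defs.
From HB Require Import structures.
From mathcomp Require Import all_boot all_order all_algebra.
From mathcomp Require Import all_classical all_reals all_analysis.
From mathcomp Require Import measurable_realfun ring lra.

Set Implicit Arguments.
Unset Strict Implicit.
Unset Printing Implicit Defensive.

Import Order.TTheory GRing.Theory Num.Theory.
Import numFieldNormedType.Exports.

Local Open Scope classical_set_scope.
Local Open Scope ring_scope.

(** * Last iterates *)

(** The choice of T balances two errors: with a ball of radius sqrt Lambda, a deviation of order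
    sqrt (Lambda / m) equals lambda^beta = m^(-beta/(2 beta + 1)) up to constants. The condition
    theta > 1/2 makes the squared step sizes summable, so the quadratic term of the subgradient
    inequality costs O(1) in the squared norm and O(1/Lambda) in the last-iterate bound. The lower
    bound - Delta uses only the optimality of the Bayes rule: E(f_t) >= E(f_c) >= E(f_lambda) -
    c_beta lambda^beta. Hence E - E_z has to be bounded from above uniformly on the ball, but E_z -
    E only at the single function f_lambda. Adding Delta makes the empirical excess nonnegative,
    which the comparison of averages needs because the step sizes decrease. In the separability
    argument neither the points far from a span, nor the separated samples, nor the covering numbers
    are known to be measurable. Measurable hulls, a probability carried by a possibly nonmeasurable
    set, and monotonicity of the integral without measurability replace the usual steps. *)

Lemma last_iterate_decomposition {R : realFieldType} (eta b : nat -> R) (G : R) (T : nat) :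
  (forall s t, (1 <= s <= t)%N -> eta t <= eta s) ->
  (forall t, (1 <= t <= T)%N -> 0 <= b t) ->
  (forall s, (1 <= s <= T)%N ->
     \sum_(s <= t < T.+1) eta t * (b t - b s) <= G * \sum_(s <= t < T.+1) eta t ^+ 2) ->
  (0 < T)%N ->
  eta T * b T <= T%:R^-1 * (\sum_(1 <= t < T.+1) eta t * b t)
     + G * \sum_(1 <= k < T) (k%:R * k.+1%:R)^-1 * \sum_(T - k <= t < T.+1) eta t ^+ 2.
Proof.
move=> eta_dec b_ge0 Hs T_gt0.
(* the average over the last k indices: W 1 is the last term, W T the full average *)
pose W k := k%:R^-1 * \sum_(T.+1 - k <= t < T.+1) eta t * b t.
(* The window of length k + 1 adds the index s = T - k, and k (k + 1) (W k - W (k + 1)) is the sum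
   of eta t b t - eta s b s over the window of length k. This is compared with the hypothesis [Hs]
   at s. *)
have step k : (0 < k < T)%N ->
    W k <= W k.+1 + G * ((k%:R * k.+1%:R)^-1 * \sum_(T - k <= t < T.+1) eta t ^+ 2).
  move=> /andP[k0 kT].
  have k0R : 0 < k%:R :> R by rewrite ltr0n.
  rewrite /W subSS.
  have -> : \sum_(T - k <= t < T.+1) eta t * b t
     = eta (T - k)%N * b (T - k)%N + \sum_(T.+1 - k <= t < T.+1) eta t * b t.
    by rewrite big_ltn ?ltnS ?leq_subr// -subSn ?(ltnW kT)//.
  set s := (T - k)%N; set A := \sum_(T.+1 - k <= t < T.+1) eta t * b t.
  set Q := \sum_(s <= t < T.+1) eta t ^+ 2.
  have s1 : (1 <= s <= T)%N by rewrite /s subn_gt0 kT leq_subr.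
  have H1 : A - k%:R * (eta s * b s) <= G * Q.
    apply: le_trans (Hs s s1).
    rewrite big_ltn; last by case/andP: s1.
    rewrite subrr mulr0 add0r.
    have -> : k%:R * (eta s * b s) = \sum_(T.+1 - k <= t < T.+1) eta s * b s.
      by rewrite sumr_const_nat subKn ?mulr_natl// ltnW// ltnW.
    rewrite /A -sumrB (_ : T.+1 - k = s.+1)%N; last by rewrite /s subSn// ltnW.
    apply: ler_sum_nat => t /andP[st tT].
    (* Since b s >= 0, eta t <= eta s allows eta t b s to be replaced by the larger eta s b s. *)
    rewrite mulrBr lerB// ler_wpM2r// ?b_ge0// eta_dec//.
    by case/andP: s1 => -> _; rewrite ltnW.
  rewrite -(@ler_pM2l _ (k%:R * k.+1%:R)); last by rewrite mulr_gt0.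
  have k1 : k.+1%:R != 0 :> R by [].
  have k00 : k%:R != 0 :> R by rewrite gt_eqF.
  rewrite mulrDr.
  have -> : k%:R * k.+1%:R * (k%:R^-1 * A) = k.+1%:R * A by field.
  have -> : k%:R * k.+1%:R * (k.+1%:R^-1 * (eta s * b s + A)) = k%:R * (eta s * b s + A).
    by move: (k.+1%:R : R) (k%:R : R) k1 k00 => x y x0 y0; field; rewrite ?x0 ?y0.
  have -> : k%:R * k.+1%:R * (G * ((k%:R * k.+1%:R)^-1 * Q)) = G * Q.
    by move: (k.+1%:R : R) (k%:R : R) k1 k00 => x y x0 y0; field; rewrite ?x0 ?y0.
  rewrite -natr1; lra.
have W1 : W 1 = eta T * b T by rewrite /W invr1 mul1r subn1 big_nat1.
have WT : W T = T%:R^-1 * (\sum_(1 <= t < T.+1) eta t * b t) by rewrite /W subSnn.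
rewrite -W1 -WT mulr_sumr.
have main n : (1 <= n <= T)%N -> W 1 <= W n + \sum_(1 <= k < n)
   G * ((k%:R * k.+1%:R)^-1 * \sum_(T - k <= t < T.+1) eta t ^+ 2).
  elim: n => // -[_ _|n IH /andP[_ nT]]; first by rewrite big_geq// addr0.
  rewrite big_nat_recr//= addrA addrAC.
  apply: le_trans (IH (ltnW nT)) _.
  by rewrite lerD2r step.
by apply: main; rewrite T_gt0 leqnn.
Qed.

(** * Sums of powers and the rate of the last iterate *)

Section power_sums.
Variable R : realType.
Implicit Types (p u : R).

(** Discrete form of the comparison with an integral. Divided by (j+2)^(-s), it becomes (1 - x)^(-s)
    >= 1 + s x for x = 1/(j+2), which follows from e^y >= 1 + y and ln (1 - x) <= - x. *)
Lemma powR_prev_ge (s : R) (j : nat) : 0 < s ->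
  s * (j.+2%:R `^ (- (s + 1))) <= j.+1%:R `^ (- s) - j.+2%:R `^ (- s).
Proof.
move=> s0.
have j2 : 0 < j.+2%:R :> R by [].
have x1 : 0 < j.+1%:R / j.+2%:R :> R by rewrite divr_gt0.
have -> : j.+1%:R = j.+2%:R * (j.+1%:R / j.+2%:R) :> R by rewrite mulrC divfK// gt_eqF.
rewrite powRM ?(ltW j2) ?(ltW x1)//.
have -> : j.+2%:R `^ (- (s + 1)) = j.+2%:R `^ (- s) * j.+2%:R^-1 :> R.
  by rewrite opprD powRD ?pnatr_eq0 ?implybT// powR_inv1.
rewrite mulrCA -[X in _ <= _ - X]mulr1 -mulrBr ler_wpM2l ?powR_ge0//.
have L : j.+2%:R^-1 <= - ln (j.+1%:R / j.+2%:R) :> R.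
  rewrite lerNr.
  have E : j.+1%:R / j.+2%:R = 1 + (- j.+2%:R^-1) :> R.
    rewrite (_ : j.+1%:R = j.+2%:R - 1); last by rewrite -[in RHS]natr1 addrK.
    by rewrite mulrBl divff// mul1r.
  by rewrite E le_ln1Dx// ltrN2 invf_lt1// ltr1n.
rewrite /powR gt_eqF//.
apply: le_trans (lerB (expR_ge1Dx _) (lexx _)).
have := ler_wpM2l (ltW s0) L.
by rewrite addrAC subrr add0r mulNr mulrN.
Qed.

(** Concavity would give the constant u; the factor 1/2 is the price of the elementary bounds on the
    exponential, and is harmless in the telescoping sum. *)
Lemma powR_diff_ge u (j : nat) : 0 < u <= 1 ->
  u / 2 * (j.+1%:R `^ (u - 1)) <= j.+1%:R `^ u - j%:R `^ u.
Proof.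
move=> /andP[u0 u1].
case: j => [|j].
  by rewrite !powR1 powR0 ?gt_eqF//; lra.
have j2 : 0 < j.+2%:R :> R by [].
set x := j.+2%:R^-1 : R.
have x0 : 0 < x by rewrite invr_gt0.
have x1 : x <= 2^-1 by rewrite lef_pV2 ?posrE// ler_nat.
have -> : j.+1%:R = j.+2%:R * (1 - x) :> R.
  by rewrite mulrBr mulr1 divff ?gt_eqF// -[in RHS]natr1 addrK.
rewrite powRM ?(ltW j2)//; last lra.
have -> : j.+2%:R `^ (u - 1) = j.+2%:R `^ u * x :> R.
  by rewrite powRD ?pnatr_eq0 ?implybT// powR_inv1.
rewrite mulrCA -[X in _ <= X - _]mulr1 -mulrBr ler_wpM2l ?powR_ge0//.
(* e^{-ux} <= 1/(1+ux) <= 1 - ux/2 *)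
have ux : 0 < u * x <= 1 by apply/andP; split; nra.
suff : (1 - x) `^ u <= 1 - u * x / 2 by lra.
apply: (@le_trans _ _ (expR (- (u * x)))).
  rewrite /powR gt_eqF; last lra.
  rewrite ler_expR -mulrN ler_wpM2l ?(ltW u0)// le_ln1Dx//; lra.
apply: (@le_trans _ _ (1 + u * x)^-1).
  by rewrite expRN lef_pV2 ?posrE ?expR_gt0 ?expR_ge1Dx//; lra.
rewrite -[leLHS]mul1r ler_pdivrMr; last lra.
nra.
Qed.

Lemma sum_powRN_le p n : 1 < p ->
  \sum_(1 <= j < n.+1) j%:R `^ (- p) <= 1 + (p - 1)^-1 :> R.
Proof.
move=> p1.
have s0 : 0 < p - 1 by lra.
case: n => [|n]; first by rewrite big_geq// addr_ge0// invr_ge0 ltW.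
(* Subtracting the tail (p - 1)^-1 (n + 1)^(1 - p) strengthens the claim so that the induction
   telescopes. *)
suff : \sum_(1 <= j < n.+2) j%:R `^ (- p) <= 1 + (p - 1)^-1 * (1 - n.+1%:R `^ (- (p - 1))).
  move/le_trans; apply; rewrite lerD2l -[leRHS]mulr1 ler_wpM2l ?invr_ge0 ?(ltW s0)//.
elim: n => [|n IH]; first by rewrite big_nat1 !powR1 subrr mulr0 addr0.
rewrite big_nat_recr//=; apply: le_trans (lerD IH (lexx _)) _.
have := @powR_prev_ge (p - 1) n s0; rewrite subrK.
rewrite -ler_pdivlMl// => /(lerD (lexx (1 + (p - 1)^-1 * (1 - n.+1%:R `^ (- (p - 1)))))) /le_trans; apply.
by rewrite -addrA -mulrDr [X in _ * X](_ : _ = 1 - n.+2%:R `^ (- (p - 1)))//; lra.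
Qed.

Lemma sum_powR_le u n : 0 < u <= 1 ->
  \sum_(1 <= j < n.+1) j%:R `^ (u - 1) <= 2 / u * n%:R `^ u :> R.
Proof.
move=> /andP[u0 u1].
elim: n => [|n IH]; first by rewrite big_geq// mulr_ge0 ?powR_ge0// divr_ge0// ltW.
rewrite big_nat_recr//=; apply: le_trans (lerD IH (lexx _)) _.
have := @powR_diff_ge u n; rewrite u0 u1 => /(_ isT).
rewrite -(@ler_pM2l _ (2 / u)) ?divr_gt0// mulrA.
rewrite (_ : 2 / u * (u / 2) = 1) ?mul1r; last by field; rewrite gt_eqF.
by rewrite mulrBr; lra.
Qed.

(** For j = T - k, the identity 1/(k j) = (1/k + 1/j)/T extracts the factor 1/T. The remaining mixed
    term k^-1 j^(1-p) is at most k^(-p) or j^(-p), according to which of k and j is larger, so three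
    convergent sums remain. *)
Lemma sum_inv_powRN_le p (T : nat) : 1 < p -> (0 < T)%N ->
  \sum_(1 <= k < T) k%:R^-1 * (T - k)%:R `^ (- p) <= 3 * (1 + (p - 1)^-1) / T%:R :> R.
Proof.
move=> p1 T0.
have T0R : 0 < T%:R :> R by rewrite ltr0n.
have bound k : (1 <= k < T)%N -> k%:R^-1 * (T - k)%:R `^ (- p) <=
    T%:R^-1 * (2 * (T - k)%:R `^ (- p) + k%:R `^ (- p)) :> R.
  move=> /andP[k0 kT].
  have kR : 0 < k%:R :> R by rewrite ltr0n.
  have jR : 0 < (T - k)%:R :> R by rewrite ltr0n subn_gt0.
  set j := (T - k)%N in jR *.
  have jE : (T%:R = k%:R + j%:R :> R) by rewrite -natrD subnKC// ltnW.
  have E x : 0 < x :> R -> x `^ (- p) = x^-1 * x `^ (1 - p).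
    move=> x0; rewrite -(@powR_inv1 _ x) ?ltW// -powRD ?(gt_eqF x0) ?implybT//.
    by congr (_ `^ _); ring.
  have M : k%:R^-1 * j%:R `^ (1 - p) <= k%:R `^ (- p) + j%:R `^ (- p) :> R.
    have [kj|jk] := leP (k%:R : R) (j%:R : R).
      apply: (@le_trans _ _ (k%:R `^ (- p))); last by rewrite lerDl powR_ge0.
      rewrite (E k%:R)// ler_wpM2l ?invr_ge0 ?ler0n//.
      rewrite -[1 - p]opprB !powRN lef_pV2 ?posrE ?powR_gt0//.
      by apply: ge0_ler_powR; rewrite ?nnegrE ?ler0n//; lra.
    apply: (@le_trans _ _ (j%:R `^ (- p))); last by rewrite lerDr powR_ge0.
    by rewrite (E j%:R)// ler_wpM2r ?powR_ge0// lef_pV2 ?posrE// ltW.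
  have -> : k%:R^-1 * j%:R `^ (- p) = T%:R^-1 * (j%:R `^ (- p) + k%:R^-1 * j%:R `^ (1 - p)) :> R.
    by rewrite (E j%:R)// jE; field; rewrite !gt_eqF// addr_gt0.
  rewrite ler_wpM2l ?invr_ge0 ?ler0n//.
  by rewrite mulr_natl mulr2n; lra.
apply: le_trans (ler_sum_nat bound) _.
rewrite -mulr_sumr mulrC ler_wpM2r ?invr_ge0 ?ler0n// big_split/= -mulr_sumr.
have C := sum_powRN_le T.-1 p1; rewrite prednK// in C.
rewrite big_nat_rev/=.
rewrite (eq_big_nat _ _ (F2 := fun k => k%:R `^ (- p) : R)); last first.
  by move=> k /andP[k1 kT]; rewrite add1n subSS subKn// ltnW.
by lra.
Qed.

(** Division by eta T = eta1 T^(1-theta) / T turns the O(1/T) terms into O(T^(theta-1)). The shift D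
    comes multiplied by the sum of the step sizes, itself O(T^(1-theta)), and so only costs a
    constant. The condition 2 theta > 1 enters through [sum_inv_powRN_le] with p = 2 theta. *)
Lemma last_iterate_rate (theta eta1 G : R) : 2^-1 < theta < 1 -> 0 < eta1 -> 0 <= G ->
  exists2 C : R, 0 < C & forall (T : nat) (b : nat -> R) (W D : R),
  (0 < T)%N -> 0 <= W -> 0 <= D ->
  (forall t, (1 <= t <= T)%N -> 0 <= b t) ->
  (forall s, (1 <= s <= T)%N ->
     \sum_(s <= t < T.+1) stepsize eta1 theta t * (b t - b s)
       <= G * \sum_(s <= t < T.+1) stepsize eta1 theta t ^+ 2) ->
  \sum_(1 <= t < T.+1) stepsize eta1 theta t * b t
     <= W + D * \sum_(1 <= t < T.+1) stepsize eta1 theta t ->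
  b T <= C * ((W + 1) / T%:R `^ (1 - theta) + D).
Proof.
move=> /andP[th2 th1] eta0 G0.
pose Cp := 1 + (2 * theta - 1)^-1.
have Cp0 : 0 < Cp by rewrite addr_gt0// invr_gt0; lra.
exists (eta1^-1 + 3 * G * eta1 * Cp + 2 / (1 - theta)).
  rewrite addr_gt0 ?divr_gt0 ?subr_gt0 ?ltr_wpDr ?invr_gt0 //.
  by rewrite !mulr_ge0 // ltW.
move=> T b W D T0 W0 D0 b0 Hs HW.
have T0R : 0 < T%:R :> R by rewrite ltr0n.
set eta := stepsize eta1 theta in Hs HW *.
have eta_dec s t : (1 <= s <= t)%N -> eta t <= eta s.
  move=> /andP[s1 st]; rewrite /eta /stepsize ler_pM2l// !powRN.
  rewrite lef_pV2 ?posrE ?powR_gt0 ?ltr0n//; last exact: leq_trans st.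
  by apply: ge0_ler_powR; rewrite ?nnegrE ?ler_nat//; lra.
have := last_iterate_decomposition eta_dec b0 Hs T0.
set Q := \sum_(1 <= k < T) _.
have HQ : Q <= eta1 ^+ 2 * (3 * Cp / T%:R).
  apply: (@le_trans _ _ (eta1 ^+ 2 * \sum_(1 <= k < T) k%:R^-1 * (T - k)%:R `^ (- (2 * theta)))); last first.
    by rewrite ler_wpM2l ?sqr_ge0// sum_inv_powRN_le//; lra.
  rewrite mulr_sumr; apply: ler_sum_nat => k /andP[k1 kT].
  have kR : 0 < k%:R :> R by rewrite ltr0n.
  (* The window from T - k to T has k + 1 terms, each at most the square of the first step size;
     this cancels one factor of k (k + 1). *)
  apply: (@le_trans _ _ ((k%:R * k.+1%:R)^-1 * (k.+1%:R * eta (T - k)%N ^+ 2))).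
    rewrite ler_wpM2l ?invr_ge0 ?mulr_ge0 ?ler0n//.
    have -> : k.+1%:R * eta (T - k)%N ^+ 2 = \sum_(T - k <= t < T.+1) eta (T - k)%N ^+ 2.
      by rewrite sumr_const_nat subSn ?leq_subr// subKn ?mulr_natl// ltnW.
    apply: ler_sum_nat => t /andP[tk tT].
    rewrite ler_sqr ?nnegrE ?mulr_ge0 ?powR_ge0 ?(ltW eta0)//.
    by apply: eta_dec; rewrite subn_gt0 kT.
  rewrite /eta /stepsize exprMn -(@powR_mulrn _ (_ `^ _)) ?powR_ge0// -powRrM.
  rewrite (_ : - theta * 2 = - (2 * theta)); last by ring.
  rewrite le_eqVlt; apply/orP; left; apply/eqP.
  by rewrite -natr1; field; rewrite gt_eqF// natr1 pnatr_eq0.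
set S := \sum_(1 <= t < T.+1) eta t in HW.
have HS : S <= eta1 * (2 / (1 - theta) * T%:R `^ (1 - theta)).
  rewrite /S -mulr_sumr ler_pM2l//.
  have := @sum_powR_le (1 - theta) T; rewrite (_ : 1 - theta - 1 = - theta); last by ring.
  by apply; apply/andP; split; lra.
move=> main.
have main2 : eta T * b T <= T%:R^-1 * (W + D * (eta1 * (2 / (1 - theta) * T%:R `^ (1 - theta))))
     + G * (eta1 ^+ 2 * (3 * Cp / T%:R)).
  apply: le_trans main _; apply: lerD; last by rewrite ler_wpM2l.
  rewrite ler_wpM2l ?invr_ge0 ?ler0n//; apply: le_trans HW _.
  by rewrite lerD2l ler_wpM2l.
set u := T%:R `^ (1 - theta) in main2 *.
have u0 : 0 < u by rewrite powR_gt0.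
have etaT : eta T = eta1 * u / T%:R.
  rewrite /eta /stepsize -mulrA; congr (_ * _).
  rewrite /u powRD ?(gt_eqF T0R) ?implybT// powRr1 ?ltW//.
  by field; rewrite gt_eqF.
rewrite etaT in main2.
have main3 : b T <= (eta1^-1 * W + 3 * G * eta1 * Cp) / u + 2 / (1 - theta) * D.
  rewrite -(@ler_pM2l _ (eta1 * u / T%:R)); last by rewrite divr_gt0// mulr_gt0.
  apply: le_trans main2 _.
  rewrite le_eqVlt; apply/orP; left; apply/eqP; field.
  by rewrite !gt_eqF//; lra.
apply: le_trans main3 _.
have ui : 0 < u^-1 by rewrite invr_gt0.
have e1 : 0 < eta1^-1 by rewrite invr_gt0.
have g1 : 0 <= 3 * G * eta1 * Cp by rewrite !mulr_ge0// ltW.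
have g2 : 0 < 2 / (1 - theta) by rewrite divr_gt0//; lra.
move: (3 * _ * _ * _) (2 / _) (u^-1) (eta1^-1) g1 g2 ui e1 => a c d e a0 c0 d0 e0.
have h1 := mulr_ge0 (ltW e0) D0; have h2 := mulr_ge0 (ltW e0) (ltW d0).
have h3 := mulr_ge0 (mulr_ge0 a0 W0) (ltW d0); have h4 := mulr_ge0 a0 D0.
have h5 := mulr_ge0 (mulr_ge0 (ltW c0) W0) (ltW d0); have h6 := mulr_ge0 (ltW c0) (ltW d0).
lra.
Qed.
End power_sums.

(** * Reproducing kernel Hilbert spaces *)

(** An alias carrying the module structure: its operations are convertible to the pointwise
    expressions in [is_RKHS], so the fields of that record apply directly to [+] and [*:]. *)
Definition fct_lmod (R : realType) (X : Type) : lmodType R := (X -> R)%type.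

Lemma fct_lmodD (R : realType) (X : Type) (f g : fct_lmod R X) (x : X) :
  (f + g) x = f x + g x.
Proof. by []. Qed.

Lemma fct_lmodN (R : realType) (X : Type) (f : fct_lmod R X) (x : X) :
  (- f) x = - f x.
Proof. by []. Qed.

Lemma fct_lmodZ (R : realType) (X : Type) (a : R) (f : fct_lmod R X) (x : X) :
  (a *: f) x = a * f x.
Proof. by []. Qed.

Lemma fct_lmod_sum (R : realType) (X I : Type) (r : seq I) (F : I -> fct_lmod R X) (x : X) :
  (\sum_(i <- r) F i) x = \sum_(i <- r) F i x.
Proof. by elim: r => [|i r IH]; rewrite ?big_nil// !big_cons fct_lmodD IH. Qed.

Definition fct_lmodE := (fct_lmodN, fct_lmodD, fct_lmodZ, fct_lmod_sum).

Section rkhs.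
Context {R : realType} {X : Type} {K : X -> X -> R} {H : set (X -> R)}
  {ip : (X -> R) -> (X -> R) -> R} (HK : is_RKHS K H ip).
Local Notation V := (fct_lmod R X).
Implicit Types f g h : V.

Local Notation N := (rknorm ip).

Lemma rkhs0 : H 0. Proof. exact: (rk_0 HK). Qed.

Lemma rkhsD f g : H f -> H g -> H (f + g). Proof. exact: (rk_add HK). Qed.

Lemma rkhsZ a f : H f -> H (a *: f). Proof. exact: (rk_scale HK). Qed.

Lemma rkhsN f : H f -> H (- f).
Proof. by move=> Hf; rewrite -scaleN1r; exact: rkhsZ. Qed.

Lemma rkhsB f g : H f -> H g -> H (f - g).
Proof. by move=> Hf Hg; apply: rkhsD => //; exact: rkhsN. Qed.

Lemma rkhs_sum (I : Type) (r : seq I) (F : I -> V) :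
  (forall i, H (F i)) -> H (\sum_(i <- r) F i).
Proof. by move=> HF; elim/big_ind : _ => //; [exact: rkhs0|exact: rkhsD]. Qed.

Lemma rkhsK x : H (K x). Proof. exact: (rk_kern HK). Qed.

Ltac rkhs_mem := repeat first [assumption |
  match goal with h : forall _, H _ |- _ => exact: h end |
  apply: rkhsK | apply: rkhs0 | apply: rkhsB |
  apply: rkhsD | apply: rkhsN | apply: rkhsZ | apply: rkhs_sum => ?].
Local Hint Extern 0 (H _) => solve [rkhs_mem] : core.
Local Hint Resolve rkhs0 rkhsK : core.

Lemma ip_linl a f g h : H f -> H g -> H h -> ip (a *: f + g) h = a * ip f h + ip g h.
Proof. exact: (rk_lin HK). Qed.

Lemma ipC f g : H f -> H g -> ip f g = ip g f.
Proof. exact: (rk_sym HK). Qed.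

Lemma ip0l h : H h -> ip 0 h = 0.
Proof.
by move=> Hh; have := ip_linl (-1) Hh Hh Hh; rewrite scaleN1r addNr mulN1r addNr.
Qed.

Lemma ipDl f g h : H f -> H g -> H h -> ip (f + g) h = ip f h + ip g h.
Proof. by move=> Hf Hg Hh; rewrite -[f]scale1r ip_linl// scale1r mul1r. Qed.

Lemma ipZl a f h : H f -> H h -> ip (a *: f) h = a * ip f h.
Proof. by move=> Hf Hh; rewrite -[a *: f]addr0 ip_linl// ip0l// addr0. Qed.

Lemma ipDr f g h : H f -> H g -> H h -> ip h (f + g) = ip h f + ip h g.
Proof. by move=> Hf Hg Hh; rewrite (ipC Hh (rkhsD Hf Hg)) ipDl// (ipC Hf Hh) (ipC Hg Hh). Qed.

Lemma ipZr a f h : H f -> H h -> ip h (a *: f) = a * ip h f.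
Proof. by move=> Hf Hh; rewrite (ipC Hh (rkhsZ a Hf)) ipZl// (ipC Hf Hh). Qed.

Lemma ipNl f h : H f -> H h -> ip (- f) h = - ip f h.
Proof.
by move=> Hf Hh; apply/eqP; rewrite -subr_eq0 opprK -ipDl// addNr ip0l.
Qed.

Lemma ipNr f h : H f -> H h -> ip h (- f) = - ip h f.
Proof. by move=> Hf Hh; rewrite (ipC Hh (rkhsN Hf)) ipNl// (ipC Hf Hh). Qed.

Lemma ipBl f g h : H f -> H g -> H h -> ip (f - g) h = ip f h - ip g h.
Proof. by move=> Hf Hg Hh; rewrite ipDl// ipNl. Qed.

Lemma ipBr f g h : H f -> H g -> H h -> ip h (f - g) = ip h f - ip h g.
Proof. by move=> Hf Hg Hh; rewrite ipDr// ipNr. Qed.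

Lemma ip_suml (I : Type) (r : seq I) (F : I -> V) h :
  (forall i, H (F i)) -> H h -> ip (\sum_(i <- r) F i) h = \sum_(i <- r) ip (F i) h.
Proof.
move=> HF Hh; elim: r => [|i r IH]; first by rewrite !big_nil ip0l.
by rewrite !big_cons ipDl ?IH//; exact: rkhs_sum.
Qed.

Lemma ip_ge0 f : H f -> 0 <= ip f f. Proof. exact: (rk_pos HK). Qed.

Lemma ip_eq0 f : H f -> ip f f = 0 -> f = 0. Proof. exact: (rk_def HK). Qed.

Lemma rknorm_ge0 f : 0 <= N f. Proof. exact: sqrtr_ge0. Qed.

Lemma sqr_rknorm f : H f -> N f ^+ 2 = ip f f.
Proof. by move=> Hf; rewrite sqr_sqrtr// ip_ge0. Qed.

Lemma rknorm0 : N 0 = 0. Proof. by rewrite /rknorm ip0l// sqrtr0. Qed.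

Lemma ip_reprK f x : H f -> ip f (K x) = f x.
Proof. by move=> Hf; rewrite (rk_repr HK). Qed.

Lemma sqr_normD f g : H f -> H g -> ip (f + g) (f + g) = ip f f + 2 * ip f g + ip g g.
Proof. by move=> Hf Hg; rewrite ipDl ?ipDr ?(ipC Hg Hf)//; ring. Qed.

Lemma sqr_normB f g : H f -> H g -> ip (f - g) (f - g) = ip f f - 2 * ip f g + ip g g.
Proof. by move=> Hf Hg; rewrite ipBl ?ipBr ?(ipC Hg Hf)//; ring. Qed.

Lemma rknormZ a f : H f -> N (a *: f) = `|a| * N f.
Proof.
move=> Hf; rewrite /rknorm ipZl ?ipZr//.
by rewrite mulrA -expr2 sqrtrM ?sqr_ge0// sqrtr_sqr.
Qed.

Lemma rknormN f : H f -> N (- f) = N f.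
Proof. by move=> Hf; rewrite /rknorm ipNl// ipNr// opprK. Qed.

Lemma CauchySchwarz f g : H f -> H g -> ip f g ^+ 2 <= ip f f * ip g g.
Proof.
move=> Hf Hg; have [g0|g0] := eqVneq (ip g g) 0.
  by rewrite (ip_eq0 Hg g0) (ipC Hf rkhs0) !ip0l// expr0n mulr0.
have gp : 0 < ip g g by rewrite lt_neqAle eq_sym g0 ip_ge0.
pose c := ip f g / ip g g.
have := ip_ge0 (rkhsB Hf (rkhsZ c Hg)).
rewrite sqr_normB//.
rewrite ipZl ?ipZr//.
rewrite -(pmulr_rge0 _ gp).
rewrite (_ : ip g g * _ = ip f f * ip g g - ip f g ^+ 2) ?subr_ge0//.
by rewrite /c; field.
Qed.

Lemma normr_ip_le f g : H f -> H g -> `|ip f g| <= N f * N g.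
Proof.
move=> Hf Hg; rewrite -sqrtrM ?ip_ge0// -sqrtr_sqr ler_wsqrtr//.
exact: CauchySchwarz.
Qed.

Lemma rknormD f g : H f -> H g -> N (f + g) <= N f + N g.
Proof.
move=> Hf Hg.
rewrite -(@ler_pXn2r _ 2)// ?nnegrE ?addr_ge0 ?rknorm_ge0//.
rewrite sqr_rknorm ?sqr_normD//.
rewrite sqrrD !sqr_rknorm//.
by have := le_trans (ler_norm _) (normr_ip_le Hf Hg); lra.
Qed.

Lemma rknorm_sum (I : Type) (r : seq I) (F : I -> V) :
  (forall i, H (F i)) -> N (\sum_(i <- r) F i) <= \sum_(i <- r) N (F i).
Proof.
move=> HF; elim: r => [|i r IH]; first by rewrite !big_nil rknorm0.
rewrite !big_cons; apply: le_trans (rknormD _ _) _ => //.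
by rewrite lerD2l.
Qed.

Lemma normr_eval_le (kap : R) f x : 0 <= kap -> (forall x, K x x <= kap ^+ 2) ->
  H f -> `|f x| <= kap * N f.
Proof.
move=> k0 kapP Hf; rewrite -(ip_reprK x Hf) mulrC.
apply: le_trans (normr_ip_le Hf (rkhsK x)) _.
rewrite ler_wpM2l ?rknorm_ge0// /rknorm -(ger0_norm k0) -sqrtr_sqr ler_wsqrtr//.
by rewrite ip_reprK.
Qed.

(** A minimizing sequence for the distance from f to D is Cauchy, and completeness gives its limit.
    As D is a subspace that need not be closed, the limit is only approximated by elements of D. *)
Lemma projection (D : set (X -> R)) f :
  D `<=` H -> D 0 -> (forall g h, D g -> D h -> D (g + h)) ->
  (forall a g, D g -> D (a *: g)) -> H f ->
  exists g, [/\ H g, forall e : R, 0 < e -> exists2 d, D d & N (g - d) < e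
    & forall d, D d -> ip (f - g) d = 0].
Proof.
move=> DH D0 DD DZ Hf.
pose E := [set ip (f - d) (f - d) | d in D].
have lE : has_inf E.
  split; first by exists (ip (f - 0) (f - 0)), 0.
  by exists 0 => _ [d Dd <-]; apply/ip_ge0/rkhsB => //; exact: DH.
have infE d : D d -> inf E <= ip (f - d) (f - d).
  by move=> Dd; apply: ge_inf; [case: lE|exists d].
have /choice[u uP] (n : nat) : exists d, D d /\ ip (f - d) (f - d) < inf E + n.+1%:R^-1.
  have /(_ _ lE)[//|_ [d Dd <-] lt] := @inf_adherent _ E (n.+1%:R^-1).
  by exists d.
have uH n : H (u n) by apply: DH; case: (uP n).
have uB n k : ip (u n - u k) (u n - u k) <= 2 * n.+1%:R^-1 + 2 * k.+1%:R^-1.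
  have [Dn ltn] := uP n; have [Dk ltk] := uP k.
  (* The midpoint lies in D, so its distance to f is at least the infimum; the parallelogram
     identity then bounds u n - u k. *)
  have := infE (2^-1 *: (u n + u k)) (DZ _ _ (DD _ _ Dn Dk)).
  have -> : f - 2^-1 *: (u n + u k) = 2^-1 *: ((f - u n) + (f - u k)).
    by apply/funext => x; rewrite !fct_lmodE; field.
  have -> : u n - u k = (f - u k) - (f - u n).
    by apply/funext => x; rewrite !fct_lmodE; ring.
  have Hn := rkhsB Hf (uH n); have Hk := rkhsB Hf (uH k).
  rewrite ipZl ?ipZr//.
  rewrite sqr_normD// sqr_normB// (ipC Hk Hn).
  move: ltn ltk; set a := ip _ _; set b := ip _ _; set c := ip _ _.
  by move: (n.+1%:R^-1) (k.+1%:R^-1) (inf E) => x y z; lra.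
have [|g [Hg ug]] := rk_complete HK uH.
  move=> e e0.
  have /ltr_add_invr[m] : 0 < e ^+ 2 / 4 by rewrite divr_gt0// exprn_gt0.
  rewrite add0r => me; exists m => n k mn mk.
  rewrite -(@ltr_pXn2r _ 2)// ?nnegrE ?rknorm_ge0 ?(ltW e0)//.
  rewrite (sqr_rknorm (rkhsB (uH n) (uH k))).
  apply: le_lt_trans (uB n k) _.
  have inv_le j : (m <= j)%N -> j.+1%:R^-1 <= m.+1%:R^-1 :> R.
    by move=> mj; rewrite lef_pV2 ?posrE// ler_nat.
  have := inv_le _ mn; have := inv_le _ mk; move: me.
  move: (n.+1%:R^-1) (k.+1%:R^-1) (m.+1%:R^-1) => x y z; lra.
have ug0 e : 0 < e -> exists n, N (u n - g) < e /\ n.+1%:R^-1 < e.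
  move=> e0; have /ltr_add_invr[m] := e0; rewrite add0r => me.
  have /cvgrPdist_lt/(_ _ e0)[k _ kP] := ug.
  exists (maxn m k); split.
    have := kP (maxn m k) (leq_maxr _ _); rewrite sub0r normrN ger0_norm//.
    exact: rknorm_ge0.
  by apply: le_lt_trans me; rewrite lef_pV2 ?posrE// ler_nat ltnS leq_maxl.
exists g; split=> //.
  move=> e /ug0[n [ne _]]; exists (u n); first by case: (uP n).
  by rewrite -rknormN//; rewrite opprB.
move=> d Dd; have Hd := DH _ Dd.
have b_le n : ip (f - u n) d ^+ 2 <= ip d d * n.+1%:R^-1.
  have [d0|d0] := eqVneq (ip d d) 0.
    rewrite (ip_eq0 Hd d0) (ipC (rkhsB Hf (uH n)) rkhs0) !ip0l//.
    by rewrite expr0n mul0r.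
  have dp : 0 < ip d d by rewrite lt_neqAle eq_sym d0 ip_ge0.
  have [Dn ltn] := uP n.
  have Hfn := rkhsB Hf (uH n).
  (* This c is optimal along d: moving from u n to u n + c d lowers the squared distance by b^2 /
     <d, d>, which the near-minimality of u n limits to 1/(n+1). *)
  pose b := ip (f - u n) d; pose c := b / ip d d.
  have := infE (u n + c *: d) (DD _ _ Dn (DZ _ _ Dd)).
  rewrite opprD addrA sqr_normB// ipZl// !ipZr// -/b.
  move=> h1; rewrite -ler_pdivrMl// mulrC.
  have cc : c * (c * ip d d) = b ^+ 2 / ip d d by rewrite /c; field.
  have cb : c * b = b ^+ 2 / ip d d by rewrite /c; field.
  move: h1 ltn; rewrite cc cb.
  by move: (n.+1%:R^-1) (_ / _) (inf E) => x y z; lra.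
apply/eqP; rewrite -normr_le0; apply/ler_addgt0Pr => e e0; rewrite add0r.
have c0 : 0 < 1 + ip d d + N d by rewrite ltr_wpDr ?rknorm_ge0// ltr_wpDr ?ip_ge0.
(* [b_le] bounds a square, so n is taken at accuracy e'^2; as e' <= 1, this accuracy is also at most
   e', as the second term requires. *)
pose e' := Num.min 1 (e / (1 + ip d d + N d)).
have e'0 : 0 < e' by rewrite lt_min ltr01 divr_gt0.
have [n [n1 n2]] := ug0 (e' ^+ 2) (exprn_gt0 _ e'0).
have -> : f - g = (f - u n) + (u n - g) by rewrite addrA subrK.
rewrite ipDl//; apply: le_trans (ler_normD _ _) _.
have e'e : e' * (1 + ip d d + N d) <= e by rewrite -ler_pdivlMr// ge_min lexx orbT.
have e'1 : e' ^+ 2 <= e' by rewrite expr2 ger_pMr// ge_min lexx.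
have A1 : `|ip (f - u n) d| <= (1 + ip d d) * e'.
  have d0 := ip_ge0 Hd.
  rewrite -(@ler_pXn2r _ 2)// ?nnegrE ?mulr_ge0 ?addr_ge0 ?(ltW e'0)//.
  rewrite real_normK ?num_real//; apply: le_trans (b_le n) _.
  rewrite exprMn; apply: ler_pM => //; last exact: ltW.
  rewrite expr2; nra.
have A2 : `|ip (u n - g) d| <= e' * N d.
  apply: le_trans (normr_ip_le _ _) _ => //.
  by rewrite ler_wpM2r ?rknorm_ge0//; apply: le_trans e'1; exact: ltW.
by apply: le_trans e'e; rewrite mulrDr mulrC lerD// mulrC.
Qed.


(** An inductive span lets facts about linear combinations be proved by rule induction, without
    lists of coefficients. *)
Inductive kspan (D : set X) : V -> Prop :=
| kspan0 : kspan D 0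
| kspanK x : D x -> kspan D (K x)
| kspanD f g : kspan D f -> kspan D g -> kspan D (f + g)
| kspanZ (a : R) f : kspan D f -> kspan D (a *: f).

Lemma kspan_rkhs (D : set X) f : kspan D f -> H f.
Proof. by elim => //=. Qed.

Lemma kspanS (D D' : set X) f : D `<=` D' -> kspan D f -> kspan D' f.
Proof.
move=> DD'; elim => [|x Dx|g h _ Hg _ Hh|a g _ Hg];
  [exact: kspan0|apply: kspanK; exact: DD'|exact: kspanD|exact: kspanZ].
Qed.

Definition kclosure (D : set X) f :=
  H f /\ forall e : R, 0 < e -> exists2 d, kspan D d & N (f - d) < e.

Lemma kspan_closure (D : set X) f : kspan D f -> kclosure D f.
Proof.
move=> Df; split=> [|e e0]; first exact: kspan_rkhs Df.
by exists f => //; rewrite subrr rknorm0.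
Qed.

(** By the reproducing property, a residual orthogonal to K_x vanishes at x. *)
Lemma kprojection (D : set X) f : H f ->
  exists g, [/\ kclosure D g & forall x, D x -> f x = g x].
Proof.
move=> Hf.
have [g [Hg gD fg]] := projection (@kspan_rkhs D) (kspan0 D) (@kspanD D) (@kspanZ D) Hf.
exists g; split; first by split.
move=> x Dx; have := fg _ (kspanK Dx); rewrite ip_reprK// => /eqP.
by rewrite subr_eq0 => /eqP.
Qed.

(** The projection of f on the closed span of all K_x agrees with f at every point, hence is f. *)
Lemma kclosureT f : H f -> kclosure setT f.
Proof.
by move=> Hf; have [g [gT fg]] := kprojection setT Hf; rewrite (_ : f = g)//; apply/funext => x; exact: fg.
Qed.

(** The dense sequence consists of the rational combinations of the K_x with x in D, coded as lists
    of pairs of a rational and an index. *)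
Lemma countable_kspan (D : set X) : countable D ->
  exists G : nat -> V, (forall n, H (G n)) /\
    forall f, kspan D f -> forall e : R, 0 < e -> exists n, N (f - G n) < e.
Proof.
move=> cD.
have /pfcard_geP[D0|[p]] := cD.
  exists (fun=> 0); split => // f Df e e0; exists 0%N.
  suff -> : f = 0 by rewrite subrr rknorm0.
  elim: Df => [//|x|g h _ -> _ ->|a g _ ->]; rewrite ?addr0 ?scaler0//.
  by rewrite D0.
have pD : D `<=` range p by exact: surj.
pose c (s : seq (rat * nat)) : V := \sum_(i <- s) ratr i.1 *: K (p i.2).
exists (fun n => c (odflt [::] (unpickle n))); split => [n|f Df e e0].
  by rewrite /c; exact: rkhs_sum.
suff [s sP] : exists s, N (f - c s) < e.
  by exists (pickle s); rewrite pickleK.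
elim: Df e e0 => [|x Dx|g h Dg IHg Dh IHh|a g Dg IHg] e e0.
- by exists [::]; rewrite /c big_nil subrr rknorm0.
- have [n _ <-] := pD _ Dx; exists [:: (1, n)].
  by rewrite /c big_seq1/= rmorph1 scale1r subrr rknorm0.
- have e2 : 0 < e / 2 by rewrite divr_gt0.
  have [s sP] := IHg _ e2; have [t tP] := IHh _ e2.
  have Hg := kspan_rkhs Dg; have Hh := kspan_rkhs Dh.
  exists (s ++ t); rewrite /c big_cat/= opprD addrACA.
  apply: le_lt_trans (rknormD _ _) _; [| |rewrite -/(c s) -/(c t); lra].
    by apply: rkhsB => //; exact: rkhs_sum.
  by apply: rkhsB => //; exact: rkhs_sum.
- have Hg := kspan_rkhs Dg.
  have [q qa] : exists q : rat, `|a - ratr q| < e / 2 / (1 + N g).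
    have e0' : 0 < e / 2 / (1 + N g) by rewrite !divr_gt0// ltr_wpDr ?rknorm_ge0.
    have /rat_in_itvoo[q] : a < a + e / 2 / (1 + N g) by rewrite ltrDl.
    rewrite in_itv/= => /andP[q1 q2]; exists q.
    by rewrite distrC ger0_norm ?subr_ge0 ?ltW// ltrBlDl.
  have q0 : 0 < 1 + `|ratr q : R| by rewrite ltr_wpDr.
  have N0 : 0 < 1 + N g by rewrite ltr_wpDr ?rknorm_ge0.
  (* The rational q is fixed first, because the accuracy asked of s depends on |q|. *)
  have [s sP] := IHg (e / 2 / (1 + `|ratr q|)) (divr_gt0 (divr_gt0 e0 (ltr0Sn _ _)) q0).
  exists [seq (q * i.1, i.2) | i <- s].
  have -> : c [seq (q * i.1, i.2) | i <- s] = ratr q *: c s.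
    rewrite /c big_map scaler_sumr; apply: eq_bigr => i _ /=.
    by rewrite rmorphM scalerA.
  have Hc : H (c s) by rewrite /c; exact: rkhs_sum.
  have -> : a *: g - ratr q *: c s = (a - ratr q) *: g + ratr q *: (g - c s).
    by rewrite scalerBl scalerBr addrA subrK.
  apply: le_lt_trans (rknormD _ _) _ => //.
  rewrite !rknormZ//; move: qa sP; rewrite !ltr_pdivlMr// => qa sP.
  have := rknorm_ge0 g; have := rknorm_ge0 (g - c s).
  have := normr_ge0 (a - ratr q); have := normr_ge0 (ratr q : R); nra.
Qed.

(** The sharp exponent is x^2/2; the weaker 2 x^2 has a short proof. For x > 1 it already dominates
    e^x; for 0 <= x <= 1, cosh x = 1 + (u - v)^2 / 2 with u = e^(x/2), v = e^(-x/2) and u - v <=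
    3x/2. *)
Lemma expR_addN_le (x : R) : 2^-1 * (expR x + expR (- x)) <= expR (2 * x ^+ 2).
Proof.
wlog x0 : x / 0 <= x.
  move=> W; have [/W//|x0] := leP 0 x.
  by have := W (- x); rewrite opprK sqrrN addrC; apply; rewrite oppr_ge0 ltW.
have [x1|x1] := leP x 1; last first.
  have : expR (- x) <= expR x by rewrite ler_expR; lra.
  have : expR x <= expR (2 * x ^+ 2) by rewrite ler_expR expr2; nra.
  lra.
apply: le_trans (expR_ge1Dx _).
set u := expR (x / 2); set v := expR (- (x / 2)).
have uv : u * v = 1 by rewrite /u /v -expRD subrr expR0.
have -> : expR x = u ^+ 2 by rewrite /u -expRM_natl; congr expR; field.
have -> : expR (- x) = v ^+ 2 by rewrite /v -expRM_natl; congr expR; field.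
have v1 : 1 - x / 2 <= v by exact: expR_ge1Dx.
have u1 : 1 + x / 2 <= u by exact: expR_ge1Dx.
have v2 : v <= 1 by rewrite /v expR_le1; lra.
have u2 : u <= 1 + x.
  suff : u * (1 - x / 2) <= (1 + x) * (1 - x / 2) by rewrite ler_pM2r//; lra.
  apply: (@le_trans _ _ (u * v)); first by rewrite ler_wpM2l ?expR_ge0.
  by rewrite uv; nra.
have : u ^+ 2 + v ^+ 2 = 2 + (u - v) ^+ 2 by rewrite sqrrB uv; ring.
have : (u - v) ^+ 2 <= (3 / 2 * x) ^+ 2.
  by rewrite ler_pXn2r// ?nnegrE; lra.
by rewrite !expr2; nra.
Qed.

(* The potential grows like exp (r ||h||) but, unlike it, is smooth at 0. *)
Lemma exp_potential_step (r : R) h v : H h -> H v ->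
  2^-1 * (expR (Num.sqrt (1 + r ^+ 2 * ip (h + v) (h + v)))
        + expR (Num.sqrt (1 + r ^+ 2 * ip (h - v) (h - v))))
  <= expR (Num.sqrt (1 + r ^+ 2 * ip h h) + 3 * (r ^+ 2 * ip v v)).
Proof.
move=> Hh Hv; set A := 1 + r ^+ 2 * ip h h; set b := r ^+ 2 * ip v v.
pose s := r ^+ 2 * ip h v.
have r2 := sqr_ge0 r; have h0 := ip_ge0 Hh; have v0 := ip_ge0 Hv.
have A1 : 1 <= A by rewrite lerDl mulr_ge0.
have b0 : 0 <= b by rewrite mulr_ge0.
have s2 : s ^+ 2 <= A * b.
  apply: (@le_trans _ _ ((r ^+ 2 * ip h h) * b)); last first.
    by rewrite ler_wpM2r// lerDr.
  rewrite /s /b exprMn (_ : _ * _ * (_ * _) = (r ^+ 2) ^+ 2 * (ip h h * ip v v)); last by ring.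
  by rewrite ler_wpM2l ?sqr_ge0// CauchySchwarz.
set Q := Num.sqrt A.
have Q1 : 1 <= Q by rewrite -[1]sqrtr1 ler_wsqrtr.
have Q0 : 0 < Q by lra.
have QQ : Q ^+ 2 = A by rewrite sqr_sqrtr//; lra.
(* The tangent of the square root at A, which makes the bound affine in the inner product s, so that
   the two signs combine into a hyperbolic cosine. *)
have q_le w : H w -> Num.sqrt (1 + r ^+ 2 * ip w w) <= (1 + r ^+ 2 * ip w w + A) / (2 * Q).
  move=> Hw; set y := Num.sqrt _.
  have w0 := ip_ge0 Hw.
  have <- : y ^+ 2 = 1 + r ^+ 2 * ip w w by rewrite sqr_sqrtr// addr_ge0// mulr_ge0.
  rewrite ler_pdivlMr ?mulr_gt0// -QQ.
  by have := sqr_ge0 (y - Q); rewrite sqrrB; lra.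
have Qp : 2 * Q != 0 by rewrite gt_eqF// mulr_gt0.
have E1 : Num.sqrt (1 + r ^+ 2 * ip (h + v) (h + v)) <= Q + b / 2 + s / Q.
  apply: le_trans (q_le _ (rkhsD Hh Hv)) _.
  rewrite sqr_normD// (_ : _ / _ = Q + b / (2 * Q) + s / Q).
    by rewrite lerD2r lerD2l ler_wpM2l// lef_pV2 ?posrE ?mulr_gt0//; lra.
  rewrite (_ : 1 + _ + A = 2 * Q ^+ 2 + 2 * s + b); first by field; rewrite gt_eqF.
  by rewrite QQ /A /b /s; ring.
have E2 : Num.sqrt (1 + r ^+ 2 * ip (h - v) (h - v)) <= Q + b / 2 - s / Q.
  apply: le_trans (q_le _ (rkhsB Hh Hv)) _.
  rewrite sqr_normB// (_ : _ / _ = Q + b / (2 * Q) - s / Q).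
    by rewrite lerD2r lerD2l ler_wpM2l// lef_pV2 ?posrE ?mulr_gt0//; lra.
  rewrite (_ : 1 + _ + A = 2 * Q ^+ 2 - 2 * s + b); first by field; rewrite gt_eqF.
  by rewrite QQ /A /b /s; ring.
apply: (@le_trans _ _ (expR (Q + b / 2) * (2^-1 * (expR (s / Q) + expR (- (s / Q)))))).
  by rewrite mulrCA ler_pM2l ?invr_gt0// mulrDr -!expRD lerD// ler_expR.
apply: (@le_trans _ _ (expR (Q + b / 2) * expR (2 * (s / Q) ^+ 2))).
  by rewrite ler_wpM2l ?expR_ge0// expR_addN_le.
rewrite -expRD ler_expR.
(* The exponent gains b/2 from the tangent, where Q >= 1, and 2 b from the cosine; 3 rounds up
   5/2. *)
have : (s / Q) ^+ 2 <= b.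
  by rewrite expr_div_n QQ ler_pdivrMr 1?mulrC//; lra.
lra.
Qed.

(** The finite span of the sampled K_x is recorded, not just membership in H: it is what later
    places the iterates in a separable closed span. *)
Lemma gd_iter_rkhs (V' : R -> R -> R) (eta : nat -> R) (m : nat) (xs : 'I_m -> X)
  (ys : 'I_m -> R) n : kspan (range xs) (gd_iter K V' eta xs ys n).
Proof.
elim: n => [|n IH] /=; first exact: kspan0.
set f := gd_iter _ _ _ _ _ _ in IH *.
rewrite (_ : (fun x => _) = (f : V) + (- (eta n.+1 * m%:R^-1)) *:
   (\sum_(j < m) V' (ys j) (f (xs j)) *: (K (xs j) : V))).
  apply: kspanD => //; apply: kspanZ.
  elim/big_ind : _ => [|g h|j _]; [exact: kspan0|exact: kspanD|].
  by apply: kspanZ; apply: kspanK; exists j.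
by apply/funext => x; rewrite !fct_lmodE mulNr mulrA.
Qed.

(** Expansion of the square of the norm. The reproducing property evaluates the inner product with
    the step, and |V'| <= 1 with ||K_x|| <= kap bounds the length of the step. *)
Lemma gd_iter_step (V' : R -> R -> R) (eta : nat -> R) (m : nat) (xs : 'I_m -> X)
    (ys : 'I_m -> R) n h (kap : R) :
  let f := gd_iter K V' eta xs ys in
  0 <= kap -> (forall x, K x x <= kap ^+ 2) -> (0 < m)%N ->
  (forall j, `|V' (ys j) (f n (xs j))| <= 1) -> H h ->
  N ((f n.+1 : V) - h) ^+ 2 <= N ((f n : V) - h) ^+ 2
    - 2 * eta n.+1 * (m%:R^-1 * \sum_(j < m) V' (ys j) (f n (xs j)) * (f n (xs j) - h (xs j)))
    + (eta n.+1 * kap) ^+ 2.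
Proof.
move=> f k0 kapP m0 V1 Hh.
have Hfn := kspan_rkhs (gd_iter_rkhs V' eta xs ys n).
rewrite -/(f n) in Hfn.
pose G : V := m%:R^-1 *: \sum_(j < m) V' (ys j) (f n (xs j)) *: (K (xs j) : V).
have HG : H G by apply: rkhsZ; apply: rkhs_sum => j.
have -> : (f n.+1 : V) - h = ((f n : V) - h) - eta n.+1 *: G.
  apply/funext => x; rewrite /G !fct_lmodE [f n.+1 x]/(f n x - eta n.+1 *
    (m%:R^-1 * \sum_(j < m) V' (ys j) (f n (xs j)) * K (xs j) x)).
  by rewrite addrAC; congr (_ - _ * (_ * _)).
have Kle x : N (K x) <= kap.
  by rewrite /rknorm ip_reprK// -(ger0_norm k0) -sqrtr_sqr ler_wsqrtr.
have NG : N G <= kap.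
  rewrite rknormZ//.
  rewrite ger0_norm ?invr_ge0 ?ler0n// ler_pdivrMl ?ltr0n//.
  apply: le_trans (rknorm_sum _ _) _ => //.
  rewrite mulr_natl -[m in leRHS]card_ord -sumr_const; apply: ler_sum => j _.
  by rewrite rknormZ// -[leRHS]mul1r ler_pM ?rknorm_ge0.
rewrite !sqr_rknorm// sqr_normB// (ipZr _ HG (rkhsB Hfn Hh)).
rewrite (ipZl _ HG (rkhsZ _ HG)) (ipZr _ HG HG).
have -> : ip ((f n : V) - h) G = m%:R^-1 * \sum_(j < m) V' (ys j) (f n (xs j)) * (f n (xs j) - h (xs j)).
  rewrite (ipC (rkhsB Hfn Hh) HG) /G ipZl//.
  rewrite ip_suml//; congr (_ * _); apply: eq_bigr => j _.
  by rewrite ipZl// (ipC (rkhsK _) (rkhsB Hfn Hh)) ip_reprK.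
have : eta n.+1 ^+ 2 * ip G G <= eta n.+1 ^+ 2 * kap ^+ 2.
  by rewrite ler_wpM2l ?sqr_ge0// -sqr_rknorm// ler_pXn2r ?nnegrE ?rknorm_ge0.
rewrite exprMn; lra.
Qed.

End rkhs.

(** Finite combinations of the K_x are measurable and approximate f in norm, hence pointwise,
    because evaluations are continuous. *)
Lemma rkhs_measurable {R : realType} d (X : measurableType d) (K : X -> X -> R) (H : set (X -> R))
    (ip : (X -> R) -> (X -> R) -> R) (HK : is_RKHS K H ip) (f : X -> R) :
  (forall x, measurable_fun [set: X] (K x)) -> H f -> measurable_fun [set: X] f.
Proof.
move=> mK Hf.
have mspan g : kspan (K := K) setT g -> measurable_fun [set: X] g.
  elim=> [|x _|g1 g2 _ m1 _ m2|a g1 _ m1].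
  - exact: measurable_cst.
  - exact: mK.
  - exact: measurable_funD.
  - by apply: measurable_funM => //; exact: measurable_cst.
have [_ fT] := kclosureT HK Hf.
have /choice[u uP] (n : nat) : exists d, kspan (K := K) setT d /\
    rknorm ip ((f : fct_lmod R X) - d) < n.+1%:R^-1.
  by have [] := fT (n.+1%:R^-1); [rewrite invr_gt0|move=> g; exists g].
apply: (@measurable_fun_cvg _ _ _ setT u) => [n|x _].
  by apply: mspan; case: (uP n).
apply/cvgrPdist_lt => e e0.
have k0 : 0 < e / (1 + Num.sqrt (K x x)) by rewrite divr_gt0// ltr_wpDr ?sqrtr_ge0.
near=> n.
have [Du un] := uP n.
have Hu := kspan_rkhs HK Du.
rewrite -[_ - _]/((f - u n : fct_lmod R X) x) -(ip_reprK HK x (rkhsB HK Hf Hu)).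
apply: le_lt_trans (normr_ip_le HK (rkhsB HK Hf Hu) (rkhsK HK x)) _.
apply: (@le_lt_trans _ _ (n.+1%:R^-1 * (1 + Num.sqrt (K x x)))).
  rewrite ler_pM ?rknorm_ge0 ?ltW// /rknorm (ip_reprK HK)//; last exact: (rkhsK HK).
  lra.
rewrite -ltr_pdivlMr ?ltr_wpDr ?sqrtr_ge0//.
by near: n; exact: (near_infty_natSinv_lt (PosNum k0)).
Unshelve. all: end_near. Qed.

(** * Laws of samples *)

Section tuple_probability.
Context {R : realType} {d : measure_display} {T : measurableType d}.
Variable P : probability T R.
Local Open Scope ereal_scope.

Definition cons_pair n (p : T * n.-tuple T) : n.+1.-tuple T := [tuple of p.1 :: p.2].

Lemma measurable_cons_pair n : measurable_fun [set: T * n.-tuple T] (@cons_pair n).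
Proof. exact: measurable_cons. Qed.

HB.instance Definition _ n :=
  isMeasurableFun.Build _ _ _ _ (@cons_pair n) (@measurable_cons_pair n).

(** The n-fold product of P, built by adding a head to a tuple, so that Fubini integrates out one
    sample point at a time. *)
Fixpoint tuple_prob n : probability (n.-tuple T) R :=
  match n with
  | 0 => \d_([tuple] : 0.-tuple T)
  | n'.+1 => distribution (P \x tuple_prob n') (@cons_pair n')
  end.

Lemma tuple_prob_integral n (f : n.+1.-tuple T -> \bar R) :
  measurable_fun setT f -> (forall t, 0 <= f t) ->
  \int[tuple_prob n.+1]_t f t = \int[P \x tuple_prob n]_p f (cons_pair p).
Proof.
move=> mf f0; rewrite /= ge0_integral_pushforward//.
Qed.

Lemma measurable_box n (A : 'I_n -> set T) : (forall i, measurable (A i)) ->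
  measurable [set t : n.-tuple T | forall i, A i (tnth t i)].
Proof.
move=> mA; rewrite [X in measurable X](_ : _ = \bigcap_(i in [set: 'I_n])
  ((fun t : n.-tuple T => tnth t i) @^-1` A i)).
  apply: fin_bigcap_measurable => // i _.
  by rewrite -[_ @^-1` _]setTI; apply: measurable_tnth.
by apply/seteqP; split => [t tA i _|t tA i]; apply: tA.
Qed.

Lemma tuple_prob_box n (A : 'I_n -> set T) : (forall i, measurable (A i)) ->
  tuple_prob n [set t | forall i, A i (tnth t i)] = \prod_(i < n) P (A i).
Proof.
elim: n A => [|n IH] A mA.
  rewrite big_ord0 (_ : [set t | _] = setT) ?probability_setT//.
  by apply/seteqP; split => // t _ [].
rewrite big_ord_recl /= /distribution /pushforward.
rewrite (_ : _ @^-1` _ = A ord0 `*` [set t | forall i : 'I_n, A (lift ord0 i) (tnth t i)]).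
  rewrite product_measure1E//; first by congr (_ * _); exact: (IH (fun i => A (lift ord0 i))).
  exact: (measurable_box (fun i => mA (lift ord0 i))).
apply/seteqP; split => [[z t] /= tA|[z t] /= [zA tA] i].
  split=> [|i]; first by have := tA ord0; rewrite tnth0.
  by have := tA (lift ord0 i); rewrite tnthS.
by case: (unliftP ord0 i) => [j|] ->; rewrite ?tnthS// tnth0.
Qed.

(** Boxes are stable under intersection and generate the measurable sets of tuples. *)
Lemma tuple_prob_unique n (m : {measure set (n.-tuple T) -> \bar R}) :
  (forall A : 'I_n -> set T, (forall i, measurable (A i)) ->
    m [set t | forall i, A i (tnth t i)] = \prod_(i < n) P (A i)) ->
  forall A, measurable A -> m A = tuple_prob n A.
Proof.
move=> mbox.
pose G : set (set (n.-tuple T)) := [set B | exists A : 'I_n -> set T,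
  (forall i, measurable (A i)) /\ B = [set t | forall i, A i (tnth t i)]].
have mG B : G B -> measurable B.
  by move=> [A [mA ->]]; exact: measurable_box.
have GT : G setT.
  by exists (fun=> setT); split=> //; apply/seteqP; split.
move=> A mA; apply: (@measure_unique _ _ _ G (fun=> setT)) => //.
- apply/seteqP; split; last first.
    by apply: smallest_sub; [exact: sigma_algebra_measurable|exact: mG].
  apply: smallest_sub; first exact: smallest_sigma_algebra.
  elim/big_ind : _ => [//|S1 S2 h1 h2 B [/h1|/h2]//|i _ _ [B mB <-]].
  apply: sub_sigma_algebra; exists (fun j => if j == i then B else setT); split.
    by move=> j; case: ifP.
  apply/seteqP; split => [t [_ tB] j|t tB]; first by case: eqP => // ->.
  by split => //; have := tB i; rewrite eqxx.
- move=> _ _ [A1 [mA1 ->]] [A2 [mA2 ->]]; exists (fun i => A1 i `&` A2 i); split.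
    by move=> i; exact: measurableI.
  by apply/seteqP; split => [t [t1 t2] i|t t12]; [|split=> i; have [] := t12 i].
- by apply/seteqP; split => // t _; exists 0%N.
- by move=> B [C [mC ->]]; rewrite mbox//; apply/esym/tuple_prob_box.
- move=> _; rewrite (_ : setT = [set t | forall i, [set: T] (tnth t i)]); last exact/seteqP.
  by rewrite (mbox (fun=> setT))// big1 ?ltey// => i _; rewrite probability_setT.
Qed.

Lemma iid_sample_law {dO} {Omega : measurableType dO} (Q : probability Omega R) n
    (Zs : 'I_n -> Omega -> T) (A : set (n.-tuple T)) :
  iid_sample Q P Zs -> measurable A ->
  let Zt w := [tuple Zs i w | i < n] in
  measurable (Zt @^-1` A) /\ Q (Zt @^-1` A) = tuple_prob n A.
Proof.
move=> [mZ [Zlaw Zind]] mA Zt.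
have mZt : measurable_fun setT Zt.
  apply/measurable_fun_tnthP => i.
  rewrite [X in measurable_fun _ X](_ : _ = Zs i)//.
  by apply/funext => w /=; rewrite tnth_mktuple.
split; first by rewrite -[_ @^-1` _]setTI; exact: mZt.
pose Ztm : {mfun Omega >-> n.-tuple T} := HB.pack Zt (isMeasurableFun.Build _ _ _ _ _ mZt).
rewrite -[LHS]/(distribution Q Ztm A); apply: tuple_prob_unique => // B mB.
rewrite [LHS]/(Q (Zt @^-1` [set t | forall i, B i (tnth t i)])).
rewrite (_ : Zt @^-1` _ = \bigcap_(i in [set: 'I_n]) (Zs i @^-1` B i)).
  by apply: etrans (Zind _ mB) _; apply: eq_bigr => i _; exact: Zlaw.
apply/seteqP; split => [w wB i _|w wB i]; first by have := wB i; rewrite tnth_mktuple.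
by rewrite tnth_mktuple; exact: wB.
Qed.

End tuple_probability.

(** * Uniform deviation by exponential symmetrization *)

Section contraction.
Variable R : realType.
Implicit Types (a b s t c : R).

(** The hyperbolic cosine is even and increasing on the nonnegative reals. *)
Lemma expR_addN_homo s t : `|s| <= `|t| -> expR s + expR (- s) <= expR t + expR (- t).
Proof.
have E x : expR x + expR (- x) = expR `|x| + expR (- `|x|) :> R.
  by case: (ger0P x) => // _; rewrite opprK addrC.
rewrite (E s) (E t); move: `|s| `|t| (normr_ge0 s) => {}s {}t s0 st.
rewrite -subr_ge0.
have -> : expR t + expR (- t) - (expR s + expR (- s)) =
    (expR t - expR s) * (1 - expR (- (s + t))).
  rewrite mulrBr mulr1 mulrBl -!expRD (_ : t + - (s + t) = - s); last by ring.
  by rewrite (_ : s + - (s + t) = - t); [ring|ring].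
by rewrite mulr_ge0// subr_ge0 ?ler_expR// expR_le1; lra.
Qed.

(** By convexity of exp, moving down from c - a to c - s, or up from c' + b to c' + t, changes the
    exponential less than the comparable move at the larger exponent; [h1] and [h2] say which
    exponent is larger. The leftover terms form a hyperbolic cosine at one index. *)
Lemma expR_contraction_aux c c' a b s t :
  `|a| <= `|s| -> `|b| <= `|t| -> a - b <= s - t ->
  c' + b <= c + a -> c - a <= c' - b ->
  expR (c + a) + expR (c' - b) <= expR (c + s) + expR (c' - t).
Proof.
move=> als blt abst h1 h2.
have hb := expR_addN_homo blt; have ha := expR_addN_homo als.
have [s0|s0] := leP s 0.
  have as_ : 0 <= a - s by move: als; rewrite (ler0_norm s0) ler_norml; lra.
  have h3 : expR (a - s) - 1 <= expR (b - t) - 1.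
    by rewrite lerD2r ler_expR; lra.
  have h4 : 0 <= expR (a - s) - 1 by rewrite subr_ge0 -expR0 ler_expR.
  have h5 : expR (c - a) * (expR (a - s) - 1) <= expR (c' - b) * (expR (b - t) - 1).
    by rewrite ler_pM ?expR_ge0// ler_expR.
  have h6 : expR c * (expR s + expR (- s) - (expR a + expR (- a))) >= 0.
    by rewrite mulr_ge0 ?expR_ge0// subr_ge0.
  move: h5 h6; rewrite !mulrBr !mulr1 !mulrDr -!expRD.
  rewrite (_ : c - a + (a - s) = c - s); last by ring.
  rewrite (_ : c' - b + (b - t) = c' - t); last by ring.
  lra.
have [t0|t0] := leP t 0.
  apply: lerD; rewrite ler_expR.
    by move: als; rewrite (gtr0_norm s0) ler_norml; lra.
  by move: blt; rewrite (ler0_norm t0) ler_norml; lra.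
have bt : 0 <= t - b by move: blt; rewrite (gtr0_norm t0) ler_norml; lra.
have h3 : expR (t - b) - 1 <= expR (s - a) - 1 by rewrite lerD2r ler_expR; lra.
have h4 : 0 <= expR (t - b) - 1 by rewrite subr_ge0 -expR0 ler_expR.
have h5 : expR (c' + b) * (expR (t - b) - 1) <= expR (c + a) * (expR (s - a) - 1).
  by rewrite ler_pM ?expR_ge0// ler_expR.
have h6 : expR c' * (expR t + expR (- t) - (expR b + expR (- b))) >= 0.
  by rewrite mulr_ge0 ?expR_ge0// subr_ge0.
move: h5 h6; rewrite !mulrBr !mulr1 !mulrDr -!expRD.
rewrite (_ : c' + b + (t - b) = c' + t); last by ring.
rewrite (_ : c + a + (s - a) = c + s); last by ring.
lra.
Qed.

(** If one index is at least as good for both signs, both terms may use it and monotonicity of cosh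
    suffices. Otherwise the auxiliary lemma applies, to (s, t) or, when s < t, to (- s, - t), which
    exchanges [Mp] and [Mn]. *)
Lemma expR_contraction (Mp Mn : R) c c' a b s t :
  `|a| <= `|s| -> `|b| <= `|t| -> `|a - b| <= `|s - t| ->
  expR (c + s) <= Mp -> expR (c' + t) <= Mp ->
  expR (c - s) <= Mn -> expR (c' - t) <= Mn ->
  expR (c + a) + expR (c' - b) <= Mp + Mn.
Proof.
move=> als blt abst p1 p2 n1 n2.
have [h1|h1] := leP (c + a) (c' + b).
  have : expR (c + a) <= expR (c' + b) by rewrite ler_expR.
  have := ler_wpM2l (expR_ge0 c') (expR_addN_homo blt).
  by rewrite !mulrDr -!expRD; lra.
have [h2|h2] := leP (c' - b) (c - a).
  have : expR (c' - b) <= expR (c - a) by rewrite ler_expR.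
  have := ler_wpM2l (expR_ge0 c) (expR_addN_homo als).
  by rewrite !mulrDr -!expRD; lra.
have [st|st] := leP t s.
  have := @expR_contraction_aux c c' a b s t als blt.
  rewrite (ltW h1) (ltW h2) => /(_ _ isT isT).
  have : a - b <= s - t.
    by rewrite (le_trans (ler_norm _))// (le_trans abst)// ger0_norm// subr_ge0.
  by move=> -> /(_ isT); lra.
have := @expR_contraction_aux c c' a b (- s) (- t).
rewrite !normrN opprK => /(_ als blt).
rewrite (ltW h1) (ltW h2) => /(_ _ isT isT).
have : a - b <= - s + t.
  rewrite (le_trans (ler_norm _))// (le_trans abst)// distrC gtr0_norm ?subr_gt0//.
  by rewrite addrC.
by move=> -> /(_ isT); lra.
Qed.

(** The exponential of a maximum over the first N indices; its growth in N later reaches the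
    supremum over a countable family. The default 0 lies below every exponential. *)
Definition mexp N (u : nat -> R) : R := \big[Num.max/0]_(j < N) expR (u j).

Lemma mexp_ge0 N (u : nat -> R) : 0 <= mexp N u.
Proof.
rewrite /mexp; elim/big_ind : _ => // x y x0 _.
by rewrite le_max x0.
Qed.

Lemma le_mexp N (u : nat -> R) (j : 'I_N) : expR (u j) <= mexp N u.
Proof. by rewrite /mexp (bigD1 j)//= le_max lexx. Qed.

Lemma mexp_le N (u : nat -> R) (x : R) : 0 <= x ->
  (forall j, (j < N)%N -> expR (u j) <= x) -> mexp N u <= x.
Proof.
move=> x0 ux; rewrite /mexp; elim/big_ind : _ => // [y z yx zx|i _]; last exact: ux.
by rewrite ge_max yx.
Qed.

(* the Ledoux-Talagrand contraction principle for a single random sign *)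
Lemma mexp_contraction N (c a s : nat -> R) :
  (forall j, `|a j| <= `|s j|) -> (forall j k, `|a j - a k| <= `|s j - s k|) ->
  mexp N (fun j => c j + a j) + mexp N (fun j => c j - a j) <=
  mexp N (fun j => c j + s j) + mexp N (fun j => c j - s j).
Proof.
move=> als abst.
have M0 := mexp_ge0 N; have Mle := @le_mexp N.
set Mp := mexp N (fun j => c j + s j); set Mn := mexp N (fun j => c j - s j).
have key j k : (j < N)%N -> (k < N)%N -> expR (c j + a j) + expR (c k - a k) <= Mp + Mn.
  move=> jN kN; apply: expR_contraction (als j) (als k) (abst j k) _ _ _ _.
  - exact: (Mle (fun j => c j + s j) (Ordinal jN)).
  - exact: (Mle (fun j => c j + s j) (Ordinal kN)).
  - exact: (Mle (fun j => c j - s j) (Ordinal jN)).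
  - exact: (Mle (fun j => c j - s j) (Ordinal kN)).
have MM : 0 <= Mp + Mn by rewrite addr_ge0 ?M0.
rewrite -lerBrDr; apply: mexp_le => [|j jN].
  rewrite subr_ge0; apply: mexp_le => // k kN.
  by apply: le_trans (key _ _ kN kN); rewrite lerDr expR_ge0.
rewrite lerBrDr -lerBrDl; apply: mexp_le => [|k kN].
  rewrite subr_ge0; apply: le_trans (key _ _ jN jN).
  by rewrite lerDl expR_ge0.
by rewrite lerBrDl key.
Qed.

(** The inequality x y <= (x^2 + y^2)/2 for exponentials separates the mean m from the sample value
    p; the factor 2 of the symmetrization originates here. *)
Lemma mexp_convex N (c m p : nat -> R) :
  mexp N (fun j => c j + m j - p j) <=
  2^-1 * (mexp N (fun j => c j + 2 * m j) + mexp N (fun j => c j - 2 * p j)).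
Proof.
apply: mexp_le => [|j jN]; first by rewrite mulr_ge0// addr_ge0// mexp_ge0.
have h1 := @le_mexp N (fun j => c j + 2 * m j) (Ordinal jN).
have h2 := @le_mexp N (fun j => c j - 2 * p j) (Ordinal jN).
apply: (@le_trans _ _ (2^-1 * (expR (c j + 2 * m j) + expR (c j - 2 * p j)))); last first.
  by rewrite ler_pM2l// lerD.
set x := expR (2^-1 * (c j + 2 * m j)); set y := expR (2^-1 * (c j - 2 * p j)).
have -> : expR (c j + 2 * m j) = x ^+ 2 by rewrite /x -expRM_natl; congr expR; field.
have -> : expR (c j - 2 * p j) = y ^+ 2 by rewrite /y -expRM_natl; congr expR; field.
have -> : expR (c j + m j - p j) = x * y by rewrite /x /y -expRD; congr expR; field.
by have := sqr_ge0 (x - y); rewrite sqrrB; lra.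
Qed.

Lemma measurable_mexp d (T : measurableType d) N (u : nat -> T -> R) :
  (forall j, measurable_fun setT (u j)) ->
  measurable_fun setT (fun z => mexp N (u^~ z)).
Proof.
rewrite /mexp; elim: N u => [|N IH] u mu.
  by under eq_fun do rewrite big_ord0; exact: measurable_cst.
under eq_fun do rewrite big_ord_recl.
apply: measurable_maxr; first exact: measurableT_comp (mu _).
exact: (IH (fun j => u j.+1)).
Qed.

End contraction.

(** * Symmetrization with a Hilbert space potential *)

Section exponential_symmetrization.
Context {R : realType} {d : measure_display} {Z : measurableType d}.
Variable P : probability Z R.
Context {X : Type} {K : X -> X -> R} {H : set (X -> R)}
  {ip : (X -> R) -> (X -> R) -> R}.
Hypothesis HK : is_RKHS K H ip.
Variables (xc : Z -> X) (f : nat -> fct_lmod R X) (r kap : R).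
Hypothesis r0 : 0 <= r.
Hypothesis Hf : forall j, H (f j).
Hypothesis fr : forall j, rknorm ip (f j) <= r.
Hypothesis kap0 : 0 <= kap.
Hypothesis Kkap : forall x, K x x <= kap ^+ 2.
Hypothesis mf : forall j, measurable_fun setT (fun z => f j (xc z)).
Variables (phi : nat -> Z -> R) (mu : nat -> R).
Hypothesis mphi : forall j, measurable_fun setT (phi j).
Hypothesis phi_le : forall j z, `|phi j z| <= `|f j (xc z)|.
Hypothesis phi_lip : forall j k z, `|phi j z - phi k z| <= `|f j (xc z) - f k (xc z)|.
Hypothesis muE : forall j, (\int[P]_z (phi j z)%:E = (mu j)%:E)%E.

Lemma mexp_lee N (u : nat -> R) (y : \bar R) : (0 <= y)%E ->
  (forall j, (j < N)%N -> ((expR (u j))%:E <= y)%E) -> ((mexp N u)%:E <= y)%E.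
Proof.
case: y => [y| |]; rewrite ?leey// ?lee_fin => y0 uy.
by apply: mexp_le => // j jN; rewrite -lee_fin uy.
Qed.

Lemma phi_bound j z : `|phi j z| <= kap * r.
Proof.
apply: le_trans (phi_le j z) _.
apply: le_trans (normr_eval_le HK _ kap0 Kkap (Hf j)) _.
by rewrite ler_wpM2l.
Qed.

Lemma bounded_measurable_integrable (g : Z -> R) (M : R) :
  measurable_fun setT g -> (forall z, `|g z| <= M) -> P.-integrable setT (EFin \o g).
Proof.
move=> mg gM; apply: measurable_bounded_integrable => //.
  by apply: le_lt_trans (probability_le1 P measurableT) _; rewrite ltry.
exists M; split; first exact: num_real.
by move=> x Mx z _ /=; rewrite (le_trans (gM z))// ltW.
Qed.

Let PT : (P : measure Z R) setT = 1%E. Proof. exact: probability_setT. Qed.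

(** Jensen's inequality by integrating the tangent of the exponential at the mean. *)
Lemma expR_Jensen (c : R) j :
  ((expR (c + 2 * mu j))%:E <= \int[P]_z (expR (c + 2 * phi j z))%:E)%E.
Proof.
pose a := expR (c + 2 * mu j).
have ip1 : P.-integrable setT (EFin \o phi j).
  exact: (bounded_measurable_integrable (mphi j) (phi_bound j)).
have i2 : P.-integrable setT (EFin \o (fun z => (a * (1 - 2 * mu j)) + (a * 2) * phi j z)).
  apply: (@bounded_measurable_integrable _ (`|a * (1 - 2 * mu j)| + `|a * 2| * (kap * r))).
    by apply: measurable_funD => //; apply: measurable_funM.
  move=> z; apply: le_trans (ler_normD _ _) _; rewrite lerD2l normrM.
  by rewrite ler_wpM2l ?phi_bound.
have i3 : P.-integrable setT (EFin \o (fun z => expR (c + 2 * phi j z))).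
  apply: (@bounded_measurable_integrable _ (expR (c + 2 * (kap * r)))).
    by apply: measurableT_comp => //; apply: measurable_funD => //; apply: measurable_funM.
  move=> z; rewrite ger0_norm ?expR_ge0// ler_expR lerD2l ler_pM2l//.
  by apply: le_trans (phi_bound j z); exact: ler_norm.
have -> : ((expR (c + 2 * mu j))%:E =
   \int[P]_z ((a * (1 - 2 * mu j)) + (a * 2) * phi j z)%:E)%E.
  under eq_integral do rewrite EFinD [X in (_ + X)%E]EFinM.
  rewrite integralD//=; last 2 first.
  - by apply: (@bounded_measurable_integrable _ `|a * (1 - 2 * mu j)|).
  - apply: (@bounded_measurable_integrable _ (`|a * 2| * (kap * r))).
      exact: measurable_funM.
    by move=> z; rewrite normrM ler_wpM2l ?phi_bound.
  rewrite integral_cst// PT mule1 integralZl// muE.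
  by rewrite -EFinM -EFinD; congr EFin; rewrite /a; ring.
apply: le_integral => //= z _; rewrite lee_fin.
have := ler_wpM2l (expR_ge0 (c + 2 * mu j)) (expR_ge1Dx (2 * (phi j z - mu j))).
rewrite -expRD (_ : c + 2 * mu j + _ = c + 2 * phi j z); last by ring.
by apply: le_trans; rewrite -/a le_eqVlt; apply/orP; left; apply/eqP; ring.
Qed.

(** Symmetrization without a ghost sample: [mexp_convex] separates the mean from the sample value,
    Jensen turns the mean back into an integral of phi, and the two integrals together are an
    average over a random sign, to which contraction applies for each z. *)
Lemma mexp_single N (c : nat -> R) :
  (\int[P]_z (mexp N (fun j => c j + mu j - phi j z))%:E <=
   \int[P]_z (2^-1 * (mexp N (fun j => c j + 2 * f j (xc z)) +
                      mexp N (fun j => c j - 2 * f j (xc z))))%:E)%E.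
Proof.
have m1 : measurable_fun setT (fun z => mexp N (fun j => c j + 2 * phi j z)).
  apply: (@measurable_mexp _ _ _ N (fun j z => c j + 2 * phi j z)) => j.
  by apply: measurable_funD => //; apply: measurable_funM.
have m2 : measurable_fun setT (fun z => mexp N (fun j => c j - 2 * phi j z)).
  apply: (@measurable_mexp _ _ _ N (fun j z => c j - 2 * phi j z)) => j.
  by apply: measurable_funB => //; apply: measurable_funM.
apply: (@le_trans _ _ (\int[P]_z (2^-1 * (mexp N (fun j => c j + 2 * phi j z) +
                      mexp N (fun j => c j - 2 * phi j z)))%:E)%E); last first.
  apply: ge0_le_integral => //=.
  - by move=> z _; rewrite lee_fin mulr_ge0// addr_ge0// mexp_ge0.
  - by apply/measurable_EFinP; apply: measurable_funM => //; exact: measurable_funD.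
  - apply/measurable_EFinP; apply: measurable_funM => //; apply: measurable_funD.
      apply: (@measurable_mexp _ _ _ N (fun j z => c j + 2 * f j (xc z))) => j.
      by apply: measurable_funD => //; apply: measurable_funM.
    apply: (@measurable_mexp _ _ _ N (fun j z => c j - 2 * f j (xc z))) => j.
    by apply: measurable_funB => //; apply: measurable_funM.
  - move=> z _; rewrite lee_fin ler_pM2l//.
    apply: mexp_contraction => [j|j k].
      by rewrite !normrM ler_pM2l ?normr_gt0.
    by rewrite -!mulrBr !normrM ler_pM2l ?normr_gt0.
apply: (@le_trans _ _ (\int[P]_z (2^-1 * (mexp N (fun j => c j + 2 * mu j) +
                      mexp N (fun j => c j - 2 * phi j z)))%:E)%E).
  apply: ge0_le_integral => //=.
  - by move=> z _; rewrite lee_fin mexp_ge0.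
  - apply/measurable_EFinP.
    apply: (@measurable_mexp _ _ _ N (fun j z => c j + mu j - phi j z)) => j.
    by apply: measurable_funB.
  - by apply/measurable_EFinP; apply: measurable_funM => //; exact: measurable_funD.
  - by move=> z _; rewrite lee_fin mexp_convex.
under eq_integral do rewrite EFinM EFinD.
under [leRHS]eq_integral do rewrite EFinM EFinD.
have M0 u : (0 <= (mexp N u)%:E)%E by rewrite lee_fin mexp_ge0.
have me1 : measurable_fun setT (fun z => (mexp N (fun j => c j + 2 * phi j z))%:E).
  exact/measurable_EFinP.
have me2 : measurable_fun setT (fun z => (mexp N (fun j => c j - 2 * phi j z))%:E).
  exact/measurable_EFinP.
rewrite ge0_integralZl_EFin//=; [|by move=> z _; exact: adde_ge0|exact: emeasurable_funD].
rewrite [leRHS]ge0_integralZl_EFin//=; [|by move=> z _; exact: adde_ge0|exact: emeasurable_funD].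
rewrite lee_pmul2l//= ge0_integralD//= [leRHS]ge0_integralD//=.
rewrite integral_cst// PT mule1 leeD2r//.
apply: mexp_lee => [|j jN]; first by apply: integral_ge0.
apply: le_trans (expR_Jensen (c j) j) _.
apply: ge0_le_integral => //=.
- apply/measurable_EFinP; apply: measurableT_comp => //.
  by apply: measurable_funD => //; apply: measurable_funM.
- move=> z _; rewrite lee_fin.
  exact: (@le_mexp _ N (fun j => c j + 2 * phi j z) (Ordinal jN)).
Qed.

Let q (h : fct_lmod R X) := Num.sqrt (1 + r ^+ 2 * ip h h).
Let Phi N n (h : fct_lmod R X) (t : n.-tuple Z) :=
  mexp N (fun j => ip (f j) h + \sum_(i < n) (mu j - phi j (tnth t i))).

Let mPhi_aux n j (c : R) :
  measurable_fun setT (fun t : n.-tuple Z => c + \sum_(i < n) (mu j - phi j (tnth t i))).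
Proof.
apply: measurable_funD => //; apply: measurable_sum => i.
apply: measurable_funB => //.
exact: (measurableT_comp (mphi j) (measurable_tnth i)).
Qed.

Let ip_le_q j h : H h -> ip (f j) h <= q h.
Proof.
move=> Hh; apply: le_trans (ler_norm _) _.
apply: le_trans (normr_ip_le HK (Hf j) Hh) _.
apply: (@le_trans _ _ (r * rknorm ip h)); first by rewrite ler_wpM2r ?rknorm_ge0 ?fr.
rewrite /q -(ger0_norm (mulr_ge0 r0 (rknorm_ge0 h))) -sqrtr_sqr ler_wsqrtr//.
by rewrite exprMn (sqr_rknorm HK)// lerDr.
Qed.

(* Integrating out one sample point z replaces the deviation of phi j by a random sign times
   2 f_j(x) = <f_j, 2 K_x>, that is, moves h to h + 2 K_x or h - 2 K_x with equal weights, and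
   exp (q h) grows at most by a constant factor on average. *)
Lemma exponential_symmetrization N n h : H h ->
  (\int[tuple_prob P n]_t (Phi N h t)%:E <= (expR (q h + n%:R * (12 * (r * kap) ^+ 2)))%:E)%E.
Proof.
have mPhi n' h' : measurable_fun setT (fun t : n'.-tuple Z => (Phi N h' t)%:E).
  apply/measurable_EFinP.
  apply: (@measurable_mexp _ _ _ N (fun j (t : n'.-tuple Z) =>
    ip (f j) h' + \sum_(i < n') (mu j - phi j (tnth t i)))) => j.
  exact: mPhi_aux.
have Phi0 n' h' (t : n'.-tuple Z) : (0 <= (Phi N h' t)%:E)%E by rewrite lee_fin mexp_ge0.
elim: n h => [|n IH] h Hh.
  rewrite mul0r addr0.
  apply: (@le_trans _ _ (\int[tuple_prob P 0]_t (cst (expR (q h))%:E t))%E).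
    apply: ge0_le_integral => //=; first exact: mPhi.
    move=> t _; rewrite lee_fin; apply: mexp_le => [|j _].
      exact: expR_ge0.
    by rewrite big_ord0 addr0 ler_expR ip_le_q.
  rewrite integral_cst// -[leRHS]mule1 lee_pmul2l ?lte_fin ?expR_gt0//.
  exact: probability_le1.
rewrite tuple_prob_integral//.
pose c j (t : n.-tuple Z) := ip (f j) h + \sum_(i < n) (mu j - phi j (tnth t i)).
pose G (p : Z * n.-tuple Z) := (2^-1 * (mexp N (fun j => c j p.2 + 2 * f j (xc p.1)) +
  mexp N (fun j => c j p.2 - 2 * f j (xc p.1))))%:E.
have mc j : measurable_fun setT (fun p : Z * n.-tuple Z => c j p.2).
  exact: (measurableT_comp (@mPhi_aux n j (ip (f j) h)) measurable_snd).
have mfp j : measurable_fun setT (fun p : Z * n.-tuple Z => 2 * f j (xc p.1)).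
  by apply: measurable_funM => //; exact: (measurableT_comp (mf j) measurable_fst).
have mG : measurable_fun setT G.
  apply/measurable_EFinP; apply: measurable_funM => //; apply: measurable_funD.
    apply: (@measurable_mexp _ _ _ N (fun j (p : Z * n.-tuple Z) => c j p.2 + 2 * f j (xc p.1))) => j.
    exact: measurable_funD.
  apply: (@measurable_mexp _ _ _ N (fun j (p : Z * n.-tuple Z) => c j p.2 - 2 * f j (xc p.1))) => j.
  exact: measurable_funB.
have G0 p : (0 <= G p)%E by rewrite lee_fin mulr_ge0// addr_ge0// mexp_ge0.
pose F (p : Z * n.-tuple Z) := (Phi N h (cons_pair p))%:E.
have mF : measurable_fun setT F by exact: (measurableT_comp (mPhi n.+1 h) (@measurable_cons_pair _ _ n)).
have F0 p : (0 <= F p)%E by rewrite lee_fin mexp_ge0.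
have -> : (\int[P \x tuple_prob P n]_p (Phi N h (cons_pair p))%:E =
    \int[tuple_prob P n]_t \int[P]_z F (z, t))%E.
  rewrite -[LHS]/(\int[P \x tuple_prob P n]_p F p)%E fubini_tonelli1//.
  exact: fubini_tonelli.
apply: (@le_trans _ _ (\int[tuple_prob P n]_t \int[P]_z G (z, t))%E).
  apply: ge0_le_integral => //=.
  - by move=> t _; exact: integral_ge0.
  - exact: measurable_fun_fubini_tonelli_G.
  - exact: measurable_fun_fubini_tonelli_G.
  - move=> t _; apply: le_trans (mexp_single N (c^~ t)).
    rewrite le_eqVlt; apply/orP; left; apply/eqP; apply: eq_integral => z _.
    rewrite /F /Phi; congr (EFin (mexp N _)); apply/funext => j.
    rewrite big_ord_recl tnth0 /c -!addrA; congr (_ + _).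
    rewrite addrA [RHS]addrC; congr (_ + _); apply: eq_bigr => i _.
    by rewrite tnthS.
(* The single-point estimate was used for a fixed tail t. Now z is fixed instead, so that the
   induction hypothesis can be applied to the integral over t. *)
rewrite -(@fubini_tonelli _ _ _ _ _ P (tuple_prob P n) G)//.
have IHD v : H v -> (\int[tuple_prob P n]_t (mexp N (fun j => c j t + ip (f j) v))%:E <=
    (expR (q (h + v) + n%:R * (12 * (r * kap) ^+ 2)))%:E)%E.
  move=> Hv; apply: le_trans (IH _ (rkhsD HK Hh Hv)).
  rewrite le_eqVlt; apply/orP; left; apply/eqP; apply: eq_integral => t _.
  rewrite /Phi; congr (EFin (mexp N _)); apply/funext => j.
  by rewrite /c (ipDr HK Hh Hv (Hf j)) addrAC.
have mcv v : measurable_fun setT (fun t => (mexp N (fun j => c j t + ip (f j) v))%:E).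
  apply/measurable_EFinP.
  apply: (@measurable_mexp _ _ _ N (fun j (t : n.-tuple Z) => c j t + ip (f j) v)) => j.
  by apply: measurable_funD => //; exact: mPhi_aux.
apply: (@le_trans _ _ (\int[P]_z (cst (expR (q h + n.+1%:R * (12 * (r * kap) ^+ 2)))%:E z))%E); last first.
  by rewrite integral_cst// PT mule1.
apply: ge0_le_integral => //=.
- by move=> z _; exact: integral_ge0.
- exact: measurable_fun_fubini_tonelli_F.
move=> z _.
pose v : fct_lmod R X := 2 *: (K (xc z) : fct_lmod R X).
have Hv : H v by apply: (rkhsZ HK); exact: (rkhsK HK).
have fv j : 2 * f j (xc z) = ip (f j) v.
  by rewrite /v (ipZr HK _ (rkhsK HK _) (Hf j)) (ip_reprK HK).
have fNv j : - (2 * f j (xc z)) = ip (f j) (- v) by rewrite (ipNr HK Hv (Hf j)) fv.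
rewrite /G /=; under eq_integral do rewrite EFinM EFinD.
have M0 u : (0 <= (mexp N u)%:E)%E by rewrite lee_fin mexp_ge0.
under eq_integral => t _.
  under eq_fun do rewrite fv.
  under [X in (_ + (mexp N X)%:E)%E]eq_fun do rewrite fNv.
  over.
rewrite ge0_integralZl_EFin//=; [|by move=> t _; exact: adde_ge0|exact: emeasurable_funD].
rewrite ge0_integralD//=.
apply: (@le_trans _ _ (2^-1%:E * ((expR (q (h + v) + n%:R * (12 * (r * kap) ^+ 2)))%:E +
   (expR (q (h - v) + n%:R * (12 * (r * kap) ^+ 2)))%:E))%E).
  rewrite lee_pmul2l//= leeD// IHD//; exact: (rkhsN HK).
rewrite -EFinD -EFinM lee_fin.
(* 12 = 3 * 2^2: the potential step costs 3 r^2 ||v||^2, and v = 2 K_x. *)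
set C0 := 12 * _; have -> : n.+1%:R * C0 = C0 + n%:R * C0 by rewrite -natr1; ring.
rewrite (expRD (q (h + v))) (expRD (q (h - v))) -mulrDl mulrA addrA (expRD (q h + C0)).
rewrite ler_wpM2r ?expR_ge0//.
apply: le_trans (exp_potential_step HK r Hh Hv) _.
rewrite ler_expR lerD2l /v (ipZl HK _ (rkhsK HK _) (rkhsZ HK _ (rkhsK HK _))).
rewrite (ipZr HK _ (rkhsK HK _) (rkhsK HK _)) (ip_reprK HK)//; last exact: (rkhsK HK).
rewrite /C0 exprMn.
by have := ler_wpM2l (sqr_ge0 r) (Kkap (xc z)); lra.
Qed.

(** Markov's inequality for each finite maximum. The bad events increase with N, so continuity from
    below bounds their union without loss. The summand 1 in the exponent is the potential sqrt (1 +
    0) at h = 0. *)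
Lemma uniform_deviation {dO} {Omega : measurableType dO} (Q : probability Omega R) n
    (Zs : 'I_n -> Omega -> Z) (t0 delta : R) : iid_sample Q P Zs ->
  expR (1 + n%:R * (12 * (r * kap) ^+ 2)) <= delta * expR t0 ->
  exists A, [/\ measurable A, ((1 - delta)%:E <= Q A)%E &
    forall w, A w -> forall j, \sum_(i < n) (mu j - phi j (Zs i w)) <= t0].
Proof.
move=> iid dt.
pose B N := [set t : n.-tuple Z | expR t0 < Phi N 0 t].
have mPhi N : measurable_fun setT (Phi N 0 : n.-tuple Z -> R).
  apply: (@measurable_mexp _ _ _ N (fun j (t : n.-tuple Z) =>
    ip (f j) 0 + \sum_(i < n) (mu j - phi j (tnth t i)))) => j.
  exact: mPhi_aux.
have mB N : measurable (B N).
  have := measurable_fun_ltr (@measurable_cst _ _ _ _ setT (expR t0)) (mPhi N).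
  by move=> /(_ measurableT [set true]); rewrite setTI; exact.
have ndB : nondecreasing_seq B.
  move=> N M NM; apply/subsetPset => t; rewrite /B /= => /lt_le_trans; apply.
  apply: mexp_le => [|j jN]; first exact: mexp_ge0.
  exact: (@le_mexp _ M (fun j => ip (f j) 0 +
    \sum_(i < n) (mu j - phi j (tnth t i))) (Ordinal (leq_trans jN NM))).
have PB N : (tuple_prob P n (B N) <= delta%:E)%E.
  rewrite -(@lee_pmul2l _ (expR t0)%:E) ?lte_fin ?expR_gt0//.
  rewrite -(@integral_cst _ _ _ (tuple_prob P n))//.
  apply: (@le_trans _ _ (\int[tuple_prob P n]_(t in B N) (Phi N 0 t)%:E)%E).
    apply: ge0_le_integral => //=.
    - by apply/measurable_EFinP; exact: measurable_funTS.
    - by move=> t Bt; rewrite lee_fin ltW.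
  apply: (@le_trans _ _ (\int[tuple_prob P n]_t (Phi N 0 t)%:E)%E).
    apply: ge0_subset_integral => //; first exact/measurable_EFinP.
    by move=> t _; rewrite lee_fin mexp_ge0.
  apply: le_trans (exponential_symmetrization N n (rkhs0 HK)) _.
  by rewrite -EFinM lee_fin /q (ip0l HK (rkhs0 HK)) mulr0 addr0 sqrtr1 [leRHS]mulrC.
have mUB : measurable (\bigcup_N B N) by exact: bigcup_measurable.
have PUB : (tuple_prob P n (\bigcup_N B N) <= delta%:E)%E.
  have cB := nondecreasing_cvg_mu (mu := tuple_prob P n) mB mUB ndB.
  rewrite -(cvg_lim _ cB)//; apply: lime_le; first by apply/cvg_ex; eexists; exact: cB.
  by apply: nearW => N; exact: PB.
have [mA QA] := iid_sample_law iid mUB.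
exists (~` ((fun w => [tuple Zs i w | i < n]) @^-1` (\bigcup_N B N))); split.
- exact: measurableC.
- rewrite probability_setC// QA EFinB leeB//.
- move=> w /= nB j; rewrite leNgt; apply/negP => lt; apply: nB.
  (* The index j is seen by the maximum over the first j + 1 functions. *)
  exists j.+1 => //; rewrite /B /=.
  have := @le_mexp _ j.+1 (fun j => ip (f j) 0 + \sum_(i < n)
    (mu j - phi j (tnth [tuple Zs i w | i < n] i))) ord_max.
  apply: lt_le_trans; rewrite ltr_expR (ipC HK (Hf j) (rkhs0 HK)) (ip0l HK (Hf j)) add0r.
  by under eq_bigr do rewrite tnth_mktuple.
Qed.

End exponential_symmetrization.

(** * Almost sure separability from the entropy condition *)

Section covering_lower_bound.
Context {R : realType} {X Z : Type} {K : X -> X -> R} {H : set (X -> R)}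
  {ip : (X -> R) -> (X -> R) -> R}.
Hypothesis HK : is_RKHS K H ip.
Variables (xc : Z -> X) (E : set Z) (c : R).
Hypothesis c0 : 0 < c.
Local Notation V := (fct_lmod R X).
Local Notation N := (rknorm ip).
Local Notation kcl := (@kclosure R X K H ip).
Local Notation ksp := (@kspan R X K).

Definition far (D : set X) (a : R) : set Z :=
  [set z | forall g, ksp D g -> a <= N ((K (xc z) : V) - g)].

Fixpoint pts (t : seq Z) : set X :=
  if t is z :: t' then xc z |` pts t' else set0.

(** Each hit is compared with the points behind it, so that a new sample point is added at the head
    and the direction it contributes vanishes on the tail. Points outside E are unconstrained. *)
Fixpoint separated (t : seq Z) : Prop :=
  if t is z :: t' then (E z -> far (pts t') c z) /\ separated t' else True.

Definition hits (t : seq Z) : nat := count (fun z => `[< E z >]) t.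

Lemma kclosureD (D : set X) (f g : V) : kcl D f ->
  kcl D g -> kcl D (f + g).
Proof.
move=> [Hf fD] [Hg gD]; split; first exact: (rkhsD HK).
move=> e e0; have e2 : 0 < e / 2 by rewrite divr_gt0.
have [a Da fa] := fD _ e2; have [b Db gb] := gD _ e2.
have Ha := kspan_rkhs HK Da; have Hb := kspan_rkhs HK Db.
exists (a + b); first exact: kspanD.
rewrite opprD addrACA; apply: le_lt_trans (rknormD HK (rkhsB HK Hf Ha) (rkhsB HK Hg Hb)) _.
lra.
Qed.

Lemma kclosureZ (D : set X) (a : R) (f : V) : kcl D f ->
  kcl D (a *: f).
Proof.
move=> [Hf fD]; split; first exact: (rkhsZ HK).
move=> e e0.
have a0 : 0 < 1 + `|a| by rewrite ltr_wpDr.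
have [b Db fb] := fD (e / (1 + `|a|)) (divr_gt0 e0 a0).
have Hb := kspan_rkhs HK Db.
exists (a *: b); first exact: kspanZ.
rewrite -scalerBr (rknormZ HK _ (rkhsB HK Hf Hb)).
move: fb; rewrite ltr_pdivlMr//.
by have := rknorm_ge0 (ip := ip) (f - b); have := normr_ge0 a; nra.
Qed.

Lemma kclosureS (D D' : set X) (f : V) : D `<=` D' ->
  kcl D f -> kcl D' f.
Proof.
move=> DD' [Hf fD]; split=> // e /fD[d Dd fd]; exists d => //.
exact: kspanS Dd.
Qed.

Lemma ip_kclosure0 (D : set X) (h f : V) : H h -> (forall x, D x -> h x = 0) ->
  kcl D f -> ip h f = 0.
Proof.
move=> Hh h0 [Hf fD].
have hD d : ksp D d -> ip h d = 0.
  elim=> [|x Dx|f1 f2 D1 IH1 D2 IH2|a g Dg IH].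
  - by rewrite (ipC HK Hh (rkhs0 HK)) (ip0l HK Hh).
  - by rewrite (ip_reprK HK _ Hh) h0.
  - by rewrite (ipDr HK (kspan_rkhs HK D1) (kspan_rkhs HK D2) Hh) IH1 IH2 addr0.
  - by rewrite (ipZr HK _ (kspan_rkhs HK Dg) Hh) IH mulr0.
apply/eqP; rewrite -normr_le0; apply/ler_addgt0Pr => e e0; rewrite add0r.
have N0 : 0 < 1 + N h by rewrite ltr_wpDr ?rknorm_ge0.
have [d Dd fd] := fD _ (divr_gt0 e0 N0).
have Hd := kspan_rkhs HK Dd.
have -> : ip h f = ip h (f - d) by rewrite (ipBr HK Hf Hd Hh) (hD _ Dd) subr0.
apply: le_trans (normr_ip_le HK Hh (rkhsB HK Hf Hd)) _.
move: fd; rewrite ltr_pdivlMr//.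
by have := rknorm_ge0 (ip := ip) (f - d); have := rknorm_ge0 (ip := ip) h; nra.
Qed.

(** One step of Gram-Schmidt: e is the normalized residual h of K_x after projection on the span
    over D, and its value at x is ||h|| >= c. *)
Lemma far_direction (D : set X) (z : Z) : far D c z ->
  exists e : V, [/\ kcl (xc z |` D) e, ip e e = 1,
    forall x, D x -> e x = 0 & c <= e (xc z)].
Proof.
move=> zfar.
have HKz := rkhsK HK (xc z).
have [g [gD Kg]] := kprojection HK D HKz.
have Hg : H g by case: gD.
pose h : V := (K (xc z) : V) - g.
have Hh : H h := rkhsB HK HKz Hg.
have h0 x : D x -> h x = 0 by move=> /Kg; rewrite /h !fct_lmodE => ->; rewrite subrr.
have ch : c <= N h.
  apply/ler_addgt0Pr => e e0; have [_ /(_ _ e0)[d Dd gd]] := gD.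
  apply: le_trans (zfar _ Dd) _.
  have Hd := kspan_rkhs HK Dd.
  rewrite (_ : (K (xc z) : V) - d = h + (g - d)); last by rewrite /h addrA subrK.
  by apply: le_trans (rknormD HK Hh (rkhsB HK Hg Hd)) _; rewrite lerD2l ltW.
have Nh : 0 < N h := lt_le_trans c0 ch.
exists ((N h)^-1 *: h); split.
- apply: kclosureZ; rewrite /h -scaleN1r; apply: kclosureD.
    by apply: (kspan_closure HK); apply: kspanK; left.
  by apply: kclosureZ; apply: kclosureS gD => x; right.
- rewrite (ipZl HK _ Hh (rkhsZ HK _ Hh)) (ipZr HK _ Hh Hh) -(sqr_rknorm HK Hh).
  by field; rewrite gt_eqF.
- by move=> x Dx; rewrite fct_lmodE h0// mulr0.
- rewrite fct_lmodE -(ip_reprK HK (xc z) Hh) ler_pdivlMl//.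
  have -> : ip h (K (xc z)) = N h ^+ 2.
    rewrite (sqr_rknorm HK Hh) /h (ipBr HK HKz Hg Hh).
    by rewrite (ip_kclosure0 Hh h0 gD) subr0.
  by rewrite expr2 ler_pM2l.
Qed.

(** Whatever b is, one of b + u and b - u has absolute value at least u. *)
Lemma two_point_expR (lam b u v : R) : 0 <= lam -> 0 <= v <= u ->
  expR (- (lam * (b + u) ^+ 2)) + expR (- (lam * (b - u) ^+ 2)) <= 1 + expR (- (lam * v ^+ 2)).
Proof.
move=> l0 /andP[v0 vu].
have sqle x : v <= `|x| -> expR (- (lam * x ^+ 2)) <= expR (- (lam * v ^+ 2)).
  move=> vx; rewrite ler_expR lerN2 ler_wpM2l// -[leRHS]real_normK ?num_real//.
  by rewrite ler_pXn2r ?nnegrE.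
have le1 x : expR (- (lam * x ^+ 2)) <= 1.
  by rewrite expR_le1 oppr_le0 mulr_ge0 ?sqr_ge0.
have [b0|b0] := leP 0 b.
  rewrite addrC lerD ?le1// sqle//.
  by rewrite (le_trans vu)// ger0_norm; lra.
by rewrite lerD ?le1// sqle// (le_trans vu)// ltr0_norm; lra.
Qed.

(* Each hit contributes, by the projection theorem, a direction vanishing at all later points, so
   the list runs through the combinations +- rho e_1 ... +- rho e_k. No g can be close to many of
   them in the empirical metric: this is what the exponential sum measures. *)
Lemma sign_combinations (lam rho : R) (t : seq Z) : 0 <= lam -> 0 <= rho ->
  separated t -> exists L : seq V, [/\ size L = (2 ^ hits t)%N,
    forall i, (i < size L)%N -> kcl (pts t) (nth 0 L i) /\
      ip (nth 0 L i) (nth 0 L i) = (hits t)%:R * rho ^+ 2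
    & forall g : X -> R, \sum_(f <- L) expR (- (lam * \sum_(z <- t) (f (xc z) - g (xc z)) ^+ 2))
      <= (1 + expR (- (lam * (rho * c) ^+ 2))) ^+ hits t].
Proof.
move=> l0 r0; elim: t => [_|z t IH /= [zfar /IH[L [sL LP LS]]]].
  exists [:: 0]; split=> // [[|//] _|g] /=.
    by split; [exact: (kspan_closure HK (kspan0 _))|rewrite (ip0l HK (rkhs0 HK)) mul0r].
  by rewrite big_seq1 big_nil mulr0 oppr0 expR0 expr0.
case: (asboolP (E z)) => [Ez|nEz]; last first.
  exists L; rewrite add0n; split => // [i iL|g].
    by have [LD LN] := LP i iL; split => //; apply: kclosureS LD => x; right.
  apply: le_trans (LS g); apply: ler_sum => f _; rewrite ler_expR lerN2 ler_wpM2l//.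
  by rewrite big_cons lerDr sqr_ge0.
have [e [eD ee e0 ec]] := far_direction (zfar Ez).
have He : H e by case: eD.
exists ([seq (f + rho *: e : V) | f <- L] ++ [seq (f - rho *: e : V) | f <- L]).
split.
- by rewrite size_cat !size_map sL add1n expnS mul2n addnn.
- move=> i; rewrite size_cat !size_map => iL; rewrite nth_cat size_map.
  have key j (s : R) : (j < size L)%N -> s = rho \/ s = - rho ->
    kcl (xc z |` pts t) (nth 0 L j + s *: e) /\
    ip (nth 0 L j + s *: e) (nth 0 L j + s *: e) = (1 + hits t)%:R * rho ^+ 2.
    move=> jL sr; have [LD LN] := LP j jL; have Hn : H (nth 0 L j) by case: LD.
    split.
      apply: kclosureD; last exact: kclosureZ.
      by apply: kclosureS LD => x; right.
    rewrite (sqr_normD HK Hn (rkhsZ HK _ He)) LN (ipZr HK _ He Hn).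
    rewrite (ipC HK Hn He) (ip_kclosure0 He e0 LD).
    rewrite (ipZl HK _ He (rkhsZ HK _ He)) (ipZr HK _ He He) ee natrD.
    by case: sr => ->; ring.
  case: ltnP => iL'.
    by rewrite (nth_map 0)//; apply: key => //; left.
  have iL2 : (i - size L < size L)%N by rewrite ltn_subLR.
  by rewrite (nth_map 0)// -scaleNr; apply: key => //; right.
- move=> g; rewrite big_cat !big_map /= -big_split/= add1n exprS.
  apply: (@le_trans _ _ (\sum_(f <- L) ((1 + expR (- (lam * (rho * c) ^+ 2))) *
     expR (- (lam * \sum_(z <- t) (f (xc z) - g (xc z)) ^+ 2))))); last first.
    by rewrite -mulr_sumr ler_wpM2l ?LS// addr_ge0 ?expR_ge0.
  apply: ler_sum => f _.
  (* Adding a multiple of e leaves the terms of the tail unchanged, so only the head distinguishes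
     the two signs. *)
  have tail (s : R) : \sum_(w <- t) ((f + s *: e : V) (xc w) - g (xc w)) ^+ 2 =
      \sum_(w <- t) (f (xc w) - g (xc w)) ^+ 2.
    elim: t e0 {IH zfar LP LS sL eD} => [|w t IHt] e0; first by rewrite !big_nil.
    rewrite !big_cons IHt; last by move=> x tx; apply: e0; right.
    by rewrite !fct_lmodE (e0 (xc w)) ?mulr0 ?addr0//; left.
  rewrite !big_cons -(scaleNr rho e) !tail !mulrDr !opprD !expRD -mulrDl ler_wpM2r ?expR_ge0//.
  set b := f (xc z) - g (xc z).
  rewrite !fct_lmodE.
  have -> : f (xc z) + rho * e (xc z) - g (xc z) = b + rho * e (xc z) by rewrite /b; ring.
  have -> : f (xc z) + - rho * e (xc z) - g (xc z) = b - rho * e (xc z) by rewrite /b; ring.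
  apply: two_point_expR => //.
  by rewrite mulr_ge0// ?(ltW c0)// ler_wpM2l.
Qed.

(** With rho = k^(-1/2) the 2^k combinations have norm 1. With lam = 3 k / c^2, lam (rho c)^2 = 3
    and e^-3 <= 1/4, so each center collects at most (5/4)^k. A combination within c / sqrt (18 m)
    of a center contributes at least e^(-k/6) >= (5/6)^k. Hence 2^k (5/6)^k <= n (5/4)^k. *)
Lemma separated_cover (m n : nat) (t : m.-tuple Z) : (0 < m)%N -> separated t ->
  is_cover (unit_ball H ip) (c / Num.sqrt (18 * m%:R)) (d2 (fun j => xc (tnth t j))) n ->
  (4 / 3) ^+ hits t <= n%:R :> R.
Proof.
move=> m0 st [C [_ cov]].
have m0R : 0 < m%:R :> R by rewrite ltr0n.
have [k0|k0] := posnP (hits t).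
  rewrite k0 expr0; have [|i _] := cov 0.
    by split; [exact: (rkhs0 HK)|rewrite (rknorm0 HK)].
  by rewrite ler1n (leq_ltn_trans _ (ltn_ord i)).
set k := hits t in k0 *.
have k0R : 0 < k%:R :> R by rewrite ltr0n.
pose rho := Num.sqrt k%:R^-1 : R.
have rho2 : rho ^+ 2 = k%:R^-1 by rewrite sqr_sqrtr// invr_ge0 ler0n.
pose lam := 3 * k%:R / c ^+ 2.
have lam0 : 0 <= lam by rewrite divr_ge0 ?sqr_ge0// mulr_ge0// ler0n.
have [L [sL LP LS]] := @sign_combinations lam rho t lam0 (sqrtr_ge0 _) st.
rewrite -/k in sL LP LS.
have q4 : expR (- (lam * (rho * c) ^+ 2)) <= 4^-1.
  rewrite exprMn rho2 /lam (_ : 3 * _ / _ * _ = 3); last by field; rewrite !gt_eqF.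
  rewrite expRN lef_pV2 ?posrE ?expR_gt0//.
  by have := expR_ge1Dx (3 : R); lra.
have near j : (j < size L)%N -> exists i : 'I_n, (5 / 6) ^+ k <=
    expR (- (lam * \sum_(z <- t) (nth 0 L j (xc z) - C i (xc z)) ^+ 2)).
  move=> jL; have [[Hf _] Nf] := LP j jL.
  have [|i] := cov (nth 0 L j).
    by split=> //; rewrite /rknorm Nf rho2 divff ?gt_eqF// sqrtr1.
  rewrite /d2 -(ler_pXn2r (ltn0Sn 1)) ?nnegrE ?sqrtr_ge0 ?divr_ge0 ?(ltW c0)//.
  rewrite expr_div_n !sqr_sqrtr ?mulr_ge0 ?invr_ge0 ?ler0n ?sumr_ge0//; last by move=> l _; exact: sqr_ge0.
  rewrite ler_pdivrMl// => dle; exists i.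
  rewrite big_tuple.
  apply: (@le_trans _ _ (expR (k%:R * - 6^-1))).
    rewrite expRM_natl ler_pXn2r ?nnegrE ?expR_ge0//.
    by have := expR_ge1Dx (- 6^-1 : R); lra.
  rewrite ler_expR mulrN lerN2.
  apply: (@le_trans _ _ (lam * (m%:R * (c ^+ 2 / (18 * m%:R))))).
    by rewrite ler_wpM2l.
  rewrite /lam le_eqVlt; apply/orP; left; apply/eqP; field.
  by rewrite !gt_eqF.
have h1 : 2 ^+ k * (5 / 6) ^+ k <= n%:R * (5 / 4) ^+ k :> R.
  apply: (@le_trans _ _ (\sum_(f <- L) \sum_(i < n)
     expR (- (lam * \sum_(z <- t) (f (xc z) - C i (xc z)) ^+ 2)))).
    have -> : 2 ^+ k = (size L)%:R :> R by rewrite sL natrX.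
    rewrite (big_nth 0) (_ : _ * _ = \sum_(0 <= j < size L) (5 / 6) ^+ k); last first.
      by rewrite sumr_const_nat subn0; exact: mulr_natl.
    apply: ler_sum_nat => j /andP[_ jL]; have [i le_i] := near j jL.
    rewrite (bigD1 i)//= ; apply: le_trans le_i _.
    by rewrite lerDl sumr_ge0// => l _; exact: expR_ge0.
  rewrite exchange_big/= mulr_natl -[X in _ *+ X]card_ord -sumr_const.
  apply: ler_sum => i _; apply: le_trans (LS (C i)) _.
  by rewrite ler_pXn2r ?nnegrE ?addr_ge0 ?expR_ge0//; lra.
have p54 : 0 < (5 / 4) ^+ k :> R by rewrite exprn_gt0//; lra.
rewrite -(ler_pM2r p54); apply: le_trans h1.
rewrite -!exprMn le_eqVlt; apply/orP; left; apply/eqP; congr (_ ^+ k); by field.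
Qed.

End covering_lower_bound.

(* The integral of a nonnegative function is a supremum over the simple functions below it. *)
Lemma le_integral_nonmeasurable {R : realType} d (T : measurableType d)
    (m : {measure set T -> \bar R}) (f g : T -> \bar R) :
  (forall x, 0 <= f x)%E -> (forall x, f x <= g x)%E ->
  (\int[m]_x f x <= \int[m]_x g x)%E.
Proof.
move=> f0 fg; rewrite !ge0_integralTE//; last by move=> x; exact: le_trans (fg x).
apply: le_ereal_sup => _ [h hf <-]; exists h => // x.
exact: le_trans (hf x) (fg x).
Qed.

(* If S meets every measurable set of positive probability, the traces on S of the measurable sets
   carry a probability for which S, although possibly not measurable, has full measure. The
   entropy condition is applied to a sample defined on such a space. *)
Section trace_probability.
Context {R : realType} {d : measure_display} {T : measurableType d}.
Variables (P : probability T R) (S : set T).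
Hypothesis S_full : forall B, measurable B -> B `&` S = set0 -> P B = 0%E.

Definition trace_sets : set (set T) :=
  [set A | exists2 B, measurable B & A `&` S = B `&` S].

Lemma trace_sigma_algebra : sigma_algebra setT trace_sets.
Proof.
split.
- by exists set0.
- move=> A [B mB AB]; exists (~` B); first exact: measurableC.
  rewrite setTD; apply/seteqP; split => x [nx Sx]; split => // Bx; apply: nx.
    by have : (B `&` S) x by []; rewrite -AB => -[].
  by have : (A `&` S) x by []; rewrite AB => -[].
- move=> F FT; have /choice[B BF] n : exists B, measurable B /\ F n `&` S = B `&` S.
    by have [B mB FB] := FT n; exists B.
  exists (\bigcup_n B n); first by apply: bigcup_measurable => n _; case: (BF n).
  by rewrite !setI_bigcupl; apply: eq_bigcupr => n _; case: (BF n).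
Qed.

Lemma measurable_traceE :
  (measurable : set (set (g_sigma_algebraType trace_sets))) = trace_sets.
Proof. exact: sigma_algebra_id trace_sigma_algebra. Qed.

Lemma trace_unique B1 B2 : measurable B1 -> measurable B2 ->
  B1 `&` S = B2 `&` S -> P B1 = P B2.
Proof.
have H C1 C2 : measurable C1 -> measurable C2 -> C1 `&` S = C2 `&` S -> (P C1 <= P C2)%E.
  move=> m1 m2 C12; have -> : P C1 = (P (C1 `\` C2) + P (C1 `&` C2))%E := measureDI P m1 m2.
  rewrite (@S_full (C1 `\` C2)) ?add0e.
  - exact: measureIr.
  - exact: measurableD.
  - apply/seteqP; split=> // x [[C1x nC2x] Sx]; apply: nC2x.
    by have : (C1 `&` S) x by []; rewrite C12 => -[].
by move=> m1 m2 e; apply/eqP; rewrite eq_le !H.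
Qed.

(** The choice of B is immaterial by [trace_unique]; the default matters only for sets outside the
    trace algebra. *)
Definition trace_prob (A : set (g_sigma_algebraType trace_sets)) : \bar R :=
  P (xget set0 [set B | measurable B /\ A `&` S = B `&` S]).

Lemma trace_probE (A : set T) B : measurable B -> A `&` S = B `&` S -> trace_prob A = P B.
Proof.
move=> mB AB; rewrite /trace_prob; case: xgetP => [C _ [mC AC]|/(_ B)].
  by apply: trace_unique => //; rewrite -AC.
by case.
Qed.

Let trace_prob0 : trace_prob set0 = 0%E.
Proof. by rewrite (@trace_probE _ set0)// measure0. Qed.

Let trace_prob_ge0 A : (0 <= trace_prob A)%E.
Proof. exact: measure_ge0. Qed.

Let trace_prob_sigma_additive : semi_sigma_additive trace_prob.
Proof.
move=> F mF tF mUF.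
have /choice[B BF] n : exists B, measurable B /\ F n `&` S = B `&` S.
  by have := mF n; rewrite measurable_traceE => -[B mB FB]; exists B.
have mB n : measurable (B n) by case: (BF n).
have BFS n : F n `&` S = B n `&` S by case: (BF n).
(* The F n are disjoint, but the chosen B n only have disjoint traces on S. Making them disjoint
   removes nothing inside S. *)
have mD n : measurable (seqDU B n).
  by apply: measurableD => //; apply: bigsetU_measurable.
have DFS n : F n `&` S = seqDU B n `&` S.
  rewrite BFS; apply/seteqP; split => x [Bx Sx]; split=> //; last by case: Bx.
  split=> //; rewrite -bigcup_mkord => -[i /= ltin Bi].
  have Fn : F n x by have : (B n `&` S) x by []; rewrite -BFS => -[].
  have Fi : F i x by have : (B i `&` S) x by []; rewrite -BFS => -[].
  have /trivIsetP/(_ i n I I) := tF.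
  by rewrite (ltn_eqF ltin) => /(_ isT)/seteqP[+ _] => /(_ x); apply.
have -> : trace_prob (\bigcup_n F n) = P (\bigcup_n seqDU B n).
  apply: trace_probE; first exact: bigcup_measurable.
  by rewrite !setI_bigcupl; apply: eq_bigcupr => n _.
under eq_fun => n do under eq_bigr => i _ do rewrite (trace_probE (mD i) (DFS i)).
apply: measure_semi_sigma_additive => //; last exact: bigcup_measurable.
Qed.

HB.instance Definition _ := isMeasure.Build _ _ _ trace_prob
  trace_prob0 trace_prob_ge0 trace_prob_sigma_additive.

Let trace_probT : trace_prob setT = 1%E.
Proof. by rewrite (@trace_probE _ setT)// probability_setT. Qed.

HB.instance Definition _ := Measure_isProbability.Build _ _ _ trace_prob trace_probT.

Definition trace_probability : probability (g_sigma_algebraType trace_sets) R := trace_prob.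

Lemma trace_probabilityE (A : set T) B :
  measurable B -> A `&` S = B `&` S -> trace_probability A = P B.
Proof. exact: trace_probE. Qed.

End trace_probability.

(** * Null sets of points far from a countable span *)

Section ae_separable.
Context {R : realType} {d : measure_display} {Z : measurableType d}.
Variable P : probability Z R.
Context {X : Type} {K : X -> X -> R} {H : set (X -> R)}
  {ip : (X -> R) -> (X -> R) -> R}.
Hypothesis HK : is_RKHS K H ip.
Variable xc : Z -> X.
Local Notation far := (@far R X Z K ip xc).
Local Notation sepd := (@separated R X Z K ip xc).

Lemma countable_pts (t : seq Z) : countable (pts xc t).
Proof.
elim: t => [|z t IH]/=; first exact: countable0.
by rewrite -bigcup2E; apply: bigcup_countable => // -[|[|n]] _;
  [exact: countable1|exact: IH|exact: countable0].
Qed.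

(** E is a measurable hull of least probability, over all countable D, of the points far from the
    span over D. If B contains no point far from D', removing B from E leaves such a hull, so by
    minimality B meets E in a null set. *)
Lemma minimal_far_hull (c : R) : exists E D, [/\ measurable E, countable D, far D c `<=` E &
  forall D' B, countable D' -> measurable B -> B `&` far D' c = set0 -> P (E `&` B) = 0%E].
Proof.
pose CC := [set B | measurable B /\ exists D, countable D /\ far D c `<=` B].
pose I := [set fine (P B) | B in CC].
have finP B : measurable B -> P B \is a fin_num by move=> mB; exact: fin_num_measure.
have lI : has_inf I.
  split; first by exists (fine (P setT)), setT; split=> //; exists set0; split => //; exact: countable0.
  by exists 0 => _ [B _ <-]; rewrite fine_ge0.
have /choice[B BP] (n : nat) : exists B, CC B /\ fine (P B) < inf I + n.+1%:R^-1.
  have /(_ _ lI)[//|_ [B CB <-] lt] := @inf_adherent _ I (n.+1%:R^-1).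
  by exists B.
have /choice[D DP] (n : nat) : exists D, countable D /\ far D c `<=` B n.
  by have [[_ [D DB]] _] := BP n; exists D.
have mB n : measurable (B n) by have [[]] := BP n.
pose E := \bigcap_n B n; pose D0 := \bigcup_n D n.
have mE : measurable E by exact: bigcapT_measurable.
have farS D1 D2 : D1 `<=` D2 -> far D2 c `<=` far D1 c.
  by move=> D12 z zD2 g /(kspanS D12); exact: zD2.
have cD0 : countable D0 by apply: bigcup_countable => // n _; case: (DP n).
have DE : far D0 c `<=` E.
  move=> z zD n _; have [_] := DP n; apply; apply: farS zD => x Dx; by exists n.
have EI : fine (P E) <= inf I.
  apply/ler_addgt0Pl => e /ltr_add_invr[n]; rewrite add0r => ne.
  have [_ ltB] := BP n; apply: le_trans (ltW (lt_trans ltB _)); last by rewrite addrC ltrD2r.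
  rewrite fine_le ?finP// le_measure ?inE//.
  exact: bigcap_inf.
exists E, D0; split=> // D' A cD' mA A0.
have mEA : measurable (E `&` A) by exact: measurableI.
have mEnA : measurable (E `\` A) by exact: measurableD.
have CEA : CC (E `\` A).
  (* Enlarging the countable set only shrinks the far set, so the union serves both E and the
     complement of B. *)
  split=> //; exists (D0 `|` D'); split.
    by rewrite -bigcup2E; apply: bigcup_countable => // -[|[|n]] _ //; exact: countable0.
  move=> z zD; split; first by apply: DE; apply: farS zD => x; left.
  move=> Az; have : (A `&` far D' c) z by split => //; apply: farS zD => x; right.
  by rewrite A0.
have le1 : fine (P E) <= fine (P (E `\` A)).
  by apply: le_trans EI _; apply: ge_inf; [case: lI|exists (E `\` A)].
have PE : P E = (P (E `\` A) + P (E `&` A))%E := measureDI P mE mA.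
move: le1; rewrite PE fineD ?finP// gerDl => le0.
by apply/eqP; rewrite eq_le measure_ge0 andbT -(fineK (finP _ mEA)) lee_fin.
Qed.

(** By Fubini: if B contains no separated tuple, then for a separated tail its section lies in E and
    avoids the points far from that tail, hence is null. The tails with a non-null section form a
    measurable set without separated tuples, null by induction. This is what the trace construction
    requires. *)
Lemma separated_full (c : R) (E : set Z) n :
  (forall D' B, countable D' -> measurable B -> B `&` far D' c = set0 -> P (E `&` B) = 0%E) ->
  forall B : set (n.-tuple Z), measurable B ->
    B `&` [set t | sepd E c t] = set0 -> tuple_prob P n B = 0%E.
Proof.
move=> EP; elim: n => [|n IH] B mB B0.
  rewrite (_ : B = set0) ?measure0//; apply/seteqP; split=> // t Bt.
  have : (B `&` [set t : 0.-tuple Z | sepd E c t]) t.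
    by split=> //; rewrite (tuple0 t).
  by rewrite B0.
have mC : measurable (@cons_pair _ _ n @^-1` B).
  by rewrite -[_ @^-1` _]setTI; apply: measurable_cons_pair.
pose g (p : Z * n.-tuple Z) := (\1_(@cons_pair _ _ n @^-1` B) p)%:E : \bar R.
have mg : measurable_fun setT g.
  by apply/measurable_EFinP; exact: measurable_indic.
have g0 p : (0 <= g p)%E by rewrite lee_fin.
have -> : tuple_prob P n.+1 B = (\int[tuple_prob P n]_t \int[P]_z g (z, t))%E.
  rewrite -(@fubini_tonelli _ _ _ _ _ P (tuple_prob P n) g)//.
  rewrite -[RHS]/(\int[P]_x fubini_F (tuple_prob P n) g x)%E -fubini_tonelli1//.
  by rewrite integral_indic// setIT.
have secE t : (\int[P]_z g (z, t) = P (ysection (@cons_pair _ _ n @^-1` B) t))%E.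
  transitivity (\int[P]_z (\1_(ysection (@cons_pair _ _ n @^-1` B) t) z)%:E)%E; last first.
    by rewrite integral_indic ?setIT//; exact: measurable_ysection.
  apply: eq_integral => z _; rewrite /g !indicE; congr (EFin (nat_of_bool _)%:R).
  by rewrite mem_ysection.
have mG := @measurable_fun_fubini_tonelli_G _ _ _ _ _ P g mg g0.
rewrite /fubini_G in mG.
pose N := [set t : n.-tuple Z | (\int[P]_z g (z, t))%E != 0%E].
have mN : measurable N.
  rewrite -[X in measurable X]setTI.
  exact: (emeasurable_neq measurableT mG 0%E).
have PN : tuple_prob P n N = 0%E.
  apply: IH => //; apply/seteqP; split=> // t [Nt St]; apply: contraNP Nt => _ /=.
  rewrite secE.
  set A := ysection _ t.
  have mA : measurable A by exact: measurable_ysection.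
  have AP z : A z -> E z /\ ~ far (pts xc t) c z.
    rewrite /A ysectionE /= => Bz.
    apply: contrapT => nfar.
    have : (B `&` [set t | sepd E c t]) (cons_pair (z, t)).
      split => //=; split=> // Ez; apply: contrapT => nf; exact: nfar.
    by rewrite B0.
  rewrite (_ : A = E `&` A); last by apply/seteqP; split=> [z Az|z []//]; split=> //; case: (AP _ Az).
  apply/eqP; apply: (EP (pts xc t)) => //; first exact: countable_pts.
  by apply/seteqP; split=> // z [/AP[_ nf] /nf].
rewrite (@ae_eq_integral _ _ _ (tuple_prob P n) setT (cst 0%E)) ?integral0//.
exists N; split => //.
by move=> t /= /not_implyP[_ /eqP].
Qed.

Lemma log_covering_ge (S : set (X -> R)) eps dd (x : R) : 1 <= x ->
  (forall n, is_cover S eps dd n -> x <= n%:R) ->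
  ((ln x)%:E <= log_covering_number S eps dd)%E.
Proof.
move=> x1 xn; rewrite /log_covering_number.
have : (x%:E <= covering_number S eps dd)%E.
  by apply: le_ereal_inf_tmp => _ [n /xn nx <-]; rewrite lee_fin.
case: covering_number => [r| |] //; rewrite ?leey// !lee_fin => xr.
by rewrite ler_ln ?posrE; lra.
Qed.

Hypothesis entropy : exists C zeta : R, 0 < zeta < 2 /\
  forall (dO : measure_display) (Omega : measurableType dO) (Q : probability Omega R)
    (m : nat) (Zs : 'I_m -> Omega -> Z), iid_sample Q P Zs -> forall eps : R, 0 < eps ->
  (\int[Q]_w log_covering_number (unit_ball H ip) eps (d2 (fun j => xc (Zs j w)))
     <= (C * eps `^ (- zeta))%:E)%E.

(** A sample under the trace probability is almost surely separated and has m P(E) hits on average,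
    so at scale c / sqrt (18 m) its expected log covering number is at least m P(E) ln (4/3). The
    entropy bound there is O(m^(zeta/2)) with zeta < 2, a contradiction for large m unless P(E) =
    0. *)
Lemma far_hull_null (c : R) (E : set Z) : 0 < c -> measurable E ->
  (forall D' B, countable D' -> measurable B -> B `&` far D' c = set0 -> P (E `&` B) = 0%E) ->
  P E = 0%E.
Proof.
move=> c0 mE EP; have [C [zeta [/andP[z0 z2] ent]]] := entropy.
have finE : P E \is a fin_num by exact: fin_num_measure.
apply/eqP; rewrite eq_le measure_ge0 andbT -(fineK finE) lee_fin leNgt; apply/negP => s0.
set s := fine (P E) in s0.
pose kappa := ln (4 / 3 : R).
have kappa0 : 0 < kappa by rewrite ln_gt0//; lra.
have key (m : nat) : (0 < m)%N ->
    m%:R * (kappa * s) <= C * (c / Num.sqrt (18 * m%:R)) `^ (- zeta).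
  move=> m0; have m0R : 0 < m%:R :> R by rewrite ltr0n.
  pose S := [set t : m.-tuple Z | sepd E c t].
  pose Q := trace_probability (@separated_full c E m EP).
  pose Zs (i : 'I_m) (t : g_sigma_algebraType (trace_sets S)) : Z := tnth (t : m.-tuple Z) i.
  have QE (A : 'I_m -> set Z) : (forall i, measurable (A i)) ->
      Q [set t | forall i, A i (Zs i t)] = (\prod_(i < m) P (A i))%E.
    move=> mA; rewrite -(tuple_prob_box P mA).
    by apply: trace_probabilityE => //; exact: measurable_box.
  have Q1 i A : measurable A -> Q (Zs i @^-1` A) = P A.
    move=> mA; have := QE (fun j => if j == i then A else setT).
    rewrite (bigD1 i)//= eqxx big1 ?mule1 => [<-|j /negbTE ->]; last exact: probability_setT.
      congr (Q _); apply/seteqP; split=> [t tA j|t tA]; first by case: eqP => // ->.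
      by have := tA i; rewrite eqxx.
    by move=> j; case: ifP.
  have mtr (B : set (m.-tuple Z)) A : measurable B -> A `&` S = B `&` S ->
      measurable (A : set (g_sigma_algebraType (trace_sets S))).
    by move=> mB AB; rewrite measurable_traceE; exists B.
  have mti i (A : set Z) : measurable A -> measurable ((fun t : m.-tuple Z => tnth t i) @^-1` A).
    by move=> mA; rewrite -[_ @^-1` _]setTI; exact: measurable_tnth.
  have iid : iid_sample Q P Zs.
    split; [|split] => [i _ A mA|i A mA|A mA].
    - by rewrite setTI; apply: (mtr _ _ (mti i A mA)).
    - exact: Q1.
    - under eq_bigr => i _ do rewrite (Q1 i _ (mA i)).
      rewrite -QE//; congr (Q _); apply/seteqP.
      by split=> [t tA i|t tA i _]; [exact: (tA i I)|exact: tA].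
  have eps0 : 0 < c / Num.sqrt (18 * m%:R).
    by rewrite divr_gt0// sqrtr_gt0 mulr_gt0.
  have := ent _ _ Q m Zs iid _ eps0; rewrite -lee_fin; apply: le_trans.
  (* Intersecting with S does not change the probability, and makes the lower bound on the covering
     number hold at every sample: off S it is 0. *)
  pose A i : set (g_sigma_algebraType (trace_sets S)) := (Zs i @^-1` E) `&` S.
  have AS i : A i `&` S = ((fun t : m.-tuple Z => tnth t i) @^-1` E) `&` S.
    by rewrite /A -setIA setIid.
  have mA i : measurable (A i) := mtr _ _ (mti i E mE) (AS i).
  have QA i : Q (A i) = P E.
    rewrite (trace_probabilityE _ (mti i E mE) (AS i)) -(Q1 i)//.
    by apply/esym/trace_probabilityE => //; exact: mti.
  apply: (@le_trans _ _ (\int[Q]_t (\sum_(i < m) kappa%:E * (\1_(A i) t)%:E))%E); last first.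
    apply: le_integral_nonmeasurable => t.
      by apply: sume_ge0 => i _; rewrite mule_ge0// lee_fin ?(ltW kappa0).
    have [St|nSt] := pselect (S t); last first.
      rewrite big1 => [|i _].
        apply: (le_trans _ (log_covering_ge (lexx 1) _)); first by rewrite ln1.
        move=> n [C' [_ cov]].
        have [|i _] := cov 0; last by rewrite ler1n (leq_ltn_trans _ (ltn_ord i)).
        by split; [exact: (rkhs0 HK)|rewrite (rknorm0 HK)].
      by rewrite indicE memNset ?mule0// => -[].
    apply: (@le_trans _ _ (ln ((4 / 3) ^+ hits E t))%:E); last first.
      apply: log_covering_ge; first by rewrite exprn_ege1//; lra.
      move=> n; exact: (separated_cover HK c0 m0 St).
    rewrite -ge0_sume_distrr; last by move=> i _; rewrite lee_fin.
    rewrite lnXn; last lra.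
    rewrite sumEFin -EFinM lee_fin -/kappa mulrC -[leRHS]mulr_natl ler_wpM2r ?(ltW kappa0)//.
    rewrite /hits -sum1_count natr_sum big_tuple [leRHS]big_mkcond; apply: ler_sum => i _.
    rewrite indicE; case: asboolP => [Ei|nEi]; first by rewrite lern1 leq_b1.
    by rewrite memNset// => -[].
  rewrite ge0_integral_sum//; last first.
  - by move=> i t _; rewrite mule_ge0// lee_fin ltW.
  - move=> i; apply: emeasurable_funM => //; apply/measurable_EFinP; exact: measurable_indic.
  have IA i : (\int[Q]_t (kappa%:E * (\1_(A i) t)%:E) = (kappa * s)%:E)%E.
    rewrite ge0_integralZl_EFin ?(ltW kappa0)//; last by apply/measurable_EFinP; exact: measurable_indic.
    rewrite integral_indic// setIT -[LHS]/(kappa%:E * Q (A i))%E QA.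
    by rewrite -(fineK finE).
  under eq_bigr do rewrite IA.
  by rewrite sumEFin lee_fin sumr_const card_ord mulr_natl.
pose p := 1 - zeta / 2.
have p0 : 0 < p by rewrite /p; lra.
pose M := C * (c / Num.sqrt 18) `^ (- zeta) / (kappa * s).
have ks : 0 < kappa * s by rewrite mulr_gt0.
(* Large enough for m^p > |M| with p = 1 - zeta/2, which contradicts [key] after division by
   m^(zeta/2). *)
pose m := (Num.bound (`|M| `^ p^-1)).+1.
have m0 : 0 < m%:R :> R by rewrite ltr0n.
have := key m isT; rewrite leNgt => /negP; apply.
have s18 : 0 < Num.sqrt 18 :> R by rewrite sqrtr_gt0.
have -> : (c / Num.sqrt (18 * m%:R)) `^ (- zeta) =
    (c / Num.sqrt 18) `^ (- zeta) * m%:R `^ (zeta / 2).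
  rewrite sqrtrM// invfM mulrA powRM ?invr_ge0 ?sqrtr_ge0 ?divr_ge0 ?(ltW c0)//.
  congr (_ * _); rewrite -powR12_sqrt ?ler0n// -powRN -powRrM; congr (_ `^ _).
  by field.
set B := (c / Num.sqrt 18) `^ (- zeta); set D := m%:R `^ (zeta / 2).
have mpow : m%:R = m%:R `^ p * D.
  by rewrite -powRD ?(gt_eqF m0) ?implybT// /p subrK powRr1// ltW.
have -> : C * (B * D) = M * D * (kappa * s) by rewrite /M -/B; field; rewrite !gt_eqF.
rewrite ltr_pM2r// [ltRHS]mpow ltr_pM2r ?powR_gt0//.
apply: le_lt_trans (ler_norm _) _.
have -> : `|M| = (`|M| `^ p^-1) `^ p by rewrite -powRrM mulVf ?gt_eqF// powRr1.
apply: gt0_ltr_powR; rewrite ?nnegrE ?powR_ge0//.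
rewrite /m -natr1; apply: lt_trans (archi_boundP (powR_ge0 _ _)) _.
by rewrite ltrDl.
Qed.

(** Distances c = 1/(n+1) are treated one by one; the union of the countable sets and that of the
    null hulls work for all n at once. *)
Lemma ae_kclosure : exists D N, [/\ countable D, measurable N, P N = 0%E &
  forall z, ~ N z -> @kclosure R X K H ip D (K (xc z))].
Proof.
have /choice[E EP] (n : nat) : exists E, exists D, [/\ measurable E, P E = 0%E, countable D &
    far D n.+1%:R^-1 `<=` E].
  have [E [D [mE cD DE EP]]] := minimal_far_hull n.+1%:R^-1.
  by exists E, D; split => //; apply: (far_hull_null _ mE EP); rewrite invr_gt0.
have /choice[D DP] n := EP n.
exists (\bigcup_n D n), (\bigcup_n E n); split.
- by apply: bigcup_countable => // n _; case: (DP n).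
- by apply: bigcup_measurable => n _; case: (DP n).
- apply: measure_negligible; first by apply: bigcup_measurable => n _; case: (DP n).
  apply: negligible_bigcup => n; have [mE PE _ _] := DP n.
  by exists (E n); split.
- move=> z nE; split; first exact: (rkhsK HK).
  move=> e e0; have [n ne] := ltr_add_invr e0; rewrite add0r in ne.
  have [_ _ _ DE] := DP n.
  have : ~ far (D n) n.+1%:R^-1 z by move=> /DE Ez; apply: nE; exists n.
  move=> /existsNP[g /not_implyP[Dg /negP]]; rewrite -ltNge => gn.
  exists g; last exact: lt_trans ne.
  by apply: kspanS Dg => x Dx; exists n.
Qed.

End ae_separable.

(** * Comparison theorem for the hinge loss *)

Section weights.
Import HBNNSimple.
Local Open Scope ereal_scope.
Context {R : realType} {d d' : measure_display} {T : measurableType d} {X : measurableType d'}.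
Variables (P : {measure set T -> \bar R}) (p : T -> X) (w1 w2 : T -> R).
Hypotheses (mp : measurable_fun setT p) (mw1 : measurable_fun setT w1) (mw2 : measurable_fun setT w2).
Hypotheses (w1_ge0 : forall z, (0 <= w1 z)%R) (w2_ge0 : forall z, (0 <= w2 z)%R).
Hypothesis w12 : forall A, measurable A ->
  \int[P]_(z in p @^-1` A) (w1 z)%:E = \int[P]_(z in p @^-1` A) (w2 z)%:E.

Let mpre A : measurable A -> measurable (p @^-1` A).
Proof. by move=> mA; rewrite -[_ @^-1` _]setTI; exact: mp. Qed.

Let integral_nnsfun_weight (w : T -> R) (g : {nnsfun X >-> R}) :
  measurable_fun setT w -> (forall z, 0 <= w z)%R ->
  \int[P]_z ((g (p z))%:E * (w z)%:E) =
  \sum_(k \in range g) (k%:E * \int[P]_(z in p @^-1` (g @^-1` [set k])) (w z)%:E).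
Proof.
move=> mw w0.
have mk k : measurable (p @^-1` (g @^-1` [set k])) by apply: mpre.
have mi k : measurable_fun setT (fun z => (\1_(p @^-1` (g @^-1` [set k])) z)%:E * (w z)%:E).
  by apply: emeasurable_funM; apply/measurable_EFinP => //; exact: measurable_indic.
transitivity (\int[P]_z \sum_(k \in range g) (k%:E * ((\1_(p @^-1` (g @^-1` [set k])) z)%:E * (w z)%:E))).
  apply: eq_integral => z _; rewrite fimfunE -fsumEFin// ge0_mule_fsuml//.
    by apply: eq_fsbigr => k _; rewrite muleA -EFinM.
  by move=> k; rewrite nnfun_muleindic_ge0.
rewrite ge0_integral_fsum//; last 2 first.
- by move=> k; exact: measurable_funeM.
- move=> k z _; have [k0|k0] := leP 0%R k.
    by rewrite mule_ge0// mule_ge0// lee_fin.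
  by rewrite /indic memNset ?mul0e ?mule0//= => gk; have : (0 <= g (p z))%R by []; rewrite gk leNgt k0.
apply: eq_fsbigr => k; rewrite inE => -[x _ <-].
rewrite ge0_integralZl//; last 2 first.
- by move=> z _; rewrite mule_ge0// lee_fin.
- by rewrite lee_fin.
congr (_ * _); rewrite integral_mkcond [RHS]integral_mkcond.
by apply: eq_integral => z _; rewrite patchT ?inE// epatch_indic muleC.
Qed.

(** Equality on preimages of sets extends to simple functions of p z, then to nonnegative G by
    monotone convergence. *)
Lemma integral_weight_eq (G : X -> R) : measurable_fun setT G -> (forall x, 0 <= G x)%R ->
  \int[P]_z ((G (p z))%:E * (w1 z)%:E) = \int[P]_z ((G (p z))%:E * (w2 z)%:E).
Proof.
move=> mG G0; have mG' : measurable_fun setT (EFin \o G) by exact/measurable_EFinP.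
pose g := nnsfun_approx measurableT mG'.
have lim_weight (w : T -> R) : measurable_fun setT w -> (forall z, 0 <= w z)%R ->
    \int[P]_z ((G (p z))%:E * (w z)%:E) = limn (fun n => \int[P]_z ((g n (p z))%:E * (w z)%:E)).
  move=> mw w0; rewrite -monotone_convergence//.
  - apply: eq_integral => z _; apply/esym/cvg_lim => //.
    by apply: cvgeZr => //; apply: cvg_nnsfun_approx => // x _; rewrite /= lee_fin.
  - move=> n; apply: emeasurable_funM; apply/measurable_EFinP => //; exact: measurableT_comp.
  - by move=> n z _; rewrite mule_ge0// lee_fin.
  - move=> z _ m n mn; rewrite lee_wpmul2r ?lee_fin//; exact/lefP/nd_nnsfun_approx.
rewrite !lim_weight//; congr (limn _); apply/funext => n.
rewrite !integral_nnsfun_weight//; apply: eq_fsbigr => k _; congr (_ * _).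
exact: w12.
Qed.

End weights.

Section hinge_comparison.
Context {R : realType} {d : measure_display} {X : measurableType d}.
Variables (rho : probability (X * R)%type R) (eta : X -> R).
Hypothesis rho_Y : rho [set z | z.2 = 1 \/ z.2 = -1] = 1%E.
Hypothesis eta_cond : cond_prob_one rho eta.

(* Labels are 1 or -1 only almost surely. *)
Definition label (y : R) : R := if y == 1 then 1 else -1.

Lemma measurable_label : measurable_fun setT label.
Proof.
apply: measurable_fun_ifT => //; exact: measurable_fun_eqr.
Qed.

Lemma measurable_fun_hinge d' (T : measurableType d') (g1 g2 : T -> R) :
  measurable_fun setT g1 -> measurable_fun setT g2 ->
  measurable_fun setT (fun t => hinge (g1 t) (g2 t)).
Proof.
by move=> m1 m2; apply: measurable_maxr => //; apply: measurable_funB => //; exact: measurable_funM.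
Qed.

Lemma measurable_label_set : measurable [set z : X * R | z.2 = 1 \/ z.2 = -1].
Proof.
rewrite (_ : [set _ | _] = snd @^-1` ([set 1] `|` [set -1])); last by [].
rewrite -[_ @^-1` _]setTI; apply: measurable_snd => //.
by apply: measurableU; exact: measurable_set1.
Qed.

Lemma ae_label : {ae rho, forall z, z.2 = label z.2}.
Proof.
exists (~` [set z | z.2 = 1 \/ z.2 = -1]); split.
- by apply: measurableC; exact: measurable_label_set.
- rewrite [LHS](probability_setC rho measurable_label_set).
  by rewrite -[rho [set _ | _]]/(rho [set z | z.2 = 1 \/ z.2 = -1]) rho_Y subee.
- move=> z /= nz [] yE; apply: nz; rewrite /label yE ?eqxx//.
  by case: eqP => //; lra.
Qed.

Lemma eta_measurable : measurable_fun setT eta. Proof. by case: eta_cond. Qed.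

Lemma eta_itv x : 0 <= eta x <= 1. Proof. by case: eta_cond => _ []. Qed.

(** [cond_prob_one] describes only the label 1. The integral over the other labels is obtained by
    subtraction from that of G2, and the bound M keeps the subtracted term finite. *)
Lemma label_integral (G1 G2 : X -> R) (M : R) :
  measurable_fun setT G1 -> measurable_fun setT G2 ->
  (forall x, 0 <= G1 x) -> (forall x, 0 <= G2 x <= M) ->
  (\int[rho]_z (if z.2 == 1 then G1 z.1 else G2 z.1)%:E =
   \int[rho]_z (eta z.1 * G1 z.1 + (1 - eta z.1) * G2 z.1)%:E)%E.
Proof.
move=> m1 m2 G10 G2M.
pose D := [set z : X * R | z.2 = 1].
have mD : measurable D.
  rewrite (_ : D = snd @^-1` [set 1]); last by [].
  by rewrite -[_ @^-1` _]setTI; apply: measurable_snd => //; exact: measurable_set1.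
have mfst (G : X -> R) : measurable_fun setT G -> measurable_fun setT (fun z : X * R => G z.1).
  by move=> mG; exact: (measurableT_comp mG measurable_fst).
have mind : measurable_fun setT (\1_D : X * R -> R) by exact: measurable_indic.
have mE := mfst _ eta_measurable.
have cond (G : X -> R) : measurable_fun setT G -> (forall x, 0 <= G x) ->
   (\int[rho]_z (G z.1 * \1_D z)%:E = \int[rho]_z (G z.1 * eta z.1)%:E)%E.
  move=> mG G0.
  apply: (@integral_weight_eq _ _ _ _ _ rho fst (\1_D) (fun z => eta z.1)) => //.
  - by move=> z; case/andP: (eta_itv z.1).
  move=> A mA; have [_ [_ /(_ _ mA)]] := eta_cond.
  rewrite (_ : A `*` [set: R] = fst @^-1` A); last first.
    by apply/seteqP; split=> [z []//|z Az]; split.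
  move=> <-; rewrite integral_indic//; last by rewrite -[_ @^-1` _]setTI; exact: measurable_fst.
  by congr (rho _); apply/seteqP; split => [z [? ?]//|z [? ?]].
have G20 x : 0 <= G2 x by case/andP: (G2M x).
have split_weight (w : X * R -> R) : measurable_fun setT w -> (forall z, 0 <= w z <= 1) ->
    (\int[rho]_z (w z * G1 z.1 + (1 - w z) * G2 z.1)%:E =
     \int[rho]_z (G1 z.1 * w z)%:E + \int[rho]_z (G2 z.1 * (1 - w z))%:E)%E /\
    (\int[rho]_z (G2 z.1 * w z)%:E + \int[rho]_z (G2 z.1 * (1 - w z))%:E =
     \int[rho]_z (G2 z.1)%:E)%E.
  move=> mw w01.
  have mG1w : measurable_fun setT (fun z => (G1 z.1 * w z)%:E).
    by apply/measurable_EFinP; apply: measurable_funM => //; exact: mfst.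
  have mG2w : measurable_fun setT (fun z => (G2 z.1 * w z)%:E).
    by apply/measurable_EFinP; apply: measurable_funM => //; exact: mfst.
  have mG2w' : measurable_fun setT (fun z => (G2 z.1 * (1 - w z))%:E).
    apply/measurable_EFinP; apply: measurable_funM; first exact: mfst.
    exact: measurable_funB.
  have w0 z : 0 <= w z by case/andP: (w01 z).
  have w1 z : 0 <= 1 - w z by rewrite subr_ge0; case/andP: (w01 z).
  split; rewrite -ge0_integralD//; try by [move=> z _; rewrite lee_fin mulr_ge0].
    by apply: eq_integral => z _; rewrite -EFinD; congr EFin; ring.
  by apply: eq_integral => z _; rewrite -EFinD; congr EFin; ring.
have ind01 (z : X * R) : 0 <= (\1_D z : R) <= 1 by rewrite indicE; case: (_ \in _); rewrite /= ?lexx ler01.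
have [s1 t1] := split_weight _ mind ind01.
have [s2 t2] := split_weight _ mE (fun z => eta_itv z.1).
transitivity (\int[rho]_z (\1_D z * G1 z.1 + (1 - \1_D z) * G2 z.1)%:E)%E.
  apply: eq_integral => z _; congr EFin; rewrite indicE; case: eqP => y1.
    by rewrite mem_set// mul1r subrr mul0r addr0.
  by rewrite memNset// mul0r subr0 mul1r add0r.
rewrite s1 s2 cond//; congr (_ + _)%E.
have fin : (\int[rho]_z (G2 z.1 * eta z.1)%:E)%E \is a fin_num.
  apply: integrable_fin_num => //.
  apply: (@measurable_bounded_integrable _ _ _ _ (fun z : X * R => G2 z.1 * eta z.1)) => //.
  - by apply: le_lt_trans (probability_le1 rho measurableT) _; rewrite ltry.
  - by apply: measurable_funM => //; exact: mfst.
  - exists M; split; first exact: num_real.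
    move=> y My z _ /=; have /andP[g0 gM] := G2M z.1; have /andP[e0 e1] := eta_itv z.1.
    rewrite ger0_norm ?mulr_ge0//; nra.
have := congr1 (fun u => (u - \int[rho]_z (G2 z.1 * eta z.1)%:E)%E) (etrans t2 (esym t1)).
by rewrite cond// [X in (X - _)%E]addeC addeK// [X in _ = (X - _)%E -> _]addeC addeK.
Qed.

Let J (G1 G2 : X -> R) : \bar R :=
  (\int[rho]_z (eta z.1 * G1 z.1 + (1 - eta z.1) * G2 z.1)%:E)%E.

Lemma exp_risk_label (f : X -> R) : measurable_fun setT f ->
  exp_risk rho (@hinge R) f = (\int[rho]_z (hinge (label z.2) (f z.1))%:E)%E.
Proof.
move=> mf; rewrite /exp_risk; apply: ge0_ae_eq_integral => //.
- apply/measurable_EFinP; apply: measurable_fun_hinge => //.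
  exact: (measurableT_comp mf measurable_fst).
- apply/measurable_EFinP; apply: measurable_fun_hinge.
    exact: (measurableT_comp measurable_label measurable_snd).
  exact: (measurableT_comp mf measurable_fst).
- by move=> z _; rewrite lee_fin /hinge le_max lexx orbT.
- by move=> z _; rewrite lee_fin /hinge le_max lexx orbT.
- by apply: filterS ae_label => z /= zE _; rewrite {1}zE.
Qed.

Lemma exp_risk_hingeE (f : X -> R) (M : R) : measurable_fun setT f -> (forall x, `|f x| <= M) ->
  exp_risk rho (@hinge R) f = J (hinge 1 \o f) (hinge (-1) \o f).
Proof.
move=> mf fM; rewrite exp_risk_label//.
have mh (y : R) : measurable_fun setT (hinge y \o f).
  exact: measurable_fun_hinge.
rewrite /J -(@label_integral _ _ (1 + M))//.
- by apply: eq_integral => z _; rewrite /label; case: eqP.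
- by move=> x; rewrite /= /hinge le_max lexx orbT.
- move=> x; have := fM x; rewrite /= /hinge le_max lexx orbT ge_max ler_norml => /andP[].
  by lra.
Qed.

Lemma measurable_fun_neq (b : X -> R) (y : R) :
  measurable_fun setT b -> measurable_fun setT (fun x => (b x != y)%:R : R).
Proof.
move=> mb; rewrite (_ : (fun _ => _) = (fun x => if b x == y then 0 else 1)).
  by apply: measurable_fun_ifT => //; exact: measurable_fun_eqr.
by apply/funext => x; case: eqP.
Qed.

Lemma measurable_misclassified (b : X -> R) : measurable_fun setT b ->
  measurable [set z : X * R | z.2 <> b z.1].
Proof.
move=> mb.
have mbf : measurable_fun setT (fun z : X * R => b z.1) := measurableT_comp mb measurable_fst.
rewrite (_ : [set _ | _] = (fun z : X * R => z.2 == b z.1) @^-1` [set false]).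
  by rewrite -[_ @^-1` _]setTI; apply: measurable_fun_eqr.
by apply/seteqP; split => z /=; [move/eqP/negbTE|move/negbT/eqP].
Qed.

Lemma mis_risk_label (b : X -> R) : measurable_fun setT b ->
  rho [set z | z.2 <> b z.1] = J (fun x => (b x != 1)%:R) (fun x => (b x != -1)%:R).
Proof.
move=> mb.
rewrite /J -(@label_integral (fun x => (b x != 1)%:R) (fun x => (b x != -1)%:R) 1)//; last first.
- by move=> x; case: eqP; rewrite /= ?lexx ?ler01.
- exact: measurable_fun_neq.
- exact: measurable_fun_neq.
have mbf : measurable_fun setT (fun z : X * R => b z.1) := measurableT_comp mb measurable_fst.
have mN := measurable_misclassified mb.
rewrite -[X in rho X]setIT -integral_indic//.
apply: ge0_ae_eq_integral => //.
- by apply/measurable_EFinP; exact: measurable_indic.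
- apply/measurable_EFinP; apply: measurable_fun_ifT.
  + exact: measurable_fun_eqr.
  + exact: (measurableT_comp (measurable_fun_neq 1 mb) measurable_fst).
  + exact: (measurableT_comp (measurable_fun_neq (-1) mb) measurable_fst).
- by move=> z _; rewrite lee_fin; case: ifP.
apply: filterS ae_label => z zE _; rewrite indicE.
have -> : (z \in [set z : X * R | z.2 <> b z.1]) = (b z.1 != z.2).
  by case: eqP => [e|e]; [rewrite memNset//= e|rewrite mem_set//= => /esym].
by move: zE; rewrite /label; case: eqP => [->|_ ->].
Qed.

(** Conditioned on x, both inequalities are pointwise in e = eta x and a = f x, and are checked
    according to whether e >= 1/2 and a >= 0. Sums on both sides avoid differences of extended
    reals. *)
Lemma hinge_comparison (f : X -> R) (M : R) : measurable_fun setT f -> (forall x, `|f x| <= M) ->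
  (rho [set z | z.2 <> bayes_rule eta z.1] <= rho [set z | z.2 <> sign f z.1])%E /\
  (exp_risk rho (@hinge R) (bayes_rule eta) + rho [set z | z.2 <> sign f z.1] <=
   exp_risk rho (@hinge R) f + rho [set z | z.2 <> bayes_rule eta z.1])%E.
Proof.
move=> mf fM.
have mb : measurable_fun setT (bayes_rule eta).
  apply: measurable_fun_ifT => //; apply: measurable_fun_ler => //; exact: eta_measurable.
have ms : measurable_fun setT (sign f).
  by apply: measurable_fun_ifT => //; exact: measurable_fun_ler.
rewrite !mis_risk_label// (@exp_risk_hingeE f M)// (@exp_risk_hingeE _ 1)//; last first.
  by move=> x; rewrite /bayes_rule; case: ifP; rewrite ?normrN normr1.
have mJ (G1 G2 : X -> R) : measurable_fun setT G1 -> measurable_fun setT G2 ->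
    measurable_fun setT (fun z : X * R => (eta z.1 * G1 z.1 + (1 - eta z.1) * G2 z.1)%:E).
  move=> m1 m2; apply/measurable_EFinP.
  apply: (measurableT_comp (f := fun x => eta x * G1 x + (1 - eta x) * G2 x) _ measurable_fst).
  have me := eta_measurable.
  by apply: measurable_funD; apply: measurable_funM => //; exact: measurable_funB.
have J0 (G1 G2 : X -> R) : (forall x, 0 <= G1 x) -> (forall x, 0 <= G2 x) ->
    forall z : X * R, (0 <= (eta z.1 * G1 z.1 + (1 - eta z.1) * G2 z.1)%:E)%E.
  move=> G10 G20 z; have /andP[e0 e1] := eta_itv z.1.
  by rewrite lee_fin addr_ge0// mulr_ge0// subr_ge0.
have mh (g : X -> R) (y : R) : measurable_fun setT g -> measurable_fun setT (hinge y \o g).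
  by move=> mg; exact: measurable_fun_hinge.
have h0 (g : X -> R) y x : 0 <= (hinge y \o g) x by rewrite /= /hinge le_max lexx orbT.
have mi0 (b : X -> R) y x : 0 <= (b x != y)%:R :> R by [].
pose F (b : X -> R) (z : X * R) := (eta z.1 * (b z.1 != 1)%:R + (1 - eta z.1) * (b z.1 != -1)%:R)%:E.
pose G (g : X -> R) (z : X * R) := (eta z.1 * hinge 1 (g z.1) + (1 - eta z.1) * hinge (-1) (g z.1))%:E.
have F0 b z : (0 <= F b z)%E by exact: (J0 (fun x => (b x != 1)%:R) (fun x => (b x != -1)%:R)).
have G0 g z : (0 <= G g z)%E by exact: (J0 (hinge 1 \o g) (hinge (-1) \o g)).
have mF b : measurable_fun setT b -> measurable_fun setT (F b).
  by move=> m; apply: (mJ (fun x => (b x != 1)%:R) (fun x => (b x != -1)%:R)); exact: measurable_fun_neq.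
have mG g : measurable_fun setT g -> measurable_fun setT (G g).
  by move=> m; apply: (mJ (hinge 1 \o g) (hinge (-1) \o g)); exact: mh.
have n11 : (-1 == 1 :> R) = false by apply/negbTE; rewrite -subr_eq0; apply/negP => /eqP; lra.
have n12 : (1 == -1 :> R) = false by rewrite eq_sym.
rewrite -[X in (X <= _)%E /\ _]/(\int[rho]_z F (bayes_rule eta) z)%E.
split.
  apply: (@ge0_le_integral _ _ _ rho setT measurableT (F (bayes_rule eta)) (F (sign f))) => //=;
    try exact: mF.
  move=> z _; rewrite lee_fin; have /andP[e0 e1] := eta_itv z.1.
  by rewrite /bayes_rule /sign; case: (leP 2^-1 (eta z.1)) => ?; case: (leP 0 (f z.1)) => ?;
    rewrite ?eqxx ?n11 ?n12 /=; lra.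
rewrite /J -[leLHS]/(\int[rho]_z G (bayes_rule eta) z + \int[rho]_z F (sign f) z)%E.
rewrite -[leRHS]/(\int[rho]_z G f z + \int[rho]_z F (bayes_rule eta) z)%E.
rewrite -!ge0_integralD//; try by [exact: mF|exact: mG].
apply: ge0_le_integral => //=.
- by move=> z _; exact: adde_ge0.
- by apply: emeasurable_funD; [exact: mG|exact: mF].
- by apply: emeasurable_funD; [exact: mG|exact: mF].
move=> z _; rewrite -!EFinD lee_fin; have /andP[e0 e1] := eta_itv z.1.
rewrite /hinge !mul1r !mulN1r !opprK /bayes_rule /sign.
move: (eta z.1) (f z.1) e0 e1 => e a e0 e1.
have m1 : Num.max (1 - a) 0 >= 1 - a by rewrite le_max lexx.
have m2 : Num.max (1 - a) 0 >= 0 by rewrite le_max lexx orbT.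
have m3 : Num.max (1 + a) 0 >= 1 + a by rewrite le_max lexx.
have m4 : Num.max (1 + a) 0 >= 0 by rewrite le_max lexx orbT.
have m5 : Num.max (1 - 1) 0 = 0 :> R by rewrite subrr maxxx.
have m6 : Num.max (1 + 1) 0 = 2 :> R by apply/max_idPl.
move: (Num.max (1 - a) 0) (Num.max (1 + a) 0) m1 m2 m3 m4 => u v m1 m2 m3 m4.
by case: (leP 2^-1 e) => ?; case: (leP 0 a) => ?; rewrite ?opprK ?m5 ?m6 ?eqxx ?n11 ?n12 /=; nra.
Qed.

End hinge_comparison.

(** * Gradient descent for the hinge loss *)

Section hinge_loss.
Context {R : realType}.
Implicit Types y a b : R.

Lemma hinge_ge0 y a : 0 <= hinge y a.
Proof. by rewrite /hinge le_max lexx orbT. Qed.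

Lemma hinge_lip y a b : y = 1 \/ y = -1 -> `|hinge y a - hinge y b| <= `|a - b|.
Proof.
move=> y1; rewrite /hinge ler_norml.
have h1 := ler_norm (a - b); have h2 := ler_norm (b - a); rewrite distrC in h2.
have h3 := normr_ge0 (a - b).
by case: y1 => ->; case: (leP (1 - _ * a) 0) => ?; case: (leP (1 - _ * b) 0) => ?; apply/andP; split; lra.
Qed.

Lemma left_deriv_hinge_near y a (c : R) :
  (\forall h \near (0 : R)^'+, (hinge y a - hinge y (a - h)) / h = c) ->
  left_deriv (@hinge R) y a = c.
Proof. by move=> hc; rewrite /left_deriv; apply: lim_near_cst. Qed.

(** The difference quotients are eventually constant as h tends to 0 from the right. They look to
    the left, so the kink belongs to the branch of slope -1 for y = 1 and to the flat branch for y =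
    -1. *)
Lemma left_deriv_hinge_subgradient y a : y = 1 \/ y = -1 ->
  `|left_deriv (@hinge R) y a| <= 1 /\
  forall b, left_deriv (@hinge R) y a * (a - b) >= hinge y a - hinge y b.
Proof.
case=> ->.
- have [a1|a1] := leP a 1.
    have -> : left_deriv (@hinge R) 1 a = -1.
      apply: left_deriv_hinge_near; near=> h.
      have h0 : 0 < h by [].
      rewrite /hinge !mul1r (max_idPl _) ?(max_idPl _); [|lra|lra].
      by field; rewrite gt_eqF.
    split; first by rewrite normrN1.
    move=> b; rewrite /hinge !mul1r (max_idPl _); last lra.
    by case: (leP (1 - b) 0) => ?; lra.
  have -> : left_deriv (@hinge R) 1 a = 0.
    apply: left_deriv_hinge_near; near=> h.
    have h0 : h < a - 1 by near: h; apply: nbhs_right_lt; lra.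
    by rewrite /hinge !mul1r (max_idPr _) ?(max_idPr _) ?subrr ?mul0r//; lra.
  split; first by rewrite normr0.
  move=> b; rewrite mul0r /hinge !mul1r (max_idPr _); last lra.
  by case: (leP (1 - b) 0) => ?; lra.
- have [a1|a1] := leP a (-1).
    have -> : left_deriv (@hinge R) (-1) a = 0.
      apply: left_deriv_hinge_near; near=> h.
      have h0 : 0 < h by [].
      by rewrite /hinge (max_idPr _) ?(max_idPr _) ?subrr ?mul0r//; lra.
    split; first by rewrite normr0.
    move=> b; rewrite mul0r /hinge (max_idPr _); last lra.
    by case: (leP (1 - -1 * b) 0) => ?; lra.
  have -> : left_deriv (@hinge R) (-1) a = 1.
    apply: left_deriv_hinge_near; near=> h.
    have h0 : 0 < h by [].
    have h1 : h < a + 1 by near: h; apply: nbhs_right_lt; lra.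
    rewrite /hinge (max_idPl _) ?(max_idPl _); [|lra|lra].
    by field; rewrite gt_eqF.
  split; first by rewrite normr1.
  move=> b; rewrite /hinge (max_idPl _); last lra.
  by case: (leP (1 - -1 * b) 0) => ?; lra.
Unshelve. all: by end_near. Qed.

End hinge_loss.

(** * Norm of the iterates and empirical risk of the last one *)

Section gradient_descent.
Context {R : realType} {X : Type} {K : X -> X -> R} {H : set (X -> R)}
  {ip : (X -> R) -> (X -> R) -> R}.
Hypothesis HK : is_RKHS K H ip.
Local Notation V := (fct_lmod R X).
Local Notation N := (rknorm ip).
Variables (kap theta eta1 : R).
Hypothesis kap0 : 0 <= kap.
Hypothesis Kkap : forall x, K x x <= kap ^+ 2.
Hypothesis theta_range : 2^-1 < theta < 1.
Hypothesis eta1_gt0 : 0 < eta1.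
Local Notation eta := (stepsize eta1 theta).

Definition emp_risk (m : nat) (xs : 'I_m -> X) (ys : 'I_m -> R) (f : X -> R) : R :=
  m%:R^-1 * \sum_(j < m) hinge (ys j) (f (xs j)).

Lemma emp_risk_ge0 m xs ys f : 0 <= @emp_risk m xs ys f.
Proof. by rewrite mulr_ge0 ?invr_ge0 ?ler0n// sumr_ge0// => j _; exact: hinge_ge0. Qed.

Let eta_gt0 t : (0 < t)%N -> 0 < eta t.
Proof. by move=> t0; rewrite mulr_gt0// powR_gt0// ltr0n. Qed.

Section sample.
Variables (m : nat) (xs : 'I_m -> X) (ys : 'I_m -> R).
Hypothesis m_gt0 : (0 < m)%N.
Hypothesis ysP : forall j, ys j = 1 \/ ys j = -1.
Local Notation f := (gd_iter K (left_deriv (@hinge R)) eta xs ys).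
Local Notation Ez := (emp_risk xs ys).

Lemma gd_hinge_step n (h : V) : H h ->
  N ((f n.+1 : V) - h) ^+ 2 + 2 * eta n.+1 * (Ez (f n) - Ez h)
    <= N ((f n : V) - h) ^+ 2 + (kap * eta n.+1) ^+ 2.
Proof.
move=> Hh.
have V1 j : `|left_deriv (@hinge R) (ys j) (f n (xs j))| <= 1.
  by have [] := left_deriv_hinge_subgradient (f n (xs j)) (ysP j).
have := gd_iter_step HK kap0 Kkap m_gt0 V1 Hh.
rewrite [eta n.+1 * kap]mulrC.
set S := m%:R^-1 * _ => step.
have le_S : Ez (f n) - Ez h <= S.
  rewrite /emp_risk -mulrBr ler_wpM2l ?invr_ge0 ?ler0n// -sumrB; apply: ler_sum => j _.
  by have [_ ->] := left_deriv_hinge_subgradient (f n (xs j)) (ysP j).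
have e2 : 0 <= 2 * eta n.+1 by rewrite mulr_ge0// ltW// eta_gt0.
by have := ler_wpM2l e2 le_S; lra.
Qed.

(** Telescoping of [gd_hinge_step]. The predecessor in [f t.-1] is the index shift of [gd_iter]: it
    denotes the iterate f_t, paired with the step size eta t. *)
Lemma gd_hinge_sum s T (h : V) : H h -> (0 < s <= T)%N ->
  N ((f T : V) - h) ^+ 2 + 2 * \sum_(s <= t < T.+1) eta t * (Ez (f t.-1) - Ez h)
    <= N ((f s.-1 : V) - h) ^+ 2 + kap ^+ 2 * \sum_(s <= t < T.+1) eta t ^+ 2.
Proof.
move=> Hh /andP[s0]; elim: T => [|T IH]; first by rewrite leqn0 => /eqP sE; rewrite sE in s0.
rewrite leq_eqVlt => /predU1P[->|].
  rewrite !big_nat1 /=; have := gd_hinge_step T Hh; rewrite exprMn; lra.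
rewrite ltnS => sT; rewrite !(big_nat_recr T.+1)//=; try exact: leqW.
have := gd_hinge_step T Hh; have := IH sT; rewrite exprMn.
set S1 := \sum_(_ <= _ < _) _; set S2 := \sum_(_ <= _ < _) _; lra.
Qed.

End sample.

Let Cp := 1 + (2 * theta - 1)^-1.

Let th1 : 2^-1 < theta. Proof. by case/andP: theta_range. Qed.
Let th2 : theta < 1. Proof. by case/andP: theta_range. Qed.

Let Cp_gt0 : 0 < Cp.
Proof. by rewrite /Cp addr_gt0// invr_gt0; have := th1; lra. Qed.

Let kc_ge0 : 0 <= kap ^+ 2 * (eta1 ^+ 2 * Cp).
Proof. by apply: mulr_ge0 (sqr_ge0 _) (mulr_ge0 (sqr_ge0 _) (ltW Cp_gt0)). Qed.

Lemma sum_stepsize_le T :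
  \sum_(1 <= t < T.+1) eta t <= eta1 * (2 / (1 - theta)) * T%:R `^ (1 - theta).
Proof.
rewrite /stepsize -mulr_sumr -mulrA ler_pM2l//.
have := @sum_powR_le R (1 - theta) T; rewrite (_ : 1 - theta - 1 = - theta); last by ring.
by apply; have := th1; have := th2; lra.
Qed.

Lemma sum_stepsize_sqr_le T : \sum_(1 <= t < T.+1) eta t ^+ 2 <= eta1 ^+ 2 * Cp.
Proof.
have -> : \sum_(1 <= t < T.+1) eta t ^+ 2 =
    eta1 ^+ 2 * \sum_(1 <= t < T.+1) t%:R `^ (- (2 * theta)).
  rewrite mulr_sumr; apply: eq_bigr => t _; rewrite /stepsize exprMn; congr (_ * _).
  by rewrite -powR_mulrn ?powR_ge0// -powRrM; congr (_ `^ _); ring.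
by rewrite ler_wpM2l ?sqr_ge0// sum_powRN_le//; have := th1; lra.
Qed.

(** Comparison with h = 0: as E_z >= 0 and E_z(0) <= 1, one step raises the squared norm by at most
    2 eta t + (kap eta t)^2. The step sizes sum to O(T^(1-theta)) and their squares to O(1). *)
Lemma gd_norm : exists2 C : R, 0 < C & forall (m : nat) (xs : 'I_m -> X) (ys : 'I_m -> R) T t,
  (0 < m)%N -> (forall j, ys j = 1 \/ ys j = -1) -> (0 < t <= T)%N ->
  N (gd_iter K (left_deriv (@hinge R)) eta xs ys t.-1) ^+ 2 <= C * T%:R `^ (1 - theta).
Proof.
have u0 : 0 < 1 - theta by have := th2; lra.
exists (2 * (eta1 * (2 / (1 - theta))) + kap ^+ 2 * (eta1 ^+ 2 * Cp)).
  apply: ltr_wpDr; last by rewrite !mulr_gt0 ?invr_gt0.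
  exact: kc_ge0.
move=> m xs ys T [//|t] m0 ysP /= tT.
set f := gd_iter _ _ _ _ _.
have T1 : 1 <= T%:R `^ (1 - theta) :> R.
  apply: (@le_trans _ _ (1 `^ (1 - theta))); first by rewrite powR1.
  apply: ge0_ler_powR; rewrite ?nnegrE ?ler0n ?ler1n ?(ltW u0)//.
  exact: leq_ltn_trans tT.
set L := T%:R `^ (1 - theta) in T1 *.
have c1 : 0 <= eta1 * (2 / (1 - theta)) by rewrite mulr_ge0 ?divr_ge0 ?(ltW eta1_gt0) ?(ltW u0).
have c2 := kc_ge0.
case: t => [|t] in tT *.
  rewrite (rknorm0 HK) expr0n/=; apply: mulr_ge0; last by apply: le_trans T1.
  by rewrite addr_ge0// mulr_ge0.
have := @gd_hinge_sum m xs ys m0 ysP 1 t.+1 0 (rkhs0 HK) isT.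
rewrite -/f /= !subr0 (rknorm0 HK) expr0n/= add0r => sumle.
have E0 : emp_risk xs ys 0 <= 1.
  rewrite /emp_risk ler_pdivrMl ?ltr0n// mulr1 -[m in leRHS]card_ord -sumr_const.
  by apply: ler_sum => j _; rewrite /hinge mulr0 subr0 ge_max lexx ler01.
have lower : - (\sum_(1 <= i < t.+2) eta i) <=
    \sum_(1 <= i < t.+2) eta i * (emp_risk xs ys (f i.-1) - emp_risk xs ys 0).
  rewrite -sumrN; apply: ler_sum_nat => i /andP[i1 _].
  have := emp_risk_ge0 xs ys (f i.-1); have := eta_gt0 i1; nra.
have h1 := sum_stepsize_le t.+1; have h2 := sum_stepsize_sqr_le t.+1.
have h3 : t.+1%:R `^ (1 - theta) <= L.
  by apply: ge0_ler_powR; rewrite ?nnegrE ?ler0n ?ler_nat ?(ltW u0)//; exact: ltnW.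
have h4 : \sum_(1 <= i < t.+2) eta i <= eta1 * (2 / (1 - theta)) * L.
  by apply: le_trans h1 _; rewrite ler_wpM2l.
have h5 := ler_wpM2l (sqr_ge0 kap) h2.
have h6 : kap ^+ 2 * (eta1 ^+ 2 * Cp) <= kap ^+ 2 * (eta1 ^+ 2 * Cp) * L.
  by rewrite ler_peMr.
move: sumle lower h4 h5 h6.
set S1 := \sum_(_ <= _ < _) _; set S2 := \sum_(_ <= _ < _) _; set S3 := \sum_(_ <= _ < _) _.
set c := eta1 * (2 / (1 - theta)); set c' := eta1 ^+ 2 * Cp.
lra.
Qed.

(** The last-iterate bound is applied to the empirical excess shifted by D, which is nonnegative by
    assumption. *)
Lemma gd_risk : exists2 C : R, 0 < C & forall (m : nat) (xs : 'I_m -> X) (ys : 'I_m -> R) T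
    (h : V) (D : R),
  (0 < m)%N -> (forall j, ys j = 1 \/ ys j = -1) -> (0 < T)%N -> H h -> 0 <= D ->
  let f := gd_iter K (left_deriv (@hinge R)) eta xs ys in
  (forall t, (0 < t <= T)%N -> - D <= emp_risk xs ys (f t.-1) - emp_risk xs ys h) ->
  emp_risk xs ys (f T.-1) - emp_risk xs ys h
    <= C * ((N h ^+ 2 + 1) / T%:R `^ (1 - theta) + D).
Proof.
have u0 : 0 < 1 - theta by have := th2; lra.
have G0 : 0 <= 2^-1 * kap ^+ 2 by rewrite mulr_ge0// sqr_ge0.
have [C C0 CP] := last_iterate_rate theta_range eta1_gt0 G0.
pose W0 := 2^-1 * (kap ^+ 2 * (eta1 ^+ 2 * Cp)).
have W00 : 0 <= W0 by rewrite mulr_ge0//; exact: kc_ge0.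
exists (C * (1 + W0)); first by rewrite mulr_gt0// ltr_wpDr.
move=> m xs ys T h D m0 ysP T0 Hh D0 f lower.
pose a t := emp_risk xs ys (f t.-1) - emp_risk xs ys h.
have Hf t : H (f t) := kspan_rkhs HK (gd_iter_rkhs _ _ _ _ _).
have aD : a T <= a T + D by rewrite lerDl.
apply: (le_trans aD).
have Nh := sqr_ge0 (N h).
have := CP T (fun t => a t + D) (2^-1 * N h ^+ 2 + W0) D T0 _ D0.
rewrite /= => /(_ _ _ _ _)/le_trans; apply.
- by rewrite addr_ge0// mulr_ge0.
- by move=> t /lower; rewrite /a; lra.
(* Here the comparison function is the iterate f_s itself, so the initial distance vanishes. *)
- move=> s /andP[s1 sT].
  have := @gd_hinge_sum m xs ys m0 ysP s T (f s.-1) (Hf _); rewrite s1 sT => /(_ isT).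
  rewrite subrr (rknorm0 HK) expr0n/= add0r -/f => sumle.
  rewrite -mulrA ler_pdivlMl//; apply: le_trans sumle.
  rewrite -[leLHS]add0r lerD ?sqr_ge0// ler_pM2l//.
  by rewrite le_eqVlt; apply/orP; left; apply/eqP; apply: eq_bigr => t _; rewrite /a; ring.
(* The full sum is compared with h, at initial distance ||h|| because f_1 = 0. *)
- have := @gd_hinge_sum m xs ys m0 ysP 1 T h Hh T0.
  rewrite -/f /= => sumle.
  under eq_bigr do rewrite mulrDr.
  rewrite big_split/= -mulr_suml [D * _]mulrC lerD2r.
  have : N ((f 0 : V) - h) ^+ 2 = N h ^+ 2.
    by rewrite -(rknormN HK Hh) /f /=; congr (N _ ^+ 2); exact: sub0r.
  have := ler_wpM2l (sqr_ge0 kap) (sum_stepsize_sqr_le T).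
  have := sqr_ge0 (N ((f T : V) - h)).
  rewrite /W0; move: sumle; rewrite /a.
  set S1 := \sum_(_ <= _ < _) _; set S2 := \sum_(_ <= _ < _) _; set c' := eta1 ^+ 2 * Cp; lra.
- rewrite -mulrA ler_pM2l// mulrDr lerD//; last by rewrite mulrDl mul1r lerDl mulr_ge0.
  rewrite mulrA ler_wpM2r ?invr_ge0 ?powR_ge0//.
  have := mulr_ge0 W00 Nh; lra.
Qed.

End gradient_descent.

(** * Deviation of the hinge risk *)

Section learning.
Context {R : realType} {d : measure_display} {X : measurableType d}.
Variable rho : probability (X * R)%type R.
Hypothesis rho_Y : rho [set z | z.2 = 1 \/ z.2 = -1] = 1%E.
Context {K : X -> X -> R} {H : set (X -> R)} {ip : (X -> R) -> (X -> R) -> R}.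
Hypothesis HK : is_RKHS K H ip.
Hypothesis K_meas : forall x, measurable_fun setT (K x).
Variable kap : R.
Hypothesis kap0 : 0 < kap.
Hypothesis Kkap : forall x, K x x <= kap ^+ 2.
Local Notation V := (fct_lmod R X).
Local Notation N := (rknorm ip).
Local Notation risk f := (fine (exp_risk rho (@hinge R) f)).

Let mH f : H f -> measurable_fun setT f.
Proof. exact: rkhs_measurable HK _ K_meas. Qed.

Lemma hinge_label_le f x y : H f -> `|hinge (label y) (f x) - 1| <= kap * N f.
Proof.
move=> Hf; apply: le_trans (normr_eval_le HK x (ltW kap0) Kkap Hf).
have ly : label y = 1 \/ label y = -1 by rewrite /label; case: ifP; [left|right].
have := hinge_lip (f x) 0 ly; rewrite subr0.
by rewrite {2}/hinge mulr0 subr0 (max_idPl ler01).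
Qed.

Lemma measurable_hinge_label f : H f ->
  measurable_fun setT (fun z : X * R => hinge (label z.2) (f z.1)).
Proof.
move=> Hf; apply: measurable_fun_hinge.
- exact: (measurableT_comp (measurable_label (R:=R)) measurable_snd).
- exact: (measurableT_comp (mH Hf) measurable_fst).
Qed.

Lemma integrable_hinge_label f : H f ->
  rho.-integrable setT (fun z : X * R => (hinge (label z.2) (f z.1))%:E).
Proof.
move=> Hf; apply: (@bounded_measurable_integrable _ _ _ rho _ (1 + kap * N f)).
- exact: measurable_hinge_label.
- move=> z; rewrite ger0_norm ?hinge_ge0//.
  by have := hinge_label_le z.1 z.2 Hf; rewrite ler_norml => /andP[_]; lra.
Qed.

Lemma riskE f : H f -> exp_risk rho (@hinge R) f = (risk f)%:E.
Proof.
move=> Hf; rewrite fineK// exp_risk_label//; last exact: mH.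
by apply: integrable_fin_num => //; exact: integrable_hinge_label.
Qed.

Lemma hinge_integralE f : H f -> (\int[rho]_z (hinge (label z.2) (f z.1))%:E)%E = (risk f)%:E.
Proof. by move=> Hf; rewrite -riskE// exp_risk_label//; exact: mH. Qed.

Lemma risk_lip (f g : V) : H f -> H g -> risk f - risk g <= kap * N (f - g).
Proof.
move=> Hf Hg; have Hfg := rkhsB HK Hf Hg.
rewrite -lee_fin EFinB -!hinge_integralE// -integralB//; [|exact: integrable_hinge_label..].
apply: (@le_trans _ _ (\int[rho]_z (kap * N (f - g))%:E)%E); last first.
  by rewrite integral_cst//= (probability_setT rho : (rho : measure _ R) setT = 1%E) mule1.
apply: le_integral => //.
- by apply: integrableB => //; exact: integrable_hinge_label.
- apply: (@bounded_measurable_integrable _ _ _ rho _ (kap * N (f - g))) => // _.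
  by rewrite ger0_norm// mulr_ge0 ?(ltW kap0) ?rknorm_ge0.
- move=> z _; rewrite -EFinB lee_fin.
  apply: le_trans (normr_eval_le HK z.1 (ltW kap0) Kkap Hfg).
  apply: le_trans (ler_norm _) _; rewrite fct_lmodE fct_lmodE.
  by apply: hinge_lip; rewrite /label; case: ifP; [left|right].
Qed.

Lemma emp_risk_lip m (xs : 'I_m -> X) (ys : 'I_m -> R) (f g : V) :
  (0 < m)%N -> (forall j, ys j = 1 \/ ys j = -1) -> H f -> H g ->
  emp_risk xs ys f - emp_risk xs ys g <= kap * N (f - g).
Proof.
move=> m0 ysP Hf Hg; have Hfg := rkhsB HK Hf Hg.
rewrite /emp_risk -mulrBr ler_pdivrMl ?ltr0n// -sumrB.
rewrite mulr_natl -[m in leRHS]card_ord -sumr_const; apply: ler_sum => j _.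
apply: le_trans (normr_eval_le HK (xs j) (ltW kap0) Kkap Hfg).
apply: le_trans (ler_norm _) _; rewrite fct_lmodE fct_lmodE.
exact: hinge_lip.
Qed.

(** The sign s serves both directions. Scaling by lam = 1/(r kap sqrt m) makes the growth term m 12
    (lam r kap)^2 equal to 12; with the initial 1 this gives the threshold 13 - ln delta. *)
Lemma hinge_deviation (s : R) (g : nat -> V) (r : R) dO (Omega : measurableType dO)
    (Q : probability Omega R) m (Zs : 'I_m -> Omega -> X * R) (delta : R) :
  s = 1 \/ s = -1 -> 0 < r -> (forall j, H (g j)) -> (forall j, N (g j) <= r) ->
  iid_sample Q rho Zs -> (0 < m)%N -> 0 < delta ->
  exists A, [/\ measurable A, ((1 - delta)%:E <= Q A)%E & forall w, A w -> forall j,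
    s * (risk (g j) - emp_risk (fun i => (Zs i w).1) (fun i => label (Zs i w).2) (g j))
    <= (13 - ln delta) * (r * kap) / Num.sqrt m%:R].
Proof.
move=> s1 r0 Hg gr iid m0 delta0.
have sm : 0 < Num.sqrt (m%:R : R) by rewrite sqrtr_gt0 ltr0n.
have sE : `|s| = 1 by case: s1 => ->; rewrite ?normrN normr1.
pose lam := (r * kap * Num.sqrt m%:R)^-1.
have lam0 : 0 < lam by rewrite invr_gt0 !mulr_gt0.
have rk : lam * r * kap = (Num.sqrt m%:R)^-1.
  by rewrite /lam; field; rewrite !gt_eqF.
pose f j : V := lam *: g j.
(* Subtracting 1, the loss of the zero function, gives |phi j| <= |f j| as contraction requires; the
   constant cancels in the deviation. *)
pose phi j (z : X * R) := s * lam * (hinge (label z.2) (g j z.1) - 1).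
have rl0 : 0 <= lam * r by rewrite mulr_ge0// ltW.
have Hf j : H (f j) := rkhsZ HK lam (Hg j).
have fr j : N (f j) <= lam * r.
  by rewrite /f (rknormZ HK)// (gtr0_norm lam0) ler_pM2l.
have mf j : measurable_fun setT (fun z : X * R => f j z.1).
  exact: (measurableT_comp (mH (Hf j)) measurable_fst).
have mphi j : measurable_fun setT (phi j).
  apply: measurable_funM => //; apply: measurable_funB => //; exact: measurable_hinge_label.
have labelP z : label z = 1 \/ label z = -1 :> R by rewrite /label; case: ifP; [left|right].
have phi_lip j k z : `|phi j z - phi k z| <= `|f j z.1 - f k z.1|.
  rewrite /phi -mulrBr /f !fct_lmodE -mulrBr !normrM sE mul1r (gtr0_norm lam0) ler_pM2l//.
  by rewrite opprB addrA subrK; exact: hinge_lip.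
have phi_le j z : `|phi j z| <= `|f j z.1|.
  rewrite /phi /f !fct_lmodE !normrM sE mul1r (gtr0_norm lam0) ler_pM2l//.
  have := hinge_lip (g j z.1) 0 (labelP z.2); rewrite subr0.
  by rewrite {2}/hinge mulr0 subr0 (max_idPl ler01).
have muE j : (\int[rho]_z (phi j z)%:E = (s * lam * (risk (g j) - 1))%:E)%E.
  transitivity (\int[rho]_z ((s * lam)%:E * ((hinge (label z.2) (g j z.1))%:E - 1%:E)))%E.
    by apply: eq_integral => z _; rewrite /phi EFinM EFinB.
  have i1 : rho.-integrable setT (cst 1%:E : X * R -> _).
    exact: finite_measure_integrable_cst.
  have i2 := integrable_hinge_label (Hg j).
  rewrite integralZl//; last exact: integrableB.
  rewrite integralB// hinge_integralE// integral_cst//.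
  by rewrite (probability_setT rho : (rho : measure _ R) setT = 1%E) mule1.
have expb : expR (1 + m%:R * (12 * (lam * r * kap) ^+ 2)) <= delta * expR (13 - ln delta).
  rewrite rk exprVn sqr_sqrtr ?ler0n// [expR (13 - _)]expRD expRN lnK ?posrE//.
  rewrite [leRHS]mulrC -mulrA mulVf ?gt_eqF// mulr1 ler_expR.
  by rewrite [12 * _]mulrC mulrA mulfV ?pnatr_eq0 -?lt0n// mul1r; lra.
have [A [mA QA AP]] := @uniform_deviation R _ _ rho X K H ip HK fst f (lam * r) kap rl0 Hf fr
  (ltW kap0) Kkap mf phi (fun j => s * lam * (risk (g j) - 1)) mphi phi_le phi_lip muE _ _ Q
  m Zs (13 - ln delta) delta iid expb.
exists A; split=> // w Aw j; have := AP w Aw j.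
rewrite /phi; under eq_bigr do rewrite -mulrBr opprB addrA subrK.
rewrite -mulr_sumr sumrB sumr_const card_ord -[_ *+ m]mulr_natl => le1.
rewrite /emp_risk ler_pdivlMr//.
have m0' : 0 < m%:R :> R by rewrite ltr0n.
set S := \sum_(i < m) hinge _ _ in le1 *.
have -> : s * (risk (g j) - m%:R^-1 * S) * Num.sqrt m%:R =
    s * lam * (m%:R * risk (g j) - S) * (r * kap).
  rewrite /lam; set q := Num.sqrt _; have -> : m%:R = q * q :> R by rewrite -expr2 sqr_sqrtr ?ler0n.
  by field; rewrite !gt_eqF.
by rewrite ler_pM2r ?mulr_gt0.
Qed.

(** A countable dense family suffices because both risks are Lipschitz in the norm. The slack of 1
    in the norm keeps approximants of f inside the ball of radius r. *)
Lemma kclosure_deviation (D : set X) (r : R) dO (Omega : measurableType dO)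
    (Q : probability Omega R) m (Zs : 'I_m -> Omega -> X * R) (delta : R) :
  countable D -> 0 < r -> iid_sample Q rho Zs -> (0 < m)%N -> 0 < delta ->
  exists A, [/\ measurable A, ((1 - delta)%:E <= Q A)%E & forall w, A w ->
    forall f, @kclosure R X K H ip D f -> N f + 1 <= r ->
    risk f - emp_risk (fun i => (Zs i w).1) (fun i => label (Zs i w).2) f
    <= (13 - ln delta) * (r * kap) / Num.sqrt m%:R].
Proof.
move=> cD r0 iid m0 delta0.
have [G [HG Gdense]] := countable_kspan HK cD.
pose g n : V := if N (G n) <= r then G n else 0.
have Hg n : H (g n) by rewrite /g; case: ifP => // _; exact: rkhs0 HK.
have gr n : N (g n) <= r by rewrite /g; case: ifP => // _; rewrite (rknorm0 HK) ltW.
have [A [mA QA AP]] := hinge_deviation (or_introl erefl) r0 Hg gr iid m0 delta0.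
exists A; split=> // w Aw f [Hf fD] fr.
apply/ler_addgt0Pr => e e0.
(* Bounded by 1 to stay in the ball, and small enough for the two Lipschitz errors kap e' to sum to
   at most e. *)
pose e' := Num.min 1 (e / (2 * kap)).
have e'0 : 0 < e' by rewrite lt_min ltr01 divr_gt0// mulr_gt0.
have e'1 : e' <= 1 by rewrite ge_min lexx.
have e'e : 2 * (kap * e') <= e.
  by rewrite mulrA -ler_pdivlMl ?mulr_gt0// mulrC ge_min lexx orbT.
have e'2 : 0 < e' / 2 by rewrite divr_gt0.
have [d' Dd fd] := fD _ e'2.
have Hd := kspan_rkhs HK Dd.
have [n dn] := Gdense d' Dd _ e'2.
have fG : N ((f : V) - G n) <= e'.
  rewrite -(subrKA (d' : V)); apply: le_trans (rknormD HK (rkhsB HK Hf Hd) (rkhsB HK Hd (HG n))) _.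
  by lra.
have Gf : N (G n - (f : V)) = N ((f : V) - G n) by rewrite -(rknormN HK (rkhsB HK Hf (HG n))) opprB.
have gE : g n = G n.
  rewrite /g ifT// -(subrK (f : V) (G n)).
  by apply: le_trans (rknormD HK (rkhsB HK (HG n) Hf) Hf) _; rewrite Gf; lra.
have labelP z : label z = 1 \/ label z = -1 :> R by rewrite /label; case: ifP; [left|right].
have := AP w Aw n; rewrite gE mul1r.
have := risk_lip Hf (HG n).
have := emp_risk_lip (fun i => (Zs i w).1) m0 (fun i => labelP (Zs i w).2) (HG n) Hf.
rewrite Gf; have := ler_wpM2l (ltW kap0) fG.
lra.
Qed.

End learning.

Lemma le_probability_setI {R : realType} d (T : measurableType d) (P : probability T R)
    (A B : set T) (a b : R) : measurable A -> measurable B ->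
  ((1 - a)%:E <= P A)%E -> ((1 - b)%:E <= P B)%E -> ((1 - (a + b))%:E <= P (A `&` B))%E.
Proof.
move=> mA mB PA PB.
have mAB : measurable (A `&` B) by exact: measurableI.
have fin C : measurable C -> P C \is a fin_num.
  by move=> mC; exact: fin_num_measure.
have : (P (~` (A `&` B)) <= P (~` A) + P (~` B))%E.
  by rewrite setCI; apply: measureU2; exact: measurableC.
rewrite !probability_setC//.
move: PA PB; rewrite -(fineK (fin _ mA)) -(fineK (fin _ mB)) -(fineK (fin _ mAB)).
rewrite -!EFinB -EFinD !lee_fin; lra.
Qed.

(** * Misclassification rate *)

(** Put M = m^(1/(2 beta + 1)). The ceiling at most doubles a number that is at least 1, so L =
    T^(1-theta) lies between M and 2 M. As sqrt m = M^beta sqrt M, both error scales reduce to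
    M^(-beta). *)
Lemma early_stopping_time {R : realType} (theta beta : R) m T :
  2^-1 < theta < 1 -> 0 < beta <= 1 -> (3 <= T)%N ->
  (T%:R : R) = (Num.ceil (m%:R `^ (1 / ((1 - theta) * (2 * beta + 1)))))%:~R ->
  [/\ (0 < m)%N, 1 <= T%:R `^ (1 - theta) :> R,
    (T%:R `^ (1 - theta))^-1 `^ beta <= m%:R `^ (- (beta / (2 * beta + 1))) &
    (Num.sqrt (T%:R `^ (1 - theta)) + 1) / Num.sqrt m%:R <= 4 * m%:R `^ (- (beta / (2 * beta + 1)))].
Proof.
move=> /andP[th1 th2] /andP[b0 b1] T3 TE.
have u0 : 0 < 1 - theta by lra.
have b2 : 0 < 2 * beta + 1 by lra.
set p := 1 / _ in TE.
have p0 : p != 0 by rewrite /p mul1r invr_eq0 mulf_neq0// gt_eqF.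
have p1 : 0 <= p by rewrite /p mul1r invr_ge0 mulr_ge0// ltW.
(* For m = 0 the power and its ceiling are 0, against T >= 3. *)
have m0 : (0 < m)%N.
  case: m TE => // TE; move: TE T3; rewrite powR0// ceil0 => /eqP.
  by rewrite pnatr_eq0 => /eqP ->.
have m1 : 1 <= m%:R :> R by rewrite ler1n.
have one_powR (x : R) : 1 `^ x = 1 by rewrite powR1.
have m0' : 0 <= m%:R :> R by rewrite ler0n.
have a1 : 1 <= m%:R `^ p :> R by rewrite -[leLHS](one_powR p) ge0_ler_powR// ?nnegrE//.
have aT : m%:R `^ p <= T%:R :> R by rewrite TE ceil_ge.
have T2 : T%:R <= 2 * m%:R `^ p :> R.
  rewrite TE; have := ceilB1_lt (m%:R `^ p : R); rewrite intrD/=; lra.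
set M := m%:R `^ (1 / (2 * beta + 1)) : R.
have M1 : 1 <= M.
  by rewrite /M -[leLHS](one_powR (1 / (2 * beta + 1))) ge0_ler_powR ?nnegrE// mul1r invr_ge0 ltW.
have ME : (m%:R `^ p) `^ (1 - theta) = M.
  by rewrite -powRrM /M /p; congr (_ `^ _); field; rewrite !gt_eqF.
set L := T%:R `^ (1 - theta) : R.
have ML : M <= L by rewrite -ME /L ge0_ler_powR ?nnegrE ?powR_ge0 ?(ltW u0).
have L2 : L <= 2 * M.
  rewrite /L; apply: (@le_trans _ _ ((2 * m%:R `^ p) `^ (1 - theta))).
    by rewrite ge0_ler_powR ?nnegrE ?(ltW u0)// mulr_ge0// powR_ge0.
  rewrite powRM ?powR_ge0// ME ler_wpM2r ?powR_ge0//.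
  rewrite -[leRHS]powRr1//; apply: ler_powR; lra.
have M0 : 0 < M by lra.
have rE : m%:R `^ (- (beta / (2 * beta + 1))) = M `^ (- beta).
  by rewrite /M -powRrM; congr (_ `^ _); field; rewrite gt_eqF.
have mE : m%:R = M `^ (2 * beta + 1).
  by rewrite /M -powRrM mul1r mulVf ?gt_eqF// powRr1.
have L0 := lt_le_trans M0 ML.
clearbody L M; rewrite rE.
split; [exact: m0|exact: le_trans ML| |].
- rewrite -(@powR_inv1 _ L) -?(powRrM L) ?(ltW L0)//.
  rewrite mulN1r !powRN lef_pV2 ?posrE ?powR_gt0//.
  by apply: ge0_ler_powR; rewrite ?nnegrE ?(ltW b0) ?(ltW L0) ?(ltW M0).
- have sM : Num.sqrt M = M `^ 2^-1 by rewrite powR12_sqrt// ltW.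
  have sm : Num.sqrt m%:R = M `^ beta * Num.sqrt M.
    rewrite mE sM -powRD; last by rewrite (gt_eqF M0) implybT.
    rewrite -powR12_sqrt ?powR_ge0// -powRrM; congr (_ `^ _); by field.
  rewrite sm invfM mulrCA powRN [4 * _]mulrC ler_pM2l ?invr_gt0 ?powR_gt0//.
  rewrite ler_pdivrMr ?sqrtr_gt0//.
  have : Num.sqrt L <= Num.sqrt (2 ^+ 2 * M) by apply: ler_wsqrtr; lra.
  rewrite sqrtrM ?sqrtr_sqr ?ger0_norm//.
  have : Num.sqrt 1 <= Num.sqrt M by apply: ler_wsqrtr.
  rewrite sqrtr1; lra.
Qed.

Lemma iid_sample_ae {R : realType} {dO d} {Omega : measurableType dO} {Z : measurableType d}
    (Q : probability Omega R) (P : probability Z R) m (Zs : 'I_m -> Omega -> Z) (B : set Z) :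
  iid_sample Q P Zs -> measurable B -> P B = 1%E ->
  exists A, [/\ measurable A, Q A = 1%E & forall w, A w -> forall i, B (Zs i w)].
Proof.
move=> [mZ [PZ indep]] mB PB.
exists (\bigcap_(i in [set: 'I_m]) (Zs i @^-1` B)); split.
- apply: fin_bigcap_measurable; first exact: finite_finset.
  by move=> i _; rewrite -[_ @^-1` _]setTI; exact: mZ.
- by rewrite (indep (fun=> B))// big1// => i _; rewrite PZ.
- by move=> w Aw i; exact: Aw.
Qed.

Lemma kspan_kclosure {R : realType} {X : Type} {K : X -> X -> R} {H : set (X -> R)}
    {ip : (X -> R) -> (X -> R) -> R} (HK : is_RKHS K H ip) (D D' : set X) (f : fct_lmod R X) :
  (forall x, D' x -> @kclosure R X K H ip D (K x)) -> @kspan R X K D' f ->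
  @kclosure R X K H ip D f.
Proof.
move=> D'D; elim=> [|x /D'D//|g h _ IHg _ IHh|a g _ IHg].
- by apply: (kspan_closure HK); exact: kspan0.
- exact: (kclosureD HK).
- exact: (kclosureZ HK).
Qed.

Lemma half_le_ln {R : realType} (x : R) : 2 <= x -> 2^-1 <= ln x.
Proof.
move=> x2; apply: (@le_trans _ _ (ln 2)); last by rewrite ler_ln ?posrE//; lra.
have := @le_ln1Dx R (- 2^-1); rewrite (_ : 1 + - 2^-1 = 2^-1); last by lra.
by rewrite lnV ?posrE// lerN2; apply; lra.
Qed.

(** The constant 27 absorbs 13 into the logarithm: l = ln (2 / delta) >= 1/2 gives 13 + l <= 27
    l. *)
Lemma deviation_rate {R : realType} (delta kap c s q r : R) :
  0 < delta -> delta < 1 -> 0 < kap -> 0 < c -> 0 <= s -> 0 <= q -> s / q <= 4 * r ->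
  0 <= (13 - ln (delta / 2)) * (c * s * kap) / q <= 27 * ln (2 / delta) * kap * c * (4 * r).
Proof.
move=> delta0 delta1 kap0 c0 s0 q0 sq.
have -> : ln (delta / 2) = - ln (2 / delta) by rewrite -lnV ?posrE ?divr_gt0// invf_div.
have : 2^-1 <= ln (2 / delta) by apply: half_le_ln; rewrite ler_pdivlMr//; lra.
set l := ln _; rewrite opprK => l2.
have -> : (13 + l) * (c * s * kap) / q = (13 + l) * (kap * c) * (s / q) by ring.
have ck : 0 < kap * c by rewrite mulr_gt0.
have sq0 : 0 <= s / q by rewrite divr_ge0.
have l0 : 0 <= (13 + l) * (kap * c) by rewrite mulr_ge0 ?(ltW ck)//; lra.
rewrite mulr_ge0//=; apply: ler_pM => //.
by rewrite -mulrA ler_pM2r//; lra.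
Qed.

Section misclassification.
Context {R : realType} {d : measure_display} {X : measurableType d}.
Variables (rho : probability (X * R)%type R) (etac : X -> R).
Hypothesis rho_Y : rho [set z | z.2 = 1 \/ z.2 = -1] = 1%E.
Hypothesis etac_cond : cond_prob_one rho etac.
Context {K : X -> X -> R} {H : set (X -> R)} {ip : (X -> R) -> (X -> R) -> R}.
Hypothesis HK : is_RKHS K H ip.
Hypothesis K_meas : forall x, measurable_fun setT (K x).
Variable kap : R.
Hypothesis kap0 : 0 < kap.
Hypothesis Kkap : forall x, K x x <= kap ^+ 2.
Local Notation V := (fct_lmod R X).
Local Notation N := (rknorm ip).
Local Notation risk f := (fine (exp_risk rho (@hinge R) f)).
Local Notation fc := (bayes_rule etac).

(** Finiteness of the Bayes risk is read off from the comparison inequality, whose right-hand side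
    is finite. *)
Lemma excess_risk f : H f -> [/\ exp_risk rho (@hinge R) fc = (risk fc)%:E, risk fc <= risk f &
  mis_risk rho (sign f) - mis_risk rho fc <= risk f - risk fc].
Proof.
move=> Hf.
have [] := hinge_comparison rho_Y etac_cond (rkhs_measurable HK K_meas Hf)
  (fun x => normr_eval_le HK x (ltW kap0) Kkap Hf).
rewrite (riskE rho_Y HK K_meas kap0 Kkap Hf) /mis_risk.
have fin (b : X -> R) : measurable_fun setT b ->
    exists2 x : R, 0 <= x & rho [set z | z.2 <> b z.1] = x%:E.
  move=> mb; exists (fine (rho [set z | z.2 <> b z.1])); first exact: fine_ge0.
  by rewrite fineK// fin_num_measure//; exact: measurable_misclassified.
have mf := rkhs_measurable HK K_meas Hf.
have [a a0 ->] : exists2 x : R, 0 <= x & rho [set z | z.2 <> sign f z.1] = x%:E.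
  by apply: fin; apply: measurable_fun_ifT => //; exact: measurable_fun_ler.
have [b b0 ->] : exists2 x : R, 0 <= x & rho [set z | z.2 <> fc z.1] = x%:E.
  apply: fin; apply: measurable_fun_ifT => //; apply: measurable_fun_ler => //.
  exact: eta_measurable etac_cond.
rewrite lee_fin => ab.
have : (0 <= exp_risk rho (@hinge R) fc)%E.
  by apply: integral_ge0 => z _; rewrite lee_fin hinge_ge0.
case: (exp_risk rho _ fc) => [c| |]//=; rewrite -!EFinD !lee_fin => c0 cab.
by split=> //; lra.
Qed.

Variables (beta c_beta : R).
Hypotheses (beta_range : 0 < beta <= 1) (c_beta0 : 0 < c_beta).
Hypothesis A3 : forall lam : R, 0 < lam -> exists flam : X -> R, H flam /\
  (exp_risk rho (@hinge R) flam - exp_risk rho (@hinge R) fc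
     + (lam * N flam ^+ 2)%:E <= (c_beta * lam `^ beta)%:E)%E.

Lemma approximation lam : 0 < lam -> exists h, [/\ H h,
  risk h - risk fc <= c_beta * lam `^ beta & lam * N h ^+ 2 <= c_beta * lam `^ beta].
Proof.
move=> lam0; have [h [Hh]] := A3 lam0; have [fcE fch _] := excess_risk Hh.
rewrite fcE (riskE rho_Y HK K_meas kap0 Kkap Hh) -EFinB -EFinD lee_fin => hle.
by exists h; split=> //; have := mulr_ge0 (ltW lam0) (sqr_ge0 (N h)); lra.
Qed.

Hypothesis entropy : exists C zeta : R, 0 < zeta < 2 /\
  forall dO (Omega : measurableType dO) (Q : probability Omega R) m (Zs : 'I_m -> Omega -> X * R),
  iid_sample Q rho Zs -> forall eps : R, 0 < eps ->
  (\int[Q]_w log_covering_number (unit_ball H ip) eps (d2 (fun j => (Zs j w).1))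
     <= (C * eps `^ (- zeta))%:E)%E.
Variables (theta eta1 : R).
Hypotheses (theta_range : 2^-1 < theta < 1) (eta1_gt0 : 0 < eta1).

Lemma misclassification_rate : exists2 Ct : R, 0 < Ct &
  forall m T (delta : R) dO (Omega : measurableType dO)
    (Q : probability Omega R) (Zs : 'I_m -> Omega -> X * R),
  iid_sample Q rho Zs ->
  (T%:R : R) = (Num.ceil (m%:R `^ (1 / ((1 - theta) * (2 * beta + 1)))))%:~R ->
  (3 <= T)%N -> 0 < delta < 1 ->
  with_confidence Q delta [set w |
    mis_risk rho (sign (gd_iter K (left_deriv (@hinge R)) (stepsize eta1 theta)
      (fun j => (Zs j w).1) (fun j => (Zs j w).2) T.-1)) - mis_risk rho fc
    <= Ct * m%:R `^ (- (beta / (2 * beta + 1))) * ln (2 / delta)].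
Proof.
have [D [B [cD mB PB sep]]] := @ae_kclosure _ _ _ rho _ _ _ _ HK fst entropy.
have [C2 C20 norm_le] := gd_norm HK (ltW kap0) Kkap theta_range eta1_gt0.
have [C C0 risk_le] := gd_risk HK (ltW kap0) Kkap theta_range eta1_gt0.
pose c2 := Num.sqrt C2 + 1; pose c3 := Num.sqrt c_beta + 1.
have c20 : 0 < c2 by rewrite ltr_wpDl ?sqrtr_ge0.
have c30 : 0 < c3 by rewrite ltr_wpDl ?sqrtr_ge0.
exists ((C + 1) * (27 * kap * 4 * (c2 + c3)) + 2 * (C * (2 * c_beta + 1) + c_beta)).
  have p1 : 0 < (C + 1) * (27 * kap * 4 * (c2 + c3)).
    by apply: mulr_gt0; [exact: addr_gt0|rewrite mulr_gt0 ?(addr_gt0 c20)// mulr_gt0// mulr_gt0].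
  have p2 : 0 < C * (2 * c_beta + 1) + c_beta by rewrite addr_gt0// mulr_gt0// addr_gt0// mulr_gt0.
  by rewrite addr_gt0// mulr_gt0.
move=> m T delta dO Omega Q Zs iid TE T3 /andP[delta0 delta1].
have [m0 L1] := early_stopping_time theta_range beta_range T3 TE.
set L := T%:R `^ (1 - theta) in L1 *.
set rm := m%:R `^ _; move=> lamb sqL.
have L0 : 0 < L by lra.
have lam1 : L^-1 <= 1 by rewrite invf_le1.
have [b0 b1] := andP beta_range.
have lamb1 : L^-1 `^ beta <= 1.
  have one_powR : 1 `^ beta = 1 :> R by rewrite powR1.
  by rewrite -[leRHS]one_powR ge0_ler_powR ?nnegrE ?(ltW b0) ?invr_ge0 ?(ltW L0).
have lamb2 : L^-1 <= L^-1 `^ beta.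
  have -> : L^-1 `^ beta = (L `^ beta)^-1.
    by rewrite -[in LHS](powR_inv1 (ltW L0)) -powRrM mulN1r powRN.
  by rewrite lef_pV2 ?posrE ?(powR_gt0 _ L0)//; exact: ler1_powR.
have Li0 : 0 < L^-1 by rewrite invr_gt0.
have [h [Hh hrisk hnorm]] := approximation Li0.
pose s := Num.sqrt L + 1.
have s0 : 0 < s by rewrite ltr_wpDl ?sqrtr_ge0.
have d20 : 0 < delta / 2 by rewrite divr_gt0.
have sqm : 0 <= Num.sqrt m%:R :> R := sqrtr_ge0 _.
(* Confidence delta / 2 for the iterates, uniformly on the closed span over D in a ball of radius
   O(sqrt L); the other delta / 2 goes to h. *)
have [A1 [mA1 QA1 AP1]] := kclosure_deviation rho_Y HK K_meas kap0 Kkap cD (mulr_gt0 c20 s0) iid m0 d20.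
have norm_bound a (f : V) : 0 < a -> N f ^+ 2 <= a * L -> N f + 1 <= (Num.sqrt a + 1) * s.
  move=> a0 /ler_wsqrtr; rewrite sqrtr_sqr ger0_norm ?rknorm_ge0// sqrtrM ?(ltW a0)//.
  by have := sqrtr_ge0 a; have := sqrtr_ge0 L; rewrite /s; nra.
have hr (j : nat) : N h <= c3 * s.
  apply: le_trans (norm_bound c_beta h c_beta0 _); first by rewrite lerDl.
  rewrite mulrC -ler_pdivrMl//; apply: le_trans hnorm _.
  by rewrite ler_piMr// ltW.
(* A constant family, since h does not depend on the sample; the sign -1 bounds the empirical risk
   from above. *)
have [A2 [mA2 QA2 AP2]] := hinge_deviation rho_Y HK K_meas kap0 Kkap (or_intror erefl)
   (mulr_gt0 c30 s0) (fun=> Hh) hr iid m0 d20.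
have [A0 [mA0 QA0 AP0]] : exists A, [/\ measurable A, Q A = 1%E & forall w, A w -> forall i,
    ~ B (Zs i w) /\ ((Zs i w).2 = 1 \/ (Zs i w).2 = -1)].
  have mlab := @measurable_label_set R _ X.
  have mB' : measurable (~` B `&` [set z | z.2 = 1 \/ z.2 = -1]).
    by apply: measurableI; [exact: measurableC|exact: mlab].
  apply: (iid_sample_ae iid mB'); apply/eqP; rewrite eq_le probability_le1//=.
  have := @le_probability_setI _ _ _ rho _ _ 0 0 (measurableC mB) mlab.
  rewrite addr0 subr0; apply; last by rewrite -[leRHS]/(rho [set z | z.2 = 1 \/ z.2 = -1]) rho_Y.
  by rewrite -[leRHS]/(rho (~` B)) probability_setC// PB sube0.
exists (A0 `&` (A1 `&` A2)); split; first exact: measurableI mA0 (measurableI _ _ mA1 mA2).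
split.
  move=> w [/AP0 w0 [/AP1 w1 /AP2 w2]] /=.
  pose xs j := (Zs j w).1; pose ys j := (Zs j w).2.
  have labE : (fun i => label (Zs i w).2) = ys.
    apply/funext => i; have [_] := w0 i; rewrite /ys /label.
    by case=> ->; rewrite ?eqxx//; case: eqP => //; lra.
  have ysP j : ys j = 1 \/ ys j = -1 by have [] := w0 j.
  rewrite labE in w1 w2.
  pose f := gd_iter K (left_deriv (@hinge R)) (stepsize eta1 theta) xs ys.
  (* Almost surely all sampled K_x lie in the closed span over the countable D, and the iterates are
     combinations of them. *)
  have fD n : @kclosure R X K H ip D (f n).
    apply: (kspan_kclosure HK) (gd_iter_rkhs _ _ _ _ _) => _ [j _ <-].
    by apply: sep; have [] := w0 j.
  have Hf n : H (f n) by have [] := fD n.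
  set E1 := (13 - _) * (c2 * s * kap) / _ in w1; set E2 := (13 - _) * _ / _ in w2.
  have dev1 t : (0 < t <= T)%N -> risk (f t.-1) - emp_risk xs ys (f t.-1) <= E1.
    by move=> tT; apply: w1 (fD _) _; apply: norm_bound => //; exact: norm_le.
  have dev2 : emp_risk xs ys h - risk h <= E2.
    by have := w2 0%N; rewrite mulN1r opprB.
  have /andP[E10 E1_le] : 0 <= E1 <= _ := deviation_rate delta0 delta1 kap0 c20 (ltW s0) sqm sqL.
  have /andP[E20 E2_le] : 0 <= E2 <= _ := deviation_rate delta0 delta1 kap0 c30 (ltW s0) sqm sqL.
  have Lg2 : 2^-1 <= ln (2 / delta) by apply: half_le_ln; rewrite ler_pdivlMr// ler_piMr// ltW.
  move: lamb lamb2 hrisk hnorm; set lb := L^-1 `^ beta => lamb lamb2 hrisk hnorm.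
  have lb0 : 0 <= lb by exact: powR_ge0.
  pose Dev := E1 + E2 + c_beta * lb.
  have Dev0 : 0 <= Dev by rewrite !addr_ge0// mulr_ge0// ltW.
  have T0 : (0 < T)%N by exact: ltn_trans T3.
  (* Chain through the Bayes rule: E_z(f_t) >= E(f_t) - E1 >= E(f_c) - E1, while E(f_c) >= E(h) -
     c_beta lb and E(h) >= E_z(h) - E2. *)
  have lower t : (0 < t <= T)%N -> - Dev <= emp_risk xs ys (f t.-1) - emp_risk xs ys h.
    move=> tT; have [_ fct _] := excess_risk (Hf t.-1); have := dev1 t tT.
    by move: dev2 fct hrisk; rewrite /Dev; clear; lra.
  have := risk_le m xs ys T h Dev m0 ysP T0 Hh Dev0 lower; rewrite -/f -/L => emp_le.
  have TT : (0 < T <= T)%N by rewrite T0 leqnn.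
  have devT := dev1 T TT.
  have [_ _ mis] := excess_risk (Hf T.-1).
  apply: le_trans mis _.
  have hL : (N h ^+ 2 + 1) / L <= (c_beta + 1) * lb.
    by rewrite [leLHS]mulrC mulrDr mulr1 [leRHS]mulrDl mul1r lerD.
  have step1 : C * ((N h ^+ 2 + 1) / L + Dev) <= C * ((c_beta + 1) * lb + Dev).
    by rewrite ler_pM2l// lerD2r.
  have step2 : risk (f T.-1) - risk fc <=
      (C + 1) * (E1 + E2) + (C * (2 * c_beta + 1) + c_beta) * lb.
    by move: (le_trans emp_le step1) devT dev2 hrisk; rewrite /Dev; clear; lra.
  apply: le_trans step2 _.
  have p2 : 0 < C * (2 * c_beta + 1) + c_beta by rewrite addr_gt0// mulr_gt0// addr_gt0// mulr_gt0.
  have C10 : 0 < C + 1 by rewrite addr_gt0.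
  have step3 := ler_wpM2l (ltW C10) (lerD E1_le E2_le).
  have step4 := ler_wpM2l (ltW p2) lamb.
  have rm0 : 0 <= rm by exact: powR_ge0.
  (* The approximation term carries no logarithm; 2 ln (2 / delta) >= 1 supplies one. *)
  have step5 : (C * (2 * c_beta + 1) + c_beta) * rm <=
      (C * (2 * c_beta + 1) + c_beta) * rm * (2 * ln (2 / delta)).
    by rewrite ler_peMr ?mulr_ge0 ?(ltW p2)// -ler_pdivrMl// mulr1.
  apply: le_trans (lerD step3 (le_trans step4 step5)) _.
  by rewrite le_eqVlt; apply/orP; left; apply/eqP; ring.
have A12 := le_probability_setI mA1 mA2 QA1 QA2.
have := le_probability_setI mA0 (measurableI _ _ mA1 mA2) _ A12 => /(_ 0).
by rewrite QA0 subr0 add0r -splitr; apply.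
Qed.

End misclassification.

Theorem theorem4 (R : realType) (X : pseudoPMetricType R)
  (X_metric : hausdorff_space X)
  (X_separable : exists D : set X, countable D /\ dense D)
  (rho : probability (BorelX X * R)%type R)
  (rho_Y : rho [set z | z.2 = 1 \/ z.2 = -1] = 1%E)
  (etac : BorelX X -> R) (etac_cond : cond_prob_one rho etac)
  (K : X -> X -> R) (K_sym : kernel_sym K) (K_psd : kernel_psd K)
  (K_meas : forall x : X, measurable_fun [set: BorelX X] (K x))
  (H : set (X -> R)) (ip : (X -> R) -> (X -> R) -> R) (H_rkhs : is_RKHS K H ip)
  (kappa_fin : has_ubound (range (fun x => Num.sqrt (K x x))))
  (beta c_beta : R) (beta_range : 0 < beta <= 1) (c_beta_pos : 0 < c_beta)
  (A3 : forall lam : R, 0 < lam -> exists flam : X -> R,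
     H flam /\
     (forall g, H g ->
        (exp_risk rho (@hinge R) flam + (lam * rknorm ip flam ^+ 2)%:E
         <= exp_risk rho (@hinge R) g + (lam * rknorm ip g ^+ 2)%:E)%E) /\
     (exp_risk rho (@hinge R) flam - exp_risk rho (@hinge R) (bayes_rule etac)
        + (lam * rknorm ip flam ^+ 2)%:E <= (c_beta * lam `^ beta)%:E)%E)
  (zeta c_zeta : R) (zeta_range : 0 < zeta < 2) (c_zeta_pos : 0 < c_zeta)
  (A4 : forall (dO : measure_display) (Omega : measurableType dO)
     (P : probability Omega R) (m : nat) (Zs : 'I_m -> Omega -> (BorelX X * R)%type),
     iid_sample P rho Zs -> forall eps : R, 0 < eps ->
     (\int[P]_w log_covering_number (unit_ball H ip) eps
                  (d2 (fun j => (Zs j w).1 : X))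
        <= (c_zeta * eps `^ (- zeta))%:E)%E)
  (theta eta1 : R) (theta_range : 2^-1 < theta < 1)
  (eta1_pos : 0 < eta1)
  (eta1_le : eta1 <= Num.min (Num.sqrt (1 - theta) / (Num.sqrt 2 * (kappa K + 1)))
                             ((1 - theta) / 4)) :
  exists Ct : R, 0 < Ct /\
   (forall (m T : nat) (delta : R) (dO : measure_display) (Omega : measurableType dO)
      (P : probability Omega R) (Zs : 'I_m -> Omega -> (BorelX X * R)%type),
      iid_sample P rho Zs ->
      (T%:R : R) = (Num.ceil (m%:R `^ (1 / ((1 - theta) * (2 * beta + 1)))))%:~R ->
      (3 <= T)%N -> 0 < delta < 1 ->
      with_confidence P delta
        [set w | mis_risk rho
                   (sign (gd_iter K (left_deriv (@hinge R)) (stepsize eta1 theta)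
                            (fun j => (Zs j w).1 : X) (fun j => (Zs j w).2) T.-1))
                 - mis_risk rho (bayes_rule etac)
                 <= Ct * m%:R `^ (- (beta / (2 * beta + 1))) * ln (2 / delta)]) /\
   (forall eps : R, 0 < eps < 3^-1 -> (1 - 3 * eps) / (1 + 6 * eps) < beta ->
    forall (m T : nat) (delta : R) (dO : measure_display) (Omega : measurableType dO)
      (P : probability Omega R) (Zs : 'I_m -> Omega -> (BorelX X * R)%type),
      iid_sample P rho Zs ->
      (T%:R : R) = (Num.ceil (m%:R `^ (1 / ((1 - theta) * (2 * beta + 1)))))%:~R ->
      (3 <= T)%N -> 0 < delta < 1 ->
      with_confidence P delta
        [set w | mis_risk rho
                   (sign (gd_iter K (left_deriv (@hinge R)) (stepsize eta1 theta)
                            (fun j => (Zs j w).1 : X) (fun j => (Zs j w).2) T.-1))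
                 - mis_risk rho (bayes_rule etac)
                 <= Ct * m%:R `^ (eps - 3^-1) * ln (2 / delta)]).
Proof.
have [b bP] := kappa_fin.
(* A positive bound, since the deviation estimates divide by it; kappa itself may be 0. *)
pose kap := Num.max b 1.
have kap0 : 0 < kap by rewrite lt_max ltr01 orbT.
have Kkap x : K x x <= kap ^+ 2.
  have K0 : 0 <= K x x by rewrite (rk_repr H_rkhs x (rk_kern H_rkhs x)) (ip_ge0 H_rkhs (rkhsK H_rkhs x)).
  rewrite -(sqr_sqrtr K0) ler_sqr ?nnegrE ?sqrtr_ge0 ?(ltW kap0)//.
  by rewrite le_max bP//; exists x.
have A3' lam : 0 < lam -> exists flam : X -> R, H flam /\
    (exp_risk rho (@hinge R) flam - exp_risk rho (@hinge R) (bayes_rule etac)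
      + (lam * rknorm ip flam ^+ 2)%:E <= (c_beta * lam `^ beta)%:E)%E.
  by move=> /A3[h [Hh [_ hle]]]; exists h.
have entropy := ex_intro (fun C => exists zeta, _) c_zeta (ex_intro _ zeta (conj zeta_range A4)).
have [Ct Ct0 rate] := @misclassification_rate R _ (BorelX X) rho etac rho_Y etac_cond K H ip
  H_rkhs K_meas kap kap0 Kkap beta c_beta beta_range c_beta_pos A3' entropy theta eta1
  theta_range eta1_pos.
exists Ct; split=> //; split=> [|eps /andP[eps0 eps1] betaE] m T delta dO Omega P Zs iid TE T3 deltaP.
  exact: rate iid TE T3 deltaP.
have [A [mA [AE PA]]] := rate m T delta dO Omega P Zs iid TE T3 deltaP.
exists A; split=> //; split=> // w /AE /= /le_trans; apply.
have [m0 _ _ _] := early_stopping_time theta_range beta_range T3 TE.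
have [d0 d1] := andP deltaP; have [b0 b1] := andP beta_range.
rewrite ler_wpM2r//; first by rewrite ln_ge0// ler_pdivlMr//; lra.
(* As m >= 1, exponents are compared: - beta/(2 beta + 1) <= eps - 1/3 is equivalent to beta (1 + 6
   eps) >= 1 - 3 eps. *)
rewrite ler_pM2l//; apply: ler_powR; first by rewrite ler1n.
rewrite lerNl opprB ler_pdivlMr; last lra.
by move: betaE; rewrite ltr_pdivrMr; lra.
Qed.
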